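(* Consider a continuous-time Markov decision model as described in the context and suppose Assumptions A, B and C hold. (a) There exist a constant $g^*$, functions $u_1^*,u_2^*\in B_w(S)$ and a stationary policy $f^*\in F$ such that for all $x\in S$ $$g^*\ge\sup_{a\in A(x)}\Big\{r(x,a)+\int_S u_1^*(y)\,q(dy|x,a)\Big\},$$ $$g^*\le\sup_{a\in A(x)}\Big\{r(x,a)+\int_S u_2^*(y)\,q(dy|x,a)\Big\}=r(x,f^*(x))+\int_S u_2^*(y)\,q(dy|x,f^*(x)).$$ (b) For all $x\in S$, $g^*=\sup_{\pi\in\Pi}V(x,\pi)=V(x,f^* )$. (c) Any stationary policy $f\in F$ that attains the supremum in the second inequality of (a), i.e. $r(x,f(x))+\int_S u_2^*(y)q(dy|x,f(x))=\sup_{a\in A(x)}\{r(x,a)+\int_S u_2^*(y)q(dy|x,a)\}$ for all $x\in S$, is (average) optimal; in particular $f^*$ is an optimal stationary policy.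
   Context: Model: $S$ (state space) and $A$ (action space) are Polish spaces with Borel $\sigma$-algebras $\mathcal{B}(\cdot)$; for each $x\in S$, $A(x)\subset A$ is a Borel set of admissible actions, and $K:=\{(x,a):x\in S,a\in A(x)\}$ is a Borel subset of $S\times A$. Transition rates $q(\cdot|x,a)$, $(x,a)\in K$, satisfy: $q(\cdot|x,a)$ is a signed measure on $\mathcal{B}(S)$ and $q(D|\cdot,\cdot)$ is Borel measurable on $K$ for each $D$; $0\le q(D|x,a)<\infty$ whenever $x\notin D$; $q(S|x,a)=0$ and $0\le -q(\{x\}|x,a)<\infty$; and $q(x):=\sup_{a\in A(x)}(-q(\{x\}|x,a))<\infty$ for all $x$. The reward rate $r:K\to\mathbb{R}$ is measurable. $I_D$ denotes the indicator of $D$. Policies: a randomized Markov policy $\pi=(\pi_t)$ is a family $\pi_t(B|x)$, $t\ge0$, such that each $\pi_t(\cdot|x)$ is a stochastic kernel on $A$ given $S$ with $\pi_t(A(x)|x)=1$ and $t\mapsto\pi_t(B|x)$ is Borel measurable. It is admissible if $t\mapsto\int_{A(x)}h(a)\pi_t(da|x)$ is continuous for every $x$ and every bounded measurable $h$; $\Pi$ is the set of admissible policies. $F\subset\Pi$ is the set of (deterministic) stationary policies, i.e. measurable $f:S\to A$ with $f(x)\in A(x)$. Set $q(D|x,\pi_t):=\int_{A(x)}q(D|x,a)\pi_t(da|x)$ and $r(x,\pi_t):=\int_{A(x)}r(x,a)\pi_t(da|x)$. Assumption A: there exist a measurable $w\ge1$ on $S$ and constants $c>0$, $b\ge0$, $M_q>0$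 with $\int_S w(y)q(dy|x,a)\le -cw(x)+b$ for all $(x,a)\in K$ and $q(x)\le M_q w(x)$ for all $x\in S$. Processes: under Assumption A, for each $\pi\in\Pi$ the minimal transition function $p^\pi(s,x,t,D)$ with transition rates $q(D|x,\pi_t)$ (i.e. $\lim_{\varepsilon\downarrow0}\varepsilon^{-1}[p^\pi(t,x,t+\varepsilon,D)-I_D(x)]=q(D|x,\pi_t)$) is regular. $x(t)$ denotes the corresponding Markov jump process; $E_x^\pi$ is the expectation when started at $x$ at time $0$. Average criterion: $V(x,\pi):=\liminf_{T\to\infty}\frac1T\int_0^T E_x^\pi[r(x(t),\pi_t)]\,dt$. A policy $\pi^*\in\Pi$ is (average) optimal if $V(x,\pi^* )\ge V(x,\pi)$ for all $\pi\in\Pi$, $x\in S$. Discounted criterion: for $\alpha>0$, $J_\alpha(x,\pi):=\int_0^\infty e^{-\alpha t}E_x^\pi[r(x(t),\pi_t)]dt$ and $J_\alpha^*(x):=\sup_{\pi\in\Pi}J_\alpha(x,\pi)$. Assumption B: (1) each $A(x)$ is compact; (2) for each $x$, $r(x,a)$ is continuous in $a\in A(x)$, and $a\mapsto\int_S u(y)q(dy|x,a)$ is continuous on $A(x)$ for every bounded measurable $u$ and for $u=w$; (3) $|r(x,a)|\le Mw(x)$ for all $(x,a)\in K$ for some constant $M>0$; (4) there exist a nonnegative measurable $w'$ on $S$ and constants $c'>0$, $b'\ge0$, $M'>0$ with $q(x)w(x)\le M'w'(x)$ and $\int_S w'(y)q(dy|x,a)\le c'w'(x)+b'$ for all $(x,a)\in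 K$. $B_w(S)$ is the space of measurable $u$ on $S$ with $\sup_x|u(x)|/w(x)<\infty$. Assumption C: there exist $v_1,v_2\in B_w(S)$ and a state $x_0\in S$ such that $v_1(x)\le J_\alpha^*(x)-J_\alpha^*(x_0)\le v_2(x)$ for all $x\in S$ and all $\alpha>0$. *)

(* Defs.v *)
From HB Require Import structures.
From mathcomp Require Import all_boot all_order all_algebra.
From mathcomp Require Import all_classical all_reals all_analysis.
From mathcomp Require Import measurable_realfun.
Import Order.TTheory GRing.Theory Num.Theory.
Import numFieldNormedType.Exports.
Set Implicit Arguments.
Unset Strict Implicit.
Unset Printing Implicit Defensive.
Local Open Scope classical_set_scope.
Local Open Scope ring_scope.

(* A complete (pseudo)metric space which is Hausdorff (hence metric)
   and separable, i.e. a Polish space equipped with a compatible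
   complete metric. *)
Definition polish {R : realType} (T : completePseudoMetricType R) : Prop :=
  hausdorff_space T /\ exists D : set T, countable D /\ closure D = setT.

Definition borel (T : topologicalType) := g_sigma_algebraType (@open T).

Section cmdp.
Variables (R : realType) (S A : completePseudoMetricType R).
Local Notation SB := (borel S).
Local Notation AB := (borel A).
Local Notation leb := (@lebesgue_measure R).

(* Data of the model:
   - Aset x = A(x) (admissible actions);
   - qm x a = the (finite, nonnegative) jump measure of q(.|x,a) off the
     diagonal: q(D|x,a) = qm x a (D \ {x}) - I_D(x) qm x a (S \ {x});
   - r = reward rate. *)
Variables (Aset : S -> set A) (qm : S -> A -> {measure set SB -> \bar R})
  (r : S -> A -> R).

Definition K : set (SB * AB)%type := [set xa | Aset xa.1 xa.2].

Definition q (x : S) (a : A) (D : set S) : \bar R :=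
  qm x a (D `&` ~` [set x]) - (if `[< D x >] then qm x a (~` [set x]) else 0%E).

(* q(x) = sup_{a in A(x)} (- q({x}|x,a)) *)
Definition qx (x : S) : \bar R :=
  ereal_sup [set qm x a (~` [set x]) | a in Aset x].

(* \int_S u(y) q(dy|x,a) *)
Definition qint (u : S -> R) (x : S) (a : A) : \bar R :=
  (\int[qm x a]_(y in ~` [set x]) (u y)%:E - (u x)%:E * qm x a (~` [set x]))%E.

Definition model_ok : Prop :=
  polish S /\ polish A /\
  (forall x, measurable (Aset x : set AB)) /\
  measurable K /\
  (forall x a, Aset x a -> (qm x a (~` [set x]) < +oo)%E) /\
  (forall D : set SB, measurable D ->
     measurable_fun K (fun xa : SB * AB => q xa.1 xa.2 D)) /\
  (forall x, (qx x < +oo)%E) /\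
  measurable_fun K (fun xa : SB * AB => r xa.1 xa.2).

Definition policy := R -> S -> probability AB R.

Definition nonneg_times : set R := `[0, +oo[.

Definition markov_policy (pi : policy) : Prop :=
  (forall t x, 0 <= t -> pi t x (Aset x) = 1%E) /\
  (forall t (B : set AB), 0 <= t -> measurable B ->
     measurable_fun [set: SB] (fun x : SB => pi t x B)) /\
  (forall x (B : set AB), measurable B ->
     measurable_fun nonneg_times (fun t => pi t x B)).

Definition admissible (pi : policy) : Prop :=
  markov_policy pi /\
  forall x (h : AB -> R), measurable_fun [set: AB] h ->
    (exists C : R, forall a, `|h a| <= C) ->
    {within nonneg_times, continuous (fun t => (\int[pi t x]_a (h a)%:E)%E)}.

Definition stationary (f : S -> A) : Prop :=
  measurable_fun [set: SB] (f : SB -> AB) /\ forall x, Aset x (f x).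

Definition stat_policy (f : S -> A) : policy :=
  fun _ x => (@dirac _ AB (f x) R : probability AB R).

(* Minimal transition function (Feller's construction), via its action *)
(* on nonnegative functions                                            *)

(* q(x, pi_v) = - q({x}|x,pi_v) *)
Definition lam (pi : policy) (v : R) (x : S) : \bar R :=
  (\int[pi v x]_a qm x a (~` [set x]))%E.

Definition jump (pi : policy) (u : R) (x : S) (h : S -> \bar R) : \bar R :=
  (\int[pi u x]_a \int[qm x a]_(y in ~` [set x]) h y)%E.

Definition surv (pi : policy) (s u : R) (x : S) : \bar R :=
  expeR (- \int[leb]_(v in `[s, u]) lam pi v x)%E.

(* P n g s x = \int_S g(y) p^{(n)}(s,x,t,dy) for nonnegative g *)
Fixpoint Pn (pi : policy) (t : R) (g : S -> \bar R) (n : nat) : R -> S -> \bar R :=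
  match n with
  | 0%N => fun s x => (g x * surv pi s t x)%E
  | m.+1 => fun s x =>
      (\int[leb]_(u in `[s, t]) (surv pi s u x * jump pi u x (Pn pi t g m u)))%E
  end.

(* \int_S g(y) p^pi(s,x,t,dy) with p^pi = sum_n p^{(n)} the minimal
   transition function, for nonnegative g *)
Definition Pmin (pi : policy) (t : R) (g : S -> \bar R) (s : R) (x : S) : \bar R :=
  (\sum_(0 <= n <oo) Pn pi t g n s x)%E.

Definition rpi (pi : policy) (t : R) (y : S) : \bar R :=
  (\int[pi t y]_a (r y a)%:E)%E.

(* E_x^pi [ r(x(t), pi_t) ] = \int_S r(y,pi_t) p^pi(0,x,t,dy) *)
Definition Erew (pi : policy) (x : S) (t : R) : \bar R :=
  (Pmin pi t (fun y => maxe (rpi pi t y) 0) 0 x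
   - Pmin pi t (fun y => maxe (- rpi pi t y) 0) 0 x)%E.

Definition Vavg (pi : policy) (x : S) : \bar R :=
  limf_einf (fun T : R => ((T^-1)%:E * \int[leb]_(t in `[0%R, T]) Erew pi x t)%E)
    (pinfty_nbhs R).

Definition Jdisc (alpha : R) (pi : policy) (x : S) : \bar R :=
  (\int[leb]_(t in nonneg_times) ((expR (- (alpha * t)))%:E * Erew pi x t))%E.

Definition Jopt (alpha : R) (x : S) : \bar R :=
  ereal_sup [set Jdisc alpha pi x | pi in admissible].

Definition avg_optimal (pi : policy) : Prop :=
  admissible pi /\ forall pi' x, admissible pi' -> (Vavg pi' x <= Vavg pi x)%E.

Definition in_Bw (w : S -> R) (u : S -> R) : Prop :=
  measurable_fun [set: SB] (u : SB -> R) /\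
  exists C : R, forall x, `|u x| <= C * w x.

Definition assumptionA (w : S -> R) : Prop :=
  measurable_fun [set: SB] (w : SB -> R) /\ (forall x, 1 <= w x) /\
  exists c b Mq : R, 0 < c /\ 0 <= b /\ 0 < Mq /\
    (forall x a, Aset x a -> (qint w x a <= (- (c * w x) + b)%:E)%E) /\
    (forall x, (qx x <= (Mq * w x)%:E)%E).

Definition assumptionB (w : S -> R) : Prop :=
  (forall x, compact (Aset x)) /\
  (forall x, {within Aset x, continuous (r x)}) /\
  (forall x (u : S -> R), measurable_fun [set: SB] (u : SB -> R) ->
     (exists C : R, forall y, `|u y| <= C) ->
     {within Aset x, continuous (qint u x)}) /\
  (forall x, {within Aset x, continuous (qint w x)}) /\
  (exists M : R, 0 < M /\ forall x a, Aset x a -> `|r x a| <= M * w x) /\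
  (exists (w' : S -> R) (c' b' M' : R),
     measurable_fun [set: SB] (w' : SB -> R) /\ (forall x, 0 <= w' x) /\
     0 < c' /\ 0 <= b' /\ 0 < M' /\
     (forall x, (qx x * (w x)%:E <= (M' * w' x)%:E)%E) /\
     (forall x a, Aset x a -> (qint w' x a <= (c' * w' x + b')%:E)%E)).

Definition assumptionC (w : S -> R) : Prop :=
  exists (v1 v2 : S -> R) (x0 : S), in_Bw w v1 /\ in_Bw w v2 /\
    forall x alpha, 0 < alpha ->
      ((v1 x)%:E <= Jopt alpha x - Jopt alpha x0)%E /\
      (Jopt alpha x - Jopt alpha x0 <= (v2 x)%:E)%E.

Definition opt_rhs (u : S -> R) (x : S) : \bar R :=
  ereal_sup [set ((r x a)%:E + qint u x a)%E | a in Aset x].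

End cmdp.

(* Main.v *)
Require Import Defs.
From HB Require Import structures.
From mathcomp Require Import all_boot all_order all_algebra.
From mathcomp Require Import all_classical all_reals all_analysis.
From mathcomp Require Import measurable_realfun.
From mathcomp Require Import ring lra zify.
Import Order.TTheory GRing.Theory Num.Theory.
Import numFieldNormedType.Exports.
Local Open Scope classical_set_scope.
Local Open Scope ring_scope.

(* Value iteration downwards from a multiple of the Lyapunov function [w] solves the discounted
   optimality equation [alpha u = sup_a (r + q u)]: by compactness of [A(x)] the supremum commutes
   with decreasing limits, and Borel maximizers exist because the projection of a Borel set with
   compact sections is Borel (separation of analytic sets).
   The minimal process is Feller's series of jump terms, which satisfies the forward equation.
   Applied to [w'], [w] and [1] this equation gives [E w(x(t)) <= w + b/c] and non-explosion;
   applied to [u] it bounds the discounted reward of every policy by [u], with equality for a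
   maximizing stationary policy, so that [J*_alpha = u_alpha].
   Along [alpha_n -> 0] with [alpha_n u_n(x0) -> g], the lower and upper limits of [u_n - u_n(x0)]
   solve the two average optimality inequalities, and the case [alpha = 0] of the same bound
   controls the long-run averages. *)

Set Implicit Arguments.
Unset Strict Implicit.
Unset Printing Implicit Defensive.

(** * Analytic sets and measurable selection *)

(** Nothing beyond measurability is assumed about the dependence of [Aset x], [qm x a] and [r x a]
    on [x], and [S] may be uncountable. No diagonal argument then makes the relative discounted
    values converge pointwise; lower and upper limits replace the limit, and each of them yields
    only one inequality. For the same reason a Borel maximizer cannot come from semicontinuity in
    [x], and projections of Borel sets have to be controlled. The rates are unbounded, so inflow and
    outflow in the forward equation may both be infinite. Identities are therefore first written
    between sums of nonnegative terms, and terms are subtracted only once [w'] has made them finite: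
    q(x) w(x) is at most a multiple of [w'], whose mean is finite at all times. A function [u] of
    either sign enters as the difference of u + C w and C w. Since |r| <= M w and [w] has drift at
    most -c w + b, the function (M/c) (w + b/alpha) is a supersolution for the discount rate alpha;
    this is where value iteration starts. Lower bounds on rewards are upper bounds for -r and -u. *)

Section analytic.
Context {X : topologicalType}.
Implicit Types (E : set X) (F : seq nat -> set X).

(** The limit [y] has to lie in [E] only, not in the sets of the branch, so the members of a scheme
    may fail to be closed. *)
Definition complete_scheme E F := forall n : nat -> nat,
  (forall k, F (mkseq n k) !=set0) ->
  exists2 y, E y & forall U, nbhs y U -> exists k, F (mkseq n k) `<=` U.

Definition souslin_scheme E F := [/\ F [::] = E,
  (forall s, F s `<=` \bigcup_j F (rcons s j)),
  (forall s j, F (rcons s j) `<=` F s) & complete_scheme E F].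

(** In a Hausdorff space every point of [E] lies on a branch that shrinks to it, so that [E] is
    parametrized by infinite words. In this form countable operations on sets become operations on
    words. *)
Definition analytic E := exists F, souslin_scheme E F.

(** A branch that may pause: when several schemes are interleaved, each of them receives a new
    letter only at some of the steps. *)
Definition chain (t : nat -> seq nat) :=
  t 0%N = [::] /\ forall k, t k.+1 = t k \/ exists j, t k.+1 = rcons (t k) j.

Lemma chain_prefix t : chain t -> forall i j, (i <= j)%N -> prefix (t i) (t j).
Proof.
move=> [_ h] i j; elim: j => [|j IH]; first by rewrite leqn0 => /eqP ->; exact: prefix_refl.
rewrite leq_eqVlt => /orP[/eqP ->|]; first exact: prefix_refl.
rewrite ltnS => /IH /prefix_trans; apply.
by case: (h j) => [->|[l ->]]; [exact: prefix_refl|exact: prefix_rcons].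
Qed.

Lemma scheme_prefix E F : souslin_scheme E F ->
  forall s s', prefix s s' -> F s' `<=` F s.
Proof.
move=> [_ _ h _] s s' /prefixP[p ->].
elim/last_ind: p => [|p a IH]; first by rewrite cats0.
by rewrite -rcons_cat; apply: subset_trans IH; exact: h.
Qed.

(** The words of the chain are prefixes of one infinite word, to whose branch completeness
    applies. *)
Lemma scheme_chain E F t : souslin_scheme E F -> chain t ->
  (forall m, exists k, (m <= size (t k))%N) -> (forall k, F (t k) !=set0) ->
  exists2 y, E y & forall U, nbhs y U -> exists k, F (t k) `<=` U.
Proof.
move=> sF ct tinf tn0.
have [_ _ _ cF] := sF.
have [kp kpP] := choice tinf.
(* The word at [kp i.+1] has more than [i] letters, so its letter number [i] exists, and later words
   do not change it. *)
pose n i := nth 0%N (t (kp i.+1)) i.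
have nE m k : (m <= size (t k))%N -> mkseq n m = take m (t k).
  move=> mk; apply: (@eq_from_nth _ 0%N) => [|i].
    by rewrite size_mkseq size_take; case: ltngtP mk.
  rewrite size_mkseq => im; rewrite nth_mkseq// nth_take//.
  have ik := leq_trans im mk; have ik' := kpP i.+1.
  rewrite /n; case: (leqP k (kp i.+1)) => [|/ltnW] /(chain_prefix ct)/prefixP[p pE].
    by rewrite pE nth_cat ik.
  by rewrite pE nth_cat ik'.
have sub m k : (m <= size (t k))%N -> F (t k) `<=` F (mkseq n m).
  by move=> mk; rewrite (nE _ _ mk); apply: (scheme_prefix sF); exact: prefix_take.
have [|y Ey yP] := cF n.
  by move=> m; have [x p] := tn0 (kp m); exists x; apply: sub p.
exists y => // U /yP[m mU]; exists (kp m).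
exact: subset_trans (sub _ _ (kpP m)) mU.
Qed.

End analytic.

(** Distributes the positions of a word among countably many coordinates: the 2-adic valuation of
    [k.+1] takes every value infinitely often. *)
Definition coord (k : nat) : nat := logn 2 k.+1.

Lemma coord_unbounded i m : exists2 k, (m <= k)%N & coord k = i.
Proof.
have e : (0 < 2 ^ i * (2 * m).+1)%N by rewrite muln_gt0 expn_gt0.
exists ((2 ^ i * (2 * m).+1).-1).
  rewrite -ltnS prednK// (leq_trans _ (leq_pmull _ _)) ?expn_gt0//.
  by rewrite ltnS leq_pmull.
rewrite /coord prednK// lognM ?expn_gt0// pfactorK//.
rewrite lognE /= dvdn2 /= mul2n odd_double /=; lia.
Qed.

Definition subword (i : nat) (s : seq nat) :=
  mask [seq coord k == i | k <- iota 0 (size s)] s.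

Lemma subword_rcons i s j : subword i (rcons s j) =
  if coord (size s) == i then rcons (subword i s) j else subword i s.
Proof.
rewrite /subword size_rcons -addn1 iotaD map_cat /= add0n cats1.
rewrite mask_rcons ?size_map ?size_iota//.
by case: ifP => _ /=; rewrite ?cats1 ?cats0.
Qed.

Lemma subword_chain i (t : nat -> seq nat) : t 0%N = [::] ->
  (forall k, exists j, t k.+1 = rcons (t k) j) ->
  chain (subword i \o t) /\ forall m, exists k, (m <= size (subword i (t k)))%N.
Proof.
move=> t0 tS.
have szt k : size (t k) = k.
  by elim: k => [|k IH]; [rewrite t0|have [j ->] := tS k; rewrite size_rcons IH].
have ch : chain (subword i \o t).
  split=> [|k]; first by rewrite /= t0.
  have [j /= ->] := tS k; rewrite subword_rcons; case: ifP => _; last by left.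
  by right; exists j.
split=> //; elim=> [|m [k mk]]; first by exists 0%N.
have [k' kk' ck'] := coord_unbounded i k.
exists k'.+1; have [j ->] := tS k'.
rewrite subword_rcons szt ck' eqxx size_rcons ltnS.
apply: leq_trans mk _.
by have /prefixP[p /= ->] := chain_prefix ch kk'; rewrite size_cat leq_addr.
Qed.

Lemma hausdorffP (X : topologicalType) : hausdorff_space X -> forall x y : X, x != y ->
  exists U V, [/\ nbhs x U, nbhs y V, open U, open V & U `&` V `<=` set0].
Proof.
rewrite open_hausdorff => h x y /h[[U V] /= [xU yV] [oU oV UV]].
exists U, V; split=> //; try by apply: open_nbhs_nbhs; split=> //; exact: set_mem.
by rewrite (eqP UV).
Qed.

(** * Closure properties of analytic sets *)

Section analytic_ops.
Context {X : topologicalType}.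
Implicit Types (E : set X).

Lemma analytic_image (Y : topologicalType) (f : X -> Y) E :
  continuous f -> analytic E -> analytic (f @` E).
Proof.
move=> cf [F [F0 F1 F2 F3]]; exists (fun s => f @` F s); split.
- by rewrite F0.
- by move=> s _ [x /F1[j _ Fx] <-]; exists j => //; exists x.
- by move=> s j _ [x /F2 Fx <-]; exists x.
- move=> n h; have [|y Ey yP] := F3 n.
    by move=> k; have [_ [x Fx _]] := h k; exists x.
  exists (f y); first by exists y.
  move=> U /cf /yP[k kU]; exists k => _ [x /kU Ux <-] //.
Qed.

(** The limit of a branch stays in [C] because every neighbourhood of it contains a nonempty set of
    the branch, which meets [C]. *)
Lemma analytic_closedI C E : closed C -> analytic E -> analytic (C `&` E).
Proof.
move=> cC [F [F0 F1 F2 F3]]; exists (fun s => C `&` F s); split.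
- by rewrite F0.
- by move=> s x [Cx /F1[j _ Fx]]; exists j.
- by move=> s j x [Cx /F2 Fx].
- move=> n h; have [|y Ey yP] := F3 n.
    by move=> k; have [x [_ Fx]] := h k; exists x.
  exists y => [|U /yP[k kU]]; last by exists k => x [_ /kU].
  split=> //; apply: contrapT => nCy.
  have [|k kC] := yP (~` C).
    by apply: open_nbhs_nbhs; split=> //; exact: closed_openC.
  by have [x [Cx /kC]] := h k.
Qed.

Lemma analytic_bigcup (E : nat -> set X) : (forall i, analytic (E i)) ->
  analytic (\bigcup_i E i).
Proof.
move=> /choice[F sF].
(* The first letter selects one of the sets, the remaining letters run through its scheme. *)
exists (fun s => if s is i :: s' then F i s' else \bigcup_i E i); split=> //.
- case=> [|i s] x.
    by move=> [i _ Ex]; exists i => //=; have [-> _ _ _] := sF i.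
  by have [_ h _ _] := sF i; move=> /h.
- case=> [|i s] j x /=; last by have [_ _ h _] := sF i; exact: h.
  by have [-> _ _ _] := sF j => Ex; exists j.
- move=> n h.
  have [F0 _ _ F3] := sF (n 0%N).
  have e k : mkseq n k.+1 = n 0%N :: mkseq (n \o S) k.
    by rewrite /mkseq /= -[1%N]addn0 iotaDl -map_comp.
  have [|y Ey yP] := F3 (n \o S).
    by move=> k; have := h k.+1; rewrite e.
  exists y; first by exists (n 0%N).
  by move=> U /yP[k kU]; exists k.+1; rewrite e.
Qed.

(** All schemes run at once, the letter at position [k] being read by the scheme number [coord k].
    Their limits agree: disjoint neighbourhoods of two limits would both contain the same late
    nonempty intersection. *)
Lemma analytic_bigcap (E : nat -> set X) : hausdorff_space X ->
  (forall i, analytic (E i)) -> analytic (\bigcap_i E i).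
Proof.
move=> hX /choice[F sF].
exists (fun s => \bigcap_i F i (subword i s)); split=> //.
- by apply: eq_bigcapr => i _; have [] := sF i.
- move=> s x Fx; pose i := coord (size s).
  have [_ /(_ (subword i s) x (Fx i I))[j _ xj] _ _] := sF i.
  exists j => // i' _; rewrite subword_rcons.
  by case: ifP => [/eqP <-//|_]; exact: Fx.
- move=> s j x Fx i _; have := Fx i I; rewrite subword_rcons.
  by case: ifP => // _; have [_ _ + _] := sF i; exact.
- move=> n h; pose t := mkseq n.
  have tS k : exists j, t k.+1 = rcons (t k) j.
    by exists (n k); rewrite /t mkseqS.
  have t0 : t 0%N = [::] by [].
  have /choice[y yP] : forall i, exists y, E i y /\
      forall U, nbhs y U -> exists k, F i (subword i (t k)) `<=` U.
    move=> i; have [ch un] := subword_chain i t0 tS.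
    have [|y Ey yP] := scheme_chain (sF i) ch un.
      by move=> k; have [x Fx] := h k; exists x; exact: Fx.
    by exists y.
  have mono i : forall k l, (k <= l)%N -> F i (subword i (t l)) `<=` F i (subword i (t k)).
    move=> k l kl; apply: (scheme_prefix (sF i)).
    have [ch _] := subword_chain i t0 tS; exact: (chain_prefix ch kl).
  have yE i : y i = y 0%N.
    apply: contrapT => /eqP /(hausdorffP hX)[U [V [yU yV _ _ UV]]].
    have [k kU] := (yP i).2 U yU; have [l lV] := (yP 0%N).2 V yV.
    have [x Fx] := h (maxn k l).
    apply: (UV x); split.
      by apply: kU; apply: mono (Fx i I); exact: leq_maxl.
    by apply: lV; apply: mono (Fx 0%N I); exact: leq_maxr.
  exists (y 0%N); first by move=> i _; rewrite -(yE i); exact: (yP i).1.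
  move=> U /(yP 0%N).2[k kU]; exists k => x Fx; apply: kU; exact: Fx.
Qed.

End analytic_ops.

Lemma analytic_prod (X Y : topologicalType) (E : set X) (E' : set Y) :
  analytic E -> analytic E' -> analytic (E `*` E').
Proof.
move=> [F sF] [G sG].
(* Each letter encodes one letter for either factor. *)
pose p (i : nat) : nat * nat := odflt (0, 0)%N (unpickle i).
have pK i j : p (pickle (i, j)) = (i, j) by rewrite /p pickleK.
pose a s := map (fst \o p) s; pose b s := map (snd \o p) s.
exists (fun s => F (a s) `*` G (b s)); split=> //.
- by rewrite /= /setX; have [-> _ _ _] := sF; have [-> _ _ _] := sG.
- move=> s [x y] [/= Fx Gy].
  have [_ /(_ _ _ Fx)[i _ Fi] _ _] := sF; have [_ /(_ _ _ Gy)[j _ Gj] _ _] := sG.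
  by exists (pickle (i, j)) => //; split; rewrite /a /b map_rcons /= pK.
- move=> s j [x y] [/=]; rewrite /a /b !map_rcons.
  have [_ _ h _] := sF; have [_ _ h' _] := sG.
  by move=> /h Fx /h' Gy.
- move=> n h.
  have ea k : a (mkseq n k) = mkseq (fst \o p \o n) k by rewrite /a /mkseq -map_comp.
  have eb k : b (mkseq n k) = mkseq (snd \o p \o n) k by rewrite /b /mkseq -map_comp.
  have [_ _ _ cF] := sF; have [_ _ _ cG] := sG.
  have [|x Ex xP] := cF (fst \o p \o n).
    by move=> k; rewrite -ea; have [[u v] [/= ? _]] := h k; exists u.
  have [|y Ey yP] := cG (snd \o p \o n).
    by move=> k; rewrite -eb; have [[u v] [/= _ ?]] := h k; exists v.
  have mono (Z : topologicalType) (C : set Z) H c : souslin_scheme C H -> forall k l, (k <= l)%N ->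
      H (mkseq c l) `<=` H (mkseq c k).
    move=> sH k l kl; apply: (scheme_prefix sH).
    rewrite /mkseq -(subnKC kl) iotaD map_cat; exact: prefix_prefix.
  exists (x, y) => // U [[U1 U2] /= [/xP[k kU] /yP[l lU] UU]].
  exists (maxn k l) => -[u v] [/=]; rewrite ea eb => Fu Gv; apply: UU; split => /=.
    by apply: kU; apply: (mono _ _ _ _ sF) Fu; exact: leq_maxl.
  by apply: lU; apply: (mono _ _ _ _ sG) Gv; exact: leq_maxr.
Qed.

(** * Simultaneous separation of analytic sets by Borel sets *)

Section separation.
Context {Z : topologicalType} {X : ptopologicalType}.

(** If every [T i] is the whole space, this says that no point of the image of [Q] lies in all the
    Borel hulls [B i]. In general [T] restricts which hulls may be used to exclude [f q]; below,
    [T i] consists of the codes that begin with the word number [i]. *)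
Definition separated_by (Q : set Z) (E : nat -> set X) (f : Z -> X) (T : nat -> set Z) :=
  exists B : nat -> set (borel X), [/\ (forall i, measurable (B i)),
    (forall i, E i `<=` B i) & forall q, Q q -> exists i, T i q /\ ~ B i (f q)].

Lemma separated_by_bigcup0 Q (Q' : nat -> set Z) E f T : Q `<=` \bigcup_j Q' j ->
  (forall j, separated_by (Q' j) E f T) -> separated_by Q E f T.
Proof.
move=> QQ' /choice[B BP].
exists (fun i => \bigcap_j B j i); split.
- by move=> i; apply: bigcapT_measurable => j; have [] := BP j.
- by move=> i x Ex j _; have [_ + _] := BP j; exact.
- move=> q /QQ'[j _ Q'q]; have [_ _ /(_ _ Q'q)[i [Tq nB]]] := BP j.
  by exists i; split=> // /(_ j I).
Qed.

Lemma separated_by_bigcup i0 Q E (E' : nat -> nat -> set X) f T :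
  E i0 `<=` \bigcup_j E' j i0 -> (forall j i, i != i0 -> E i `<=` E' j i) ->
  (forall j, separated_by Q (E' j) f T) -> separated_by Q E f T.
Proof.
move=> EE' EE /choice[B BP].
(* The hulls of the pieces are united at the index that was split and intersected at the others. If
   [f q] lies in the union, the piece [j] whose hull contains it must exclude [f q] at another
   index. *)
exists (fun i => if i == i0 then \bigcup_j B j i else \bigcap_j B j i); split.
- move=> i; case: ifP => _.
    by apply: bigcupT_measurable => j; have [] := BP j.
  by apply: bigcapT_measurable => j; have [] := BP j.
- move=> i; case: ifP => [/eqP ->|/negbT i0i] x.
    by move=> /EE'[j _ Ex]; exists j => //; have [_ + _] := BP j; exact.
  by move=> Ex j _; have [_ + _] := BP j; apply; exact: EE Ex.
- move=> q Qq.
  have [i0P|] := pselect (T i0 q /\ ~ (\bigcup_j B j i0) (f q)).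
    by exists i0; rewrite eqxx.
  move=> /not_andP.
  have [Tq|nTq] := pselect (T i0 q).
    case=> [//|/contrapT[j _ Bj]].
    have [_ _ /(_ _ Qq)[i [Ti nB]]] := BP j.
    exists i; split=> //; case: eqP => [ii0|_]; first by rewrite ii0 in nB.
    by move=> /(_ j I).
  move=> _; have [_ _ /(_ _ Qq)[i [Ti nB]]] := BP 0%N.
  exists i; split=> //; case: eqP => [ii0|_]; first by rewrite ii0 in Ti.
  by move=> /(_ 0%N I).
Qed.

(* Lusin's and Novikov's separation theorems are both instances of this lemma. *)
Lemma separation (Q : set Z) (E : nat -> set X) (f : Z -> X) (T : nat -> set Z) :
  hausdorff_space X -> analytic Q -> (forall i, analytic (E i)) ->
  continuous f -> (forall i, open (T i)) ->
  (forall q, Q q -> exists i, T i q /\ ~ E i (f q)) -> separated_by Q E f T.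
Proof.
move=> hX [G sG] /choice[F sF] cf oT QE.
(* Coordinate 0 of the word drives the scheme of [Q], coordinate [i.+1] that of [E i]. *)
pose sep s := separated_by (G (subword 0 s)) (fun i => F i (subword i.+1 s)) f T.
suff : sep [::].
  rewrite /sep; have [-> _ _ _] := sG.
  by congr (separated_by _ _ _ _); apply/funext => i; have [-> _ _ _] := sF i.
(* A word is separated as soon as all its children are, so failure at the root propagates along an
   infinite branch. *)
apply: contrapT => nsep.
have step s : exists j, ~ sep s -> ~ sep (rcons s j).
  apply: contrapT => /forallNP h.
  have {}h j : ~ sep s /\ sep (rcons s j) by have /not_implyP[? /contrapT] := h j.
  have [ns _] := h 0%N; apply: ns; have {}h j := (h j).2.
  rewrite /sep; case c0 : (coord (size s) == 0%N).
    apply: (@separated_by_bigcup0 _ (fun j => G (subword 0 (rcons s j)))).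
      by rewrite (funext (fun j => congr1 G (subword_rcons 0 s j))) c0; have [_ h0 _ _] := sG; exact: h0.
    move=> j; have := h j; rewrite /sep; congr (separated_by _ _ _ _).
    apply/funext => i; rewrite subword_rcons.
    by rewrite (eqP c0).
  apply: (@separated_by_bigcup (coord (size s)).-1 _ _ (fun j i => F i (subword i.+1 (rcons s j)))).
  - move=> x Fx.
    have [_ /(_ _ _ Fx)[j _ Fj] _ _] := sF (coord (size s)).-1.
    by exists j => //; rewrite subword_rcons prednK ?lt0n ?c0// eqxx; rewrite prednK ?lt0n ?c0// in Fj.
  - move=> j i ii0; rewrite subword_rcons.
    by case: eqP => [ci|_ //]; rewrite ci eqxx in ii0.
  - by move=> j; have := h j; rewrite /sep subword_rcons c0.
have [g gP] := choice step.
pose t := fix t k := if k is k'.+1 then rcons (t k') (g (t k')) else [::].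
have tsep k : ~ sep (t k) by elim: k => //= k; exact: gP.
have t0 : t 0%N = [::] by [].
have tS k : exists j, t k.+1 = rcons (t k) j by eexists.
have [ch un] := subword_chain 0 t0 tS.
have [|q Qq qP] := scheme_chain sG ch un.
  move=> k; apply: contrapT => /set0P/negP/negPn/eqP /= G0.
  apply: (tsep k); exists (fun=> setT); split=> // q; by rewrite G0.
have Gmono k l : (k <= l)%N -> G (subword 0 (t l)) `<=` G (subword 0 (t k)).
  by move=> kl; apply: (scheme_prefix sG); exact: (chain_prefix ch kl).
have [i [Tq nEq]] := QE q Qq.
have [k0 k0T] := qP _ (open_nbhs_nbhs (conj (oT i) Tq)).
have [ch' un'] := subword_chain i.+1 t0 tS.
have Fmono k l : (k <= l)%N -> F i (subword i.+1 (t l)) `<=` F i (subword i.+1 (t k)).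
  by move=> kl; apply: (scheme_prefix (sF i)); exact: (chain_prefix ch' kl).
(* If the scheme of [E i] became empty along the branch, the empty hull for [E i] would separate
   once the piece of [Q] lies in [T i]. Hence this branch has a limit [y] in [E i] as well, and [y]
   differs from [f q]. *)
have [|y Ey yP] := scheme_chain (sF i) ch' un'.
  move=> k; apply: contrapT => /set0P/negP/negPn/eqP /= F0.
  apply: (tsep (maxn k k0)); exists (fun j => if j == i then set0 else setT); split.
  - by move=> j; case: ifP.
  - move=> j x; case: ifP => [/eqP -> Fx|//].
    by move: (Fmono _ _ (leq_maxl k k0) _ Fx); rewrite F0.
  - move=> q' Gq'; exists i; rewrite eqxx; split=> //.
    by apply: k0T; apply: Gmono Gq'; exact: leq_maxr.
have /eqP /(hausdorffP hX)[U [V [qU yV _ oV UV]]] : f q <> y.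
  by move=> fy; rewrite fy in nEq.
have [l lV] := yP V yV.
have [k kU] := qP _ (cf q _ qU).
(* At a late stage [f] maps the piece of [Q] into [U], which is disjoint from [V], so the hull [V]
   of [E i] separates. *)
apply: (tsep (maxn (maxn k k0) l)); exists (fun j => if j == i then V else setT); split.
- by move=> j; case: ifP => // _; exact: sub_sigma_algebra.
- move=> j x; case: ifP => [/eqP -> Fx|//].
  by apply: lV; apply: Fmono Fx; exact: leq_maxr.
- move=> q' Gq'; exists i; rewrite eqxx; split.
    by apply: k0T; apply: Gmono Gq'; rewrite -maxnA leq_max leq_maxl orbT.
  move=> Vq'; apply: (UV (f q')); split=> //.
  by apply: kU; apply: Gmono Gq'; rewrite -maxnA leq_maxl.
Qed.

End separation.

(** * Cantor space, Polish spaces and their Borel sets are analytic *)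

Lemma analytic_cantor : analytic [set: cantor_space].
Proof.
have nb (z : cantor_space) U : nbhs z U ->
    exists k, forall z' : cantor_space, (forall i, (i < k)%N -> z' i = z i) -> U z'.
  move=> zU; apply: contrapT => /forallNP h.
  have {h} /choice[z' z'P] : forall k, exists z' : cantor_space,
      (forall i, (i < k)%N -> z' i = z i) /\ ~ U z'.
    by move=> k; have /existsNP[z' /not_implyP[]] := h k; exists z'.
  have cz : z' @ \oo --> z.
    apply/cvg_sup => i; apply/cvg_image.
      apply/seteqP; split=> // b _; exists (fun=> b) => //.
    move=> W Wz; exists (proj i @^-1` W); last first.
      apply/seteqP; split=> [_ [u Wu <-] //|b Wb]; exists (fun=> b) => //.
    exists i.+1 => // k /= ik; rewrite /proj (z'P k).1//.
    exact: nbhs_singleton Wz.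
  have [k _ /(_ k (leqnn k)) /=] := cz U zU.
  exact: (z'P k).2.
(* Letters are natural numbers and are read modulo 2. *)
exists (fun s => [set z : cantor_space | forall k, (k < size s)%N -> z k = odd (nth 0%N s k)]); split.
- by apply/seteqP; split.
- move=> s z /= h; exists (nat_of_bool (z (size s))) => // k.
  rewrite size_rcons ltnS leq_eqVlt nth_rcons => /orP[/eqP ->|ks].
    by rewrite ltnn eqxx; case: (z _).
  by rewrite ks h.
- move=> s j z /= h k ks; have := h k; rewrite size_rcons nth_rcons ks; apply.
  exact: ltnW.
- move=> n h; exists (odd \o n) => // U /nb[k kU]; exists k => z /= hz.
  apply: kU => i ik; rewrite hz ?size_mkseq// nth_mkseq//.
Qed.

Definition dense_seq (R : realType) (T : completePseudoMetricType R) (d : nat -> T) :=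
  forall x (e : R), 0 < e -> exists k, ball (d k) e x.

Lemma polish_dense_seq (R : realType) (T : completePseudoMetricType R) :
  polish T -> exists d : nat -> T, dense_seq d.
Proof.
move=> [_ [D [cD dD]]].
have Dball x (e : R) : 0 < e -> exists2 y, D y & ball y e x.
  move=> e0; have : closure D x by rewrite dD.
  by move=> /(_ _ (nbhsx_ballx x e e0))[y [Dy xy]]; exists y => //; exact: ball_sym.
have [D0|[f]] := pfcard_geP cD.
  by have [y] := Dball point 1 ltr01; rewrite D0.
exists f => x e e0; have [y Dy yx] := Dball x e e0.
by have [k _ ky] := @surj _ _ _ _ f _ Dy; exists k; rewrite ky.
Qed.

Lemma analytic_polish (R : realType) (T : completePseudoMetricType R) :
  polish T -> analytic [set: T].
Proof.
move=> /polish_dense_seq[d dP].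
pose e (k : nat) : R := k.+1%:R^-1.
have e0 k : 0 < e k by rewrite invr_gt0.
have esmall (eps : R) : 0 < eps -> exists k, e k < eps.
  move=> eps0; have [N _ /(_ N (leqnn N))] := near_infty_natSinv_lt (PosNum eps0).
  by exists N.
(* The letter at position [k] names a point of the dense sequence within [e k]. Points chosen along
   a branch then form a Cauchy sequence and converge by completeness. *)
exists (fun s => [set x | forall k, (k < size s)%N -> ball (d (nth 0%N s k)) (e k) x]); split.
- by apply/seteqP; split.
- move=> s x /= h; have [j jx] := dP x _ (e0 (size s)); exists j => // k.
  rewrite size_rcons ltnS leq_eqVlt nth_rcons => /orP[/eqP ->|ks].
    by rewrite ltnn eqxx.
  by rewrite ks; exact: h.
- move=> s j z /= h k ks; have := h k; rewrite size_rcons nth_rcons ks; apply.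
  exact: ltnW.
- move=> n /choice[x xP].
  have xb k l : (k < l)%N -> ball (d (n k)) (e k) (x l).
    by move=> kl; have := xP l k; rewrite size_mkseq nth_mkseq//; exact.
  have : cvg (x @ \oo).
    apply/cauchy_cvgP/cauchy_exP => eps /esmall[k kP]; exists (d (n k)).
    by exists k.+1 => // l /= kl; apply: le_ball (xb _ _ kl); exact: ltW.
  move=> /cvg_ex[y xy]; exists y => // U /nbhs_ballP[eps /= eps0 epsU].
  have [k kP] := esmall (eps / 4) (divr_gt0 eps0 (ltr0Sn _ 3)).
  exists k.+1 => z /(_ k); rewrite size_mkseq nth_mkseq// => /(_ (ltnSn k)) zk.
  apply: epsU.
  have /(_ _ (nbhsx_ballx y (eps / 4) (divr_gt0 eps0 (ltr0Sn _ 3)))) [l _ lP] := xy.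
  have yx := lP (maxn l k.+1) (leq_maxl _ _).
  have xk := xb k (maxn l k.+1) (leq_maxr _ _).
  have dk : ball (x (maxn l k.+1)) (e k + e k) z.
    by apply: ball_triangle zk; exact: ball_sym.
  apply: le_ball (ball_triangle yx dk).
  by lra.
Qed.

Section bianalytic.
Context {X : topologicalType}.
Implicit Types (E : set X).

(** Unlike analyticity, this property is stable under complements and so passes from generators to
    the sigma-algebra. *)
Definition bianalytic E := analytic E /\ analytic (~` E).

Lemma bianalyticC E : bianalytic E -> bianalytic (~` E).
Proof. by move=> [? ?]; split=> //; rewrite setCK. Qed.

Lemma bianalytic_bigcup (E : nat -> set X) : hausdorff_space X ->
  (forall i, bianalytic (E i)) -> bianalytic (\bigcup_i E i).
Proof.
move=> hX h; split; first by apply: analytic_bigcup => i; have [] := h i.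
by rewrite setC_bigcup; apply: analytic_bigcap => // i; have [] := h i.
Qed.

Lemma analytic_closed E : analytic [set: X] -> closed E -> analytic E.
Proof. by move=> aX cE; rewrite -(setIT E); exact: analytic_closedI. Qed.

Lemma bianalytic_sigma_algebra : hausdorff_space X -> analytic [set: X] ->
  sigma_algebra [set: X] [set E | bianalytic E].
Proof.
move=> hX aX; split.
- by split; [exact: analytic_closed closed0|rewrite setC0].
- by move=> E hE; rewrite setTD; exact: bianalyticC.
- by move=> F hF; exact: bianalytic_bigcup.
Qed.

End bianalytic.

Lemma hausdorff_prod (X Y : topologicalType) : hausdorff_space X -> hausdorff_space Y ->
  hausdorff_space (X * Y)%type.
Proof.
move=> hX hY [x y] [x' y'] cl; congr pair.
  apply: hX => U V xU xV.
  have [||[u v] [/= [? _] [? _]]] := cl (U `*` setT) (V `*` setT).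
  - by exists (U, setT) => //; split=> //; exact: filterT.
  - by exists (V, setT) => //; split=> //; exact: filterT.
  by exists u.
apply: hY => U V xU xV.
have [||[u v] [/= [_ ?] [_ ?]]] := cl (setT `*` U) (setT `*` V).
- by exists (setT, U) => //; split=> //; exact: filterT.
- by exists (setT, V) => //; split=> //; exact: filterT.
by exists v.
Qed.

Section base.
Context {R : realType} {T : completePseudoMetricType R} (d : nat -> T).

Definition base_radius (i : nat) : nat := (odflt (0, 0)%N (unpickle i : option (nat * nat))).2.

(** The index encodes a centre and a radius. The interior is taken because [ball] is not assumed to
    be open. *)
Definition base (i : nat) : set T :=
  interior (ball (d (odflt (0, 0)%N (unpickle i : option (nat * nat))).1)
    ((base_radius i).+1%:R^-1)).

Lemma open_base i : open (base i).
Proof. exact: open_interior. Qed.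

Lemma base_ball i x y : base i x -> base i y -> ball x (2 / (base_radius i).+1%:R) y.
Proof.
move=> /interior_subset ix /interior_subset iy.
have -> : 2 / (base_radius i).+1%:R = (base_radius i).+1%:R^-1 + (base_radius i).+1%:R^-1 :> R by rewrite mulr_natl mulr2n.
by apply: ball_triangle iy; exact: ball_sym.
Qed.

Hypothesis dd : dense_seq d.

Lemma base_cover m x : exists2 i, base_radius i = m & base i x.
Proof.
have e0 : 0 < (m.+1%:R^-1 : R) / 2 by rewrite divr_gt0// invr_gt0.
have [k kx] := dd x e0.
exists (pickle (k, m)); rewrite /base /base_radius pickleK//=.
apply/nbhs_ballP; exists (m.+1%:R^-1 / 2) => // y xy.
by rewrite [X in ball _ X](splitr (m.+1%:R^-1 : R)); exact: ball_triangle kx xy.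
Qed.

Lemma base_nbhs x U : nbhs x U -> exists i, base i x /\ closure (base i) `<=` U.
Proof.
move=> /nbhs_ballP[e /= e0 eU].
have [m _ /(_ m (leqnn m)) /= me] := near_infty_natSinv_lt (PosNum (divr_gt0 e0 (ltr0Sn _ 2))).
have [i im ix] := base_cover m x; exists i; split=> // y.
have m0 : 0 < (m.+1%:R^-1 : R) by rewrite invr_gt0.
move=> /(_ _ (nbhsx_ballx y _ m0))[z [iz yz]]; apply: eU.
apply: le_ball (ball_triangle (base_ball ix iz) (ball_sym yz)).
rewrite im; move: me m0 => /=; set t := _^-1 => *; lra.
Qed.

End base.

Lemma bianalytic_borel (R : realType) (T : completePseudoMetricType R) : polish T ->
  forall D : set (borel T), measurable D -> bianalytic (D : set T).
Proof.
move=> pT; have aT := analytic_polish pT; have [d dd] := polish_dense_seq pT.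
apply: smallest_sub; first exact: bianalytic_sigma_algebra pT.1 aT.
move=> U oU; split; last by apply: analytic_closed => //; exact: open_closedC.
(* An open set of a metric space is a countable union of closed sets. *)
have -> : U = \bigcup_i (if `[< closure (base d i) `<=` U >] then closure (base d i) else set0).
  apply/seteqP; split=> [x Ux|x [i _]]; last by case: asboolP => // h /h.
  have [i [ix iU]] := base_nbhs dd (open_nbhs_nbhs (conj oU Ux)).
  by exists i => //; case: asboolP => // _; exact: subset_closure.
apply: analytic_bigcup => i; apply: analytic_closed => //.
by case: asboolP => _; [exact: closed_closure|exact: closed0].
Qed.

Lemma closed_preimage (X Y : topologicalType) (f : X -> Y) (D : set Y) :
  continuous f -> closed D -> closed (f @^-1` D).
Proof. by move=> /continuous_closedP; exact. Qed.

Lemma konig (b : seq bool -> Prop) : (forall s t, b (s ++ t) -> b s) ->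
  (forall k, exists s, size s = k /\ b s) ->
  exists z : nat -> bool, forall k, b (mkseq z k).
Proof.
move=> bp binf.
(* A word is followed only while it has extensions in [b] of every length; one of its two children
   inherits this. *)
pose inf s := forall k, exists t, size t = k /\ b (s ++ t).
have step s : exists c, inf s -> inf (rcons s c).
  apply: contrapT => /forallNP h.
  have /not_implyP[infs /existsNP[k0 k0P]] := h false.
  have /not_implyP[_ /existsNP[k1 k1P]] := h true.
  have [[|c t] [//= [st] bt]] := infs (maxn k0 k1).+1.
  have shorten k : (k <= size t)%N -> exists t', size t' = k /\ b (rcons s c ++ t').
    move=> kt; exists (take k t); split; first by rewrite size_take; case: ltngtP kt.
    by apply: (bp _ (drop k t)); rewrite -catA cat_take_drop cat_rcons.
  case: c bt shorten => bt shorten.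
    by apply: k1P; apply: shorten; rewrite st leq_maxr.
  by apply: k0P; apply: shorten; rewrite st leq_maxl.
have [g gP] := choice step.
pose t := fix t k := if k is k'.+1 then rcons (t k') (g (t k')) else [::].
have it k : inf (t k) by elim: k => [k|k /gP//]; have [s] := binf k; exists s.
exists (fun k => g (t k)) => k.
have -> : mkseq (fun k => g (t k)) k = t k.
  by elim: k => // k IH; rewrite mkseqS IH.
by have [s [_ /bp]] := it k 0%N.
Qed.

(** * Projections of Borel sets with compact sections *)

Section projection.
Context {R : realType} {S A : completePseudoMetricType R}.
Hypotheses (pS : polish S) (pA : polish A).
Local Notation SB := (borel S).
Local Notation AB := (borel A).

Lemma bianalytic_prod (P : set (SB * AB)%type) : measurable P ->
  bianalytic (P : set (S * A)%type).
Proof.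
have aSA : analytic [set: S * A].
  by rewrite -setXTT; apply: analytic_prod; exact: analytic_polish.
rewrite measurable_prod_measurableType; apply: smallest_sub.
  exact: bianalytic_sigma_algebra (hausdorff_prod pS.1 pA.1) aSA.
move=> _ [D1 mD1 [D2 mD2 <-]]; split.
  by apply: analytic_prod; [exact: (bianalytic_borel pS mD1).1|exact: (bianalytic_borel pA mD2).1].
have -> : ~` (D1 `*` D2) = \bigcup_(i in [set: nat])
    (if i == 0%N then (~` D1) `*` setT else setT `*` (~` D2)).
  apply/seteqP; split=> [[x y] /= /not_andP[h|h]|[x y] [i _]].
  - by exists 0%N => //; split.
  - by exists 1%N => //; split.
  - by case: ifP => _ [/= h1 h2] [].
apply: analytic_bigcup => i; case: ifP => _; apply: analytic_prod;
  by [exact: analytic_polish|exact: (bianalytic_borel pS mD1).2|exact: (bianalytic_borel pA mD2).2].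
Qed.

Lemma analytic_projection (P : set (SB * AB)%type) : measurable P ->
  analytic ([set x | exists a, P (x, a)] : set S).
Proof.
move=> /bianalytic_prod[aP _].
have -> : [set x | exists a, P (x, a)] = fst @` (P : set (S * A)%type).
  by apply/seteqP; split=> [x [a Pxa]|_ [[x a] Pxa <-]]; [exists (x, a)|exists a].
by apply: analytic_image aP => x; exact: cvg_fst.
Qed.

Let d := projT1 (cid (polish_dense_seq pA)).
Let dd : dense_seq d := projT2 (cid (polish_dense_seq pA)).
Let V := base d.

(* A code [z] lists which basic open sets contain the terms of a sequence. *)
Definition cell (s : seq bool) : set A :=
  [set a | forall i, (i < size s)%N -> V i a <-> nth false s i].

(** A closed condition on the pair that holds whenever [z] codes a sequence converging to [a]: the
    listed basic sets have [a] in their closure, the others miss [a]. *)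
Definition code_limit (z : cantor_space) (a : A) :=
  forall i, (z i = false \/ closure (V i) a) /\ (z i = true \/ ~ V i a).

Let sg (i : nat) : seq bool := odflt [::] (unpickle i).

Lemma measurable_cell s : measurable (cell s : set AB).
Proof.
have -> : cell s = \bigcap_i (if (i < size s)%N then
    (if nth false s i then V i else ~` V i) else setT).
  apply/seteqP; split=> [a h i _|a h i si].
    case: ifP => // /h; case: ifP => _ [h1 h2]; first exact: h2.
    by move=> /h1.
  by have := h i I; rewrite /= si; case: ifP => _.
have mV i : measurable (V i : set AB) by apply: sub_sigma_algebra; exact: open_base.
apply: bigcapT_measurable => i; case: ifP => // _; case: ifP => _ //.
exact: measurableC.
Qed.

Variable P : set (SB * AB)%type.
Hypotheses (mP : measurable P) (cP : forall x, compact [set a : A | P (x, a)]).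

(** Codes incompatible with convergence inside the section of [P] at [x]: either some radius is
    never listed, or a limit lies outside the section. *)
Let Q : set (S * cantor_space)%type := [set xz |
  (exists m, forall i, base_radius i = m -> xz.2 i = false) \/
  exists a, ~ P (xz.1, a) /\ code_limit xz.2 a].

Lemma continuous_coordinate i : continuous (fun z : cantor_space => z i).
Proof. exact: (@proj_continuous _ (fun=> bool) i). Qed.

Lemma closed_coordinate i b : closed [set z : cantor_space | z i = b].
Proof.
apply: (@closed_comp _ _ (fun z : cantor_space => z i) [set b]).
  by move=> z _; exact: continuous_coordinate.
exact: discrete_closed.
Qed.

(** The alternative with a limit is a continuous image of a closed set intersected with an analytic
    one, since the complement of [P] is analytic; the other alternative is a countable union of
    closed sets. *)
Lemma analytic_Q : analytic Q.
Proof.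
have aS := analytic_polish pS.
have -> : Q = \bigcup_i (if i is m.+1 then
    setT `*` [set z : cantor_space | forall i, base_radius i = m -> z i = false]
  else (fun w : (S * A) * cantor_space => (w.1.1, w.2)) @`
    ([set w | code_limit w.2 w.1.2] `&` ((~` P) `*` setT))).
  apply/seteqP; split=> [[x z] [[m /= h]|[a /= [nP h]]]|[x z] [[|m] _]].
  - by exists m.+1.
  - by exists 0%N => //; exists ((x, a), z).
  - by move=> [[[x' a] z'] [/= h [nP _]] [<- <-]]; right; exists a.
  - by move=> [_ h]; left; exists m.
apply: analytic_bigcup => -[|m].
  apply: analytic_image.
    move=> [[x a] z].
    have h1 : ((fun w : (S * A) * cantor_space => w.1.1) @ nbhs ((x, a), z)) --> x.
      exact: (cvg_comp _ _ cvg_fst cvg_fst).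
    have h2 : ((fun w : (S * A) * cantor_space => w.2) @ nbhs ((x, a), z)) --> z.
      exact: cvg_snd.
    exact: (cvg_pair h1 h2).
  apply: analytic_closedI; last first.
    by apply: analytic_prod (bianalytic_prod mP).2 analytic_cantor.
  have -> : [set w : (S * A) * cantor_space | code_limit w.2 w.1.2] = \bigcap_i
    ((snd @^-1` [set z : cantor_space | z i = false] `|` (snd \o fst) @^-1` (closure (V i))) `&`
     (snd @^-1` [set z : cantor_space | z i = true] `|` (snd \o fst) @^-1` (~` V i))).
    by apply/seteqP; split=> [w h i _|w h i]; [exact: h|exact: (h i I)].
  apply: closed_bigI => i _.
  have c1 : continuous (snd : (S * A) * cantor_space -> cantor_space) by move=> w; exact: cvg_snd.
  have c2 : continuous (snd \o fst : (S * A) * cantor_space -> A).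
    by move=> [[x a] z]; exact: (cvg_comp _ _ cvg_fst cvg_snd).
  apply: closedI; apply: closedU.
  - by apply: (@closed_preimage _ _ snd) c1 _; exact: closed_coordinate.
  - by apply: (@closed_preimage _ _ (snd \o fst)) c2 _; exact: closed_closure.
  - by apply: (@closed_preimage _ _ snd) c1 _; exact: closed_coordinate.
  - by apply: (@closed_preimage _ _ (snd \o fst)) c2 _; apply: open_closedC; exact: open_base.
apply: analytic_prod => //; apply: analytic_closed; first exact: analytic_cantor.
have -> : [set z : cantor_space | forall i, base_radius i = m -> z i = false] =
    \bigcap_(i in [set i | base_radius i = m]) [set z | z i = false].
  by apply/seteqP; split=> z h i; exact: h.
by apply: closed_bigI => i _; exact: closed_coordinate.
Qed.

(** These are projections of Borel sets, hence analytic; [Q] is to be separated from them. *)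
Let E i : set S := [set x | exists a, (P `&` (setT `*` cell (sg i))) (x, a)].

Let T i : set (S * cantor_space)%type :=
  [set xz | forall k, (k < size (sg i))%N -> xz.2 k = nth false (sg i) k].

Lemma open_T i : open (T i).
Proof.
rewrite /T; elim: (size _) => [|n IH].
  by rewrite (_ : [set _ | _] = setT); [exact: openT|apply/seteqP; split].
rewrite (_ : [set _ | _] = [set xz | forall k, (k < n)%N -> xz.2 k = nth false (sg i) k] `&`
    snd @^-1` [set z : cantor_space | z n = nth false (sg i) n]).
  apply: openI => //; apply: open_comp; first by move=> w _; exact: cvg_snd.
  apply: (@open_comp _ _ (fun z : cantor_space => z n) [set (nth false (sg i) n)]).
    by move=> z _; exact: continuous_coordinate.
  exact: discrete_open.
apply/seteqP; split=> [w h|w [h hn] k].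
  by split=> [k kn|]; apply: h => //; exact: ltnW.
by rewrite ltnS leq_eqVlt => /orP[/eqP ->|/h].
Qed.

(** Otherwise every initial word of [z] would be realized by a point of the section. By compactness
    such points cluster at some [b] in the section, and [z] lists every basic set around [b]. This
    rules out a missing radius as well as any limit other than [b]. *)
Lemma Q_covered xz : Q xz -> exists i, T i xz /\ ~ E i xz.1.
Proof.
case: xz => x z Qxz; apply: contrapT => /forallNP h.
have /choice[a aP] : forall k, exists a, P (x, a) /\ cell (mkseq z k) a.
  move=> k; have /not_andP[nT|/contrapT[a [Pa [_ ca]]]] := h (pickle (mkseq z k)).
    exfalso; apply: nT => j; rewrite /sg pickleK /= size_mkseq => jk.
    by rewrite nth_mkseq.
  by exists a; split=> //; move: ca; rewrite /= /sg pickleK.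
have [|b [Pb clb]] := @cP x (a @ \oo) _.
  by exists 0%N => // k _; exact: (aP k).1.
have bz i : V i b -> z i = true.
  move=> Vb; have [||c [[k /= ik <-] Vk]] := clb (a @` [set k | (i < k)%N]) (V i).
  - by exists i.+1 => // k /= ik; exists k.
  - by apply: open_nbhs_nbhs; split=> //; exact: open_base.
  by have := (aP k).2 i; rewrite size_mkseq nth_mkseq// => /(_ ik) [/(_ Vk)].
case: Qxz => [[m /= zm]|[c /= [nPc cl]]].
  by have [i im Vb] := base_cover dd m b; have := bz _ Vb; rewrite zm.
have /eqP/(hausdorffP pA.1)[U [W [bU cW _ oW UW]]] : b <> c by move=> bc; rewrite bc in Pb.
have [i [Vb VU]] := base_nbhs dd bU.
have [[zi|cV] _] := cl i; first by have := bz i Vb; rewrite zi.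
by have [y [Vy Wy]] := cV _ cW; apply: (UW y); split=> //; apply: VU; exact: subset_closure.
Qed.

(** Points realizing the initial words form a Cauchy sequence as soon as [z] lists a set of every
    radius, and their limit is outside the empty section. *)
Lemma Q_code x z : (forall a, ~ P (x, a)) -> (forall k, cell (mkseq z k) !=set0) -> Q (x, z).
Proof.
move=> Px /choice[a aP].
have aV i k : (i < k)%N -> V i (a k) <-> z i.
  by move=> ik; have := aP k i; rewrite size_mkseq nth_mkseq//; exact.
have [h|/forallNP h] := pselect (exists m, forall i, base_radius i = m -> z i = false).
  by left.
right; have : cvg (a @ \oo).
  apply/cauchy_cvgP/cauchy_exP => e e0.
  have [m _ /(_ m (leqnn m)) /= me] := near_infty_natSinv_lt (PosNum e0).
  have /existsNP[i /not_implyP[im zi]] := h m.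
  exists (d (odflt (0, 0)%N (unpickle i : option (nat * nat))).1); exists i.+1 => // k /= ik.
  have /interior_subset : V i (a k) by apply/(aV _ _ ik); case: (z i) zi.
  by apply: le_ball; rewrite im; exact: ltW.
move=> /cvg_ex[b ab]; exists b; split; first exact: Px.
move=> i; case zi : (z i); split; [right|by left|by left|right].
  move=> U bU; have [k _ kU] := ab U bU.
  exists (a (maxn k i.+1)); split; last by apply: kU; exact: leq_maxl.
  by apply/aV; rewrite ?leq_maxr.
move=> Vb; have [k _ kV] := ab _ (open_nbhs_nbhs (conj (open_base d i) Vb)).
have /(aV i _ (leq_maxr k i.+1)) : V i (a (maxn k i.+1)) by apply: kV; exact: leq_maxl.
by rewrite zi.
Qed.

(* Novikov: the complement of the projection is the set of points at which a countable
   Borel cover of the codes has a finite subcover, by compactness of the Cantor space. *)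
Lemma projection_measurable : measurable ([set x | exists a, P (x, a)] : set SB).
Proof.
have [B [mB EB QB]] : separated_by Q E fst T.
  apply: separation; [exact: pS.1|exact: analytic_Q| |by move=> ?; exact: cvg_fst|exact: open_T|exact: Q_covered].
  move=> i; apply: analytic_projection; apply: measurableI => //.
  by apply: measurableX => //; exact: measurable_cell.
(* A word is good at [x] if no action realizes it or if the hull of one of its prefixes excludes
   [x]. The section is empty exactly when all words of some length are good. *)
pose good s : set SB := [set x | cell s = set0] `|` \bigcup_i (if prefix (sg i) s then ~` B i else set0).
suff -> : [set x | exists a, P (x, a)] =
    ~` (\bigcup_k \bigcap_i (if size (sg i) == k then good (sg i) else setT)).
  apply: measurableC; apply: bigcupT_measurable => k; apply: bigcapT_measurable => i.
  case: ifP => // _; apply: measurableU.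
    by have [h|h] := pselect (cell (sg i) = set0); [rewrite (_ : [set x | _] = setT)|rewrite (_ : [set x | _] = set0)];
      do ?(by apply/seteqP; split).
  by apply: bigcupT_measurable => j; case: ifP => // _; exact: measurableC.
apply/seteqP; split=> [x [a Pa] [k _ xk]|x nx].
  pose s := mkseq (fun i => `[< V i a >]) k.
  have ca : cell s a by move=> i; rewrite size_mkseq => ik; rewrite nth_mkseq//; split=> /asboolP.
  have := xk (pickle s) I; rewrite /= /sg pickleK /= size_mkseq eqxx => -[c0|[i _]].
    by rewrite /= c0 in ca.
  case: ifP => // /prefixP[t st] /=; apply; apply: EB; exists a; split=> //; split=> // j ji.
  by have := ca j; rewrite st size_cat nth_cat ji; apply; exact: ltn_addr.
apply: contrapT => /forallNP Px.
pose bad s := cell s !=set0 /\ forall i, prefix (sg i) s -> B i x.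
(* Bad words of every length produce a code that lies in [Q] while [x] belongs to the hulls of all
   its initial words, against the separation. *)
have [||z zP] := @konig bad.
- move=> s t [[a ca] h]; split; last first.
    by move=> i si; apply: h; apply: prefix_trans si _; exact: prefix_prefix.
  by exists a => i si; have := ca i; rewrite size_cat nth_cat si; apply; exact: ltn_addr.
- move=> k; apply: contrapT => /forallNP h; apply: nx; exists k => // i _.
  case: eqP => // sk; have /not_andP[//|/not_andP[/set0P/negP/negPn/eqP c0|]] := h (sg i).
    by left.
  by move=> /existsNP[j /not_implyP[ji nB]]; right; exists j => //; rewrite ji.
have [i [Ti nB]] := QB _ (Q_code Px (fun k => (zP k).1)).
apply: nB; apply: (zP (size (sg i))).2.
have -> : mkseq z (size (sg i)) = sg i; last exact: prefix_refl.
by apply: (@eq_from_nth _ false); rewrite size_mkseq// => k ki; rewrite nth_mkseq//; exact: (Ti k ki).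
Qed.

End projection.

(** * Compactness and Borel maximizers *)

Lemma within_continuous_near (X Y : topologicalType) (K : set X) (v : X -> Y) a U :
  {within K, continuous v} -> K a -> nbhs (v a) U ->
  exists2 W, nbhs a W & forall b, W b -> K b -> U (v b).
Proof.
move=> /subspace_continuousP cv Ka vU; have := cv a Ka U vU.
by move=> h; exists [set b | K b -> U (v b)].
Qed.

Lemma near_within_continuous (X Y : topologicalType) (K : set X) (v : X -> Y) :
  (forall a U, K a -> nbhs (v a) U -> exists2 W, nbhs a W & forall b, W b -> K b -> U (v b)) ->
  {within K, continuous v}.
Proof.
move=> h; apply/subspace_continuousP => a Ka U /(h a U Ka)[W aW WU].
apply: filterS aW => b Wb Kb; exact: WU.
Qed.

Lemma compact_superlevel (R : realType) (X : topologicalType) (K : set X) (v : X -> R) c :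
  compact K -> {within K, continuous v} -> compact (K `&` [set a | c <= v a]).
Proof.
move=> cK cv F PF FD.
have [a [Ka cla]] := cK F PF (filterS (@subIsetl _ _ _) FD).
exists a; split=> //; split=> //=; rewrite leNgt; apply/negP => va.
have [|W aW WP] := within_continuous_near (U := [set y | y < c]) cv Ka.
  by apply: open_nbhs_nbhs; split=> //; exact: open_lt.
have [b [[Kb /= vb] Wb]] := cla _ _ FD aW.
by have := WP b Wb Kb; rewrite /= ltNge vb.
Qed.

Lemma compact_bigcap_nonempty (X : topologicalType) (D : nat -> set X) : hausdorff_space X ->
  (forall n, compact (D n)) -> (forall n, D n !=set0) ->
  (forall n, D n.+1 `<=` D n) -> exists a, forall n, D n a.
Proof.
move=> hX cD /choice[a aD] dD.
have mono m n : (m <= n)%N -> D n `<=` D m.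
  elim: n => [|n IH]; first by rewrite leqn0 => /eqP ->.
  by rewrite leq_eqVlt => /orP[/eqP -> //|/IH]; apply: subset_trans; exact: dD.
have [|b [_ clb]] := cD 0%N (a @ \oo) _.
  by exists 0%N => // k _; exact: mono (leq0n k) _ (aD k).
exists b => n; have cn := compact_closed hX (cD n).
move: cn => /closure_id -> U bU.
have [|c [[k /= nk <-] Uc]] := clb (a @` [set k | (n <= k)%N]) U _ bU.
  by exists n => // k /= nk; exists k.
by exists (a k); split=> //; exact: mono nk _ (aD k).
Qed.

Section selection.
Context {R : realType} {S A : completePseudoMetricType R}.
Hypotheses (pS : polish S) (pA : polish A).
Local Notation SB := (borel S).
Local Notation AB := (borel A).

Lemma measurable_cylinder1 (D : set SB) : measurable D ->
  measurable [set xa : SB * AB | D xa.1].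
Proof. by move=> mD; have := @measurable_fst _ _ SB AB measurableT D mD; rewrite setTI. Qed.

Lemma measurable_cylinder2 (D : set AB) : measurable D ->
  measurable [set xa : SB * AB | D xa.2].
Proof. by move=> mD; have := @measurable_snd _ _ SB AB measurableT D mD; rewrite setTI. Qed.

(* The sections are cut down successively by the closures of a countable base;
   what remains of each section in the limit is a single point. *)
Lemma measurable_selection (P : set (SB * AB)%type) : measurable P ->
  (forall x, compact [set a : A | P (x, a)]) -> (forall x, exists a, P (x, a)) ->
  exists f : S -> A, measurable_fun setT (f : SB -> AB) /\ forall x, P (x, f x).
Proof.
move=> mP cP nP.
have [d dd] := polish_dense_seq pA.
pose F n : set A := closure (base d n).
have cF n : closed (F n) by exact: closed_closure.
(* A section is intersected with the next closed set only if it stays nonempty. *)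
pose Pn := fix Pn n : set (SB * AB)%type := if n is n'.+1 then
  Pn n' `&` [set xa | (exists a, Pn n' (xa.1, a) /\ F n' a) -> F n' xa.2] else P.
have mF C : closed C -> measurable (C : set AB).
  move=> cC; rewrite -(setCK C); apply: measurableC; apply: sub_sigma_algebra.
  exact: closed_openC.
have cPn n x : compact [set a : A | Pn n (x, a)].
  elim: n => [|n IH]; first exact: cP.
  have [h|h] := pselect (exists a, Pn n (x, a) /\ F n a).
    rewrite (_ : [set a | _] = [set a | Pn n (x, a)] `&` F n).
      by apply: compact_closedI => //; exact: cF.
    by apply/seteqP; split=> a [Pa Fa]; split=> //; exact: Fa.
  by rewrite (_ : [set a | _] = [set a | Pn n (x, a)])//; apply/seteqP; split=> [a []|a Pa]//; split.
have nPn n x : exists a, Pn n (x, a).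
  elim: n => [|n [a Pa]]; first exact: nP.
  have [[b [Pb Fb]]|h] := pselect (exists a, Pn n (x, a) /\ F n a); first by exists b; split.
  by exists a; split.
have cPC n x C : closed C -> compact [set a : A | Pn n (x, a) /\ C a].
  move=> cC; rewrite (_ : [set a | _] = [set a | Pn n (x, a)] `&` C).
    by apply: compact_closedI; [exact: cPn|].
  by apply/seteqP; split=> a [].
have mproj n C : measurable (Pn n) -> closed C ->
    measurable ([set x | exists a, Pn n (x, a) /\ C a] : set SB).
  move=> mPn cC.
  apply: (@projection_measurable _ _ _ pS pA (Pn n `&` [set xa | C xa.2])) => [|x]; last exact: cPC.
  by apply: measurableI => //; apply: measurable_cylinder2; exact: mF.
have mPn n : measurable (Pn n).
  elim: n => //= n IH; apply: measurableI => //.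
  rewrite (_ : [set xa | _] = ~` [set xa : SB * AB | [set x | exists a, Pn n (x, a) /\ F n a] xa.1] `|`
      [set xa | F n xa.2]).
    apply: measurableU; last by apply: measurable_cylinder2; exact: mF.
    by apply: measurableC; apply: measurable_cylinder1; exact: mproj.
  apply/seteqP; split=> [xa /= h|xa /= [//|//]].
  by have [/h|] := pselect (exists a, Pn n (xa.1, a) /\ F n a); [right|left].
have [f fP] : exists f : S -> A, forall x n, Pn n (x, f x).
  suff /choice[f fP] : forall x, exists a, forall n, Pn n (x, a) by exists f.
  move=> x; apply: (@compact_bigcap_nonempty _ (fun n => [set a : A | Pn n (x, a)])).
  - exact: pA.1.
  - by move=> n; exact: cPn.
  - by move=> n; exact: nPn.
  - by move=> n a [].
have uniq x a : (forall n, Pn n (x, a)) -> a = f x.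
  move=> aP; apply: contrapT => /eqP /(hausdorffP pA.1)[U [W [aU fW _ _ UW]]].
  have [n [na nU]] := base_nbhs dd aU.
  have [_ /= h] := fP x n.+1.
  have Fa : F n a by exact: subset_closure.
  have /h /nU Uf : exists a, Pn n (x, a) /\ F n a by exists a; split=> //; exact: aP.
  by apply: (UW (f x)); split=> //; exact: nbhs_singleton fW.
exists f; split=> [|x]; last exact: (fP x 0%N).
apply: (measurability (@open A : set (set AB))) => [//|] _ [U oU <-]; rewrite setTI.
(* The remaining sections are compact and decrease to the point [f x], so [f x] avoids [U] exactly
   when each of them meets the complement of [U]. *)
have -> : f @^-1` U = ~` (\bigcap_n [set x | exists a, Pn n (x, a) /\ (~` U) a]).
  apply/seteqP; split=> [x Uf h|x h /=].
    have [||||a aP] := @compact_bigcap_nonempty _ (fun n => [set a : A | Pn n (x, a) /\ (~` U) a]).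
    - exact: pA.1.
    - by move=> n; apply: cPC; exact: open_closedC.
    - by move=> n; have [a] := h n I; exists a.
    - by move=> n a [[]].
    by case: (aP 0%N) => _; apply; rewrite (uniq x a)// => n; case: (aP n).
  by apply: contrapT => nU; apply: h => n _; exists (f x); split=> //; exact: fP.
apply: measurableC; apply: bigcapT_measurable => n; apply: mproj => //.
exact: open_closedC.
Qed.

Lemma measurable_argmax (K : set (SB * AB)%type) (v : S -> A -> R) : measurable K ->
  (forall x, compact [set a : A | K (x, a)]) -> (forall x, exists a, K (x, a)) ->
  measurable_fun K (fun xa : SB * AB => v xa.1 xa.2) ->
  (forall x, {within [set a : A | K (x, a)], continuous (v x)}) ->
  exists f : S -> A, [/\ measurable_fun setT (f : SB -> AB), (forall x, K (x, f x)) &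
    forall x a, K (x, a) -> v x a <= v x (f x)].
Proof.
move=> mK cK nK mv cv.
pose L (c : R) : set (SB * AB)%type := K `&` [set xa | c <= v xa.1 xa.2].
have mL c : measurable (L c).
  rewrite /L (_ : [set xa | _] = (fun xa : SB * AB => v xa.1 xa.2) @^-1` `[c, +oo[).
    exact: mv.
  by apply/seteqP; split=> xa /=; rewrite in_itv /= andbT.
have cL c x : compact [set a : A | L c (x, a)] by exact: (compact_superlevel (cK x) (cv x)).
pose Lp c : set SB := [set x | exists a, L c (x, a)].
have mLp c : measurable (Lp c) by exact: projection_measurable.
(* Maximality is tested at rational levels: every level reached somewhere in the section is reached
   at [a]. The set of states where a level is reached is Borel because the superlevel sets have
   compact sections. *)
pose M : set (SB * AB)%type := K `&` \bigcap_n
  (let c := ratr (odflt 0 (unpickle n : option rat)) in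
   ~` [set xa : SB * AB | Lp c xa.1] `|` [set xa | L c xa]).
have ME x a : M (x, a) <-> K (x, a) /\ forall a', K (x, a') -> v x a' <= v x a.
  split=> [[Ka h]|[Ka h]]; split=> //.
    move=> a' Ka'; rewrite leNgt; apply/negP => /rat_in_itvoo[q]; rewrite in_itv /= => /andP[qa qa'].
    have := h (pickle q) I; rewrite /= pickleK /= => -[|[_ /=]].
      by apply; exists a'; split=> //; exact: ltW.
    by rewrite leNgt qa.
  move=> n _ /=; set c := ratr _.
  have [[a' [Ka' ca']]|] := pselect (Lp c x); last by left.
  by right; split=> //=; exact: le_trans ca' (h a' Ka').
have maxP x : exists a, M (x, a).
  have [a0 Ka0] := nK x.
  have ha : exists a, [set a | K (x, a)] a /\ forall b, K (x, b) -> v x b <= v x a.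
    have := @compact_EVT_max _ _ (v x) [set a | K (x, a)].
    by move=> h; have [||| a aK am] := h; [by exists a0|exact: cK|exact: cv|exists a; split=> [|b bK]; [exact: set_mem|by apply: am; rewrite inE]].
  by have [a [Ka ha']] := ha; exists a; exact/ME.
have mM : measurable M.
  apply: measurableI => //; apply: bigcapT_measurable => n /=; apply: measurableU; last exact: mL.
  by apply: measurableC; apply: measurable_cylinder1.
have cM x : compact [set a : A | M (x, a)].
  have [a /ME[Ka am]] := maxP x.
  rewrite (_ : [set a | _] = [set b : A | L (v x a) (x, b)]); first exact: cL.
  apply/seteqP; split=> b /=.
    by move=> /ME[Kb bm]; split=> //=; exact: bm.
  by move=> [Kb /= vb]; apply/ME; split=> // c Kc; exact: le_trans (am c Kc) vb.
have [f [mf fP]] := measurable_selection mM cM maxP.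
exists f; split=> // x; first by have /ME[] := fP x.
by have /ME[] := fP x.
Qed.

End selection.

(** * Forward equation of Feller's series *)

Local Open Scope ereal_scope.

Ltac mproj := repeat first [ exact: measurable_id | exact: measurable_fst | exact: measurable_snd
  | exact: measurable_cst | exact: measurable_fun_pair | apply: measurable_fun_pair
  | apply: (measurableT_comp measurable_fst) | apply: (measurableT_comp measurable_snd) ].

Section iterated_integrals.
Context {R : realType}.
Local Notation leb := (@lebesgue_measure R).

Lemma measurable_between d (X : measurableType d) (a b c : X -> R) :
  measurable_fun setT a -> measurable_fun setT b -> measurable_fun setT c ->
  measurable [set x | (a x <= c x <= b x)%R].
Proof.
move=> ma mb mc.
have := measurableI _ _ (measurable_fun_le measurableT ma mc) (measurable_fun_le measurableT mc mb).
rewrite !setTI; congr (measurable _).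
by apply/seteqP; split=> x /= => [[-> ->]|/andP[-> ->]].
Qed.

(** The moving endpoints are absorbed into a jointly measurable indicator, which reduces the claim
    to Tonelli's theorem. *)
Lemma measurable_integral_itv d (X : measurableType d) (a b : X -> R) (F : X -> R -> \bar R) :
  measurable_fun setT a -> measurable_fun setT b ->
  measurable_fun setT (fun p : X * R => F p.1 p.2) -> (forall x u, 0 <= F x u) ->
  measurable_fun setT (fun x => \int[leb]_(u in `[a x, b x]) F x u).
Proof.
move=> ma mb mF F0.
pose G (p : X * R) := F p.1 p.2 * (\1_[set p : X * R | (a p.1 <= p.2 <= b p.1)%R] p)%:E.
have G0 p : 0 <= G p by rewrite mule_ge0// lee_fin.
have mG : measurable_fun setT G.
  apply: emeasurable_funM => //; apply/measurable_EFinP; apply: measurable_indic.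
  by apply: measurable_between; [apply: (measurableT_comp ma)|apply: (measurableT_comp mb)|]; mproj.
rewrite (_ : (fun x => _) = fubini_F leb G); first exact: measurable_fun_fubini_tonelli_F.
apply/funext => x; rewrite /fubini_F [LHS]integral_mkcond; apply: eq_integral => u _.
rewrite /G patchE /= indicE.
have -> : (u \in `[a x, b x]%classic) = ((x, u) \in [set p : X * R | (a p.1 <= p.2 <= b p.1)%R]).
  by apply/idP/idP; rewrite !inE /= ?in_itv.
by case: ifP => _; rewrite ?mule1 ?mule0.
Qed.

Lemma triangle_swap (F : R -> R -> \bar R) s t :
  measurable_fun setT (fun p : R * R => F p.1 p.2) -> (forall u v, 0 <= F u v) ->
  \int[leb]_(v in `[s, t]) \int[leb]_(u in `[s, v]) F u v =
  \int[leb]_(u in `[s, t]) \int[leb]_(v in `[u, t]) F u v.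
Proof.
move=> mF F0.
pose D := [set p : R * R | (s <= p.1 <= p.2)%R] `&` [set p | (p.1 <= p.2 <= t)%R].
pose G (p : R * R) := F p.1 p.2 * (\1_D p)%:E.
have G0 p : 0 <= G p by rewrite mule_ge0// lee_fin.
have mG : measurable_fun setT G.
  apply: emeasurable_funM => //; apply/measurable_EFinP; apply: measurable_indic.
  by apply: measurableI; apply: measurable_between; mproj.
have := @fubini_tonelli _ _ _ _ R leb leb G mG G0.
rewrite /fubini_F /fubini_G /= => h.
transitivity (\int[leb]_v \int[leb]_u G (u, v)).
  rewrite [LHS]integral_mkcond; apply: eq_integral => v _; rewrite patchE; case: ifPn => sv.
    rewrite [LHS]integral_mkcond; apply: eq_integral => u _; rewrite patchE /G /= indicE.
    have -> : (u \in `[s, v]%classic) = ((u, v) \in D).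
      move: sv; rewrite inE /= in_itv /= => /andP[sv vt].
      rewrite mem_setE in_itv /=; apply/idP/idP; rewrite inE /D /=; last by case.
      move=> /andP[su uv]; split; apply/andP; [exact: (conj su uv)|exact: (conj uv vt)].
    by case: ifP => _; rewrite ?mule1 ?mule0.
  apply/esym; apply: integral0_eq => u _; rewrite /G indicE memNset; first by rewrite mule0.
  move=> [/= /andP[su uv] /andP[_ vt]].
  move: sv; rewrite mem_setE in_itv /= vt andbT => /negP; apply; exact: le_trans su uv.
rewrite -h; symmetry.
rewrite [LHS]integral_mkcond; apply: eq_integral => u _; rewrite patchE; case: ifPn => su.
  rewrite [LHS]integral_mkcond; apply: eq_integral => v _; rewrite patchE /G /= indicE.
  have -> : (v \in `[u, t]%classic) = ((u, v) \in D).
    move: su; rewrite inE /= in_itv /= => /andP[su ut].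
    rewrite mem_setE in_itv /=; apply/idP/idP; rewrite inE /D /=; last by case.
    move=> /andP[uv vt]; split; apply/andP; [exact: (conj su uv)|exact: (conj uv vt)].
  by case: ifP => _; rewrite ?mule1 ?mule0.
apply/esym; apply: integral0_eq => v _; rewrite /G indicE memNset; first by rewrite mule0.
move=> [/= /andP[su' uv] /andP[_ vt]].
move: su; rewrite mem_setE in_itv /= su' => /negP; apply; exact: le_trans uv vt.
Qed.

End iterated_integrals.

Section hazard.
Context {R : realType} (l : R -> R) (b : R).
Local Notation leb := (@lebesgue_measure R).

(** [S] solves the linear equation S' = (b - l) S with initial value 1 at [s]. *)
Lemma hazard_FTC (s t : R) : (forall u, {for u, continuous l}) -> (s <= t)%R ->
  let S u := expR (b * (u - s) - \int[leb]_(v in `[s, u]) l v)%R in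
  \int[leb]_(v in `[s, t]) ((b - l v) * S v)%:E = (S t)%:E - 1.
Proof.
move=> cl; rewrite le_eqVlt => /orP[/eqP <-|st] S.
  by rewrite set_itv1 integral_set1 /S subrr mulr0 set_itv1 Rintegral_set1 subr0 expR0 subee.
have lis u : leb.-integrable `[s, u] (EFin \o l).
  apply: continuous_compact_integrable; first exact: segment_compact.
  by apply: continuous_subspaceT => v; exact: cl.
pose L u := (\int[leb]_(v in `[s, u]) l v)%R.
have dL u : (s < u)%R -> is_derive u (1:R)%R L (l u).
  move=> su; have [] := @continuous_FTC1_closed R l s u (u + 1)%R _ (lis _) su (cl u).
    by rewrite ltrDl.
  by rewrite derive1E => h1 h2; apply: DeriveDef.
have dS u : (s < u)%R -> is_derive u (1:R)%R S ((b - l u) * S u)%R.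
  move=> su; have := dL u su => ?.
  rewrite /S; apply: is_derive_eq.
  by rewrite subr0 [(_ *: _)%R]mulr1 mulrC.
have cL : {within `[s, t], continuous L}.
  exact: (@parameterized_integral_continuous _ s t l (ltW st) (lis t)).
have cP : {within `[s, t], continuous (fun u => b * (u - s) - L u)%R}.
  move=> u; apply: cvgB; last exact: cL.
  apply: continuous_subspaceT u => u.
  by apply: cvgM; [exact: cvg_cst|apply: cvgB; [exact: cvg_id|exact: cvg_cst]].
have cS : {within `[s, t], continuous S}.
  by move=> u; exact: (cvg_comp _ _ (cP u) (@continuous_expR R _)).
have Ss : S s = 1%R by rewrite /S subrr mulr0 set_itv1 Rintegral_set1 subr0 expR0.
clear cP; clearbody S.
have [_ S1 S2] := (continuous_within_itvP _ st).1 cS.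
have -> : 1 = (S s)%:E by rewrite Ss.
apply: continuous_FTC2.
- exact: st.
- move=> u; apply: cvgM; last exact: cS.
  apply: continuous_subspaceT u => u; apply: cvgB; [exact: cvg_cst|exact: cl].
- split=> // u; rewrite in_itv /= => /andP[su _].
  by have ? := dS u su; exact: ex_derive.
- move=> u; rewrite in_itv /= => /andP[su _].
  by have ? := dS u su; rewrite derive1E derive_val.
Qed.

End hazard.

Local Open Scope ereal_scope.

(** * Feller's recursion for an abstract jump operator *)

Section jump_process.
Context d (T : measurableType d) {R : realType}.
Local Notation leb := (@lebesgue_measure R).

Definition jointly (F : R -> T -> \bar R) := measurable_fun setT (fun p : R * T => F p.1 p.2).

(** Models the integral of [h] against the jump rates out of [x] at time [u], for nonnegative [h].
    The additional time variable in [measurable_jump] is the terminal time, which Feller's recursion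
    carries along as a parameter. *)
Record jump_operator (J : R -> T -> (T -> \bar R) -> \bar R) := JumpOperator {
  jump_ge0 : forall u x (h : T -> \bar R), (forall y, 0 <= h y) -> 0 <= J u x h;
  jumpD : forall u x (h1 h2 : T -> \bar R), measurable_fun setT h1 -> measurable_fun setT h2 ->
    (forall y, 0 <= h1 y) -> (forall y, 0 <= h2 y) ->
    J u x (fun y => h1 y + h2 y) = J u x h1 + J u x h2;
  jumpZ : forall u x (c : R) (h : T -> \bar R), measurable_fun setT h -> (forall y, 0 <= h y) -> (0 <= c)%R ->
    J u x (fun y => c%:E * h y) = c%:E * J u x h;
  le_jump : forall u x (h1 h2 : T -> \bar R), measurable_fun setT h1 -> measurable_fun setT h2 ->
    (forall y, 0 <= h1 y) -> (forall y, h1 y <= h2 y) -> J u x h1 <= J u x h2;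
  jump_integral : forall u x (F : R -> T -> \bar R) D, measurable D -> jointly F ->
    (forall v y, 0 <= F v y) ->
    J u x (fun y => \int[leb]_(v in D) F v y) = \int[leb]_(v in D) J u x (F v);
  measurable_jump : forall (F : R -> R -> T -> \bar R),
    measurable_fun setT (fun p : (R * R) * T => F p.1.1 p.1.2 p.2) ->
    (forall v u y, 0 <= F v u y) ->
    measurable_fun setT (fun p : (R * R) * T => J p.1.2 p.2 (F p.1.1 p.1.2)) }.

Variables (J : R -> T -> (T -> \bar R) -> \bar R) (l : R -> T -> R).
Hypotheses (JJ : jump_operator J) (l_ge0 : forall u x, (0 <= l u x)%R)
  (ml : measurable_fun setT (fun p : R * T => l p.1 p.2))
  (cl : forall x u, {for u, continuous (l^~ x)}).

Section discounted.
Variables (a a' : R).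
Hypotheses (a0 : (0 <= a)%R) (a'0 : (0 <= a')%R).

(* With these weights [Q n] below is [e^((a - a') (t - s))] times the n-th term of Feller's series;
   [a] and [a'] absorb the exponential rates of the drift conditions. *)
Definition sv s u x : R := expR ((a - a') * (u - s) - \int[leb]_(v in `[s, u]) l v x)%R.

Fixpoint Q (n : nat) (t : R) (G : T -> \bar R) (s : R) (x : T) : \bar R :=
  if n is m.+1 then \int[leb]_(u in `[s, t]) ((sv s u x)%:E * J u x (Q m t G u))
  else (G x * (sv s t x)%:E).

(** The rate at which [G] is lost by jumps out of the current state and by killing at rate [a']. *)
Definition lG G : R -> T -> \bar R := fun v y => (l v y + a')%:E * G y.

Lemma Q_ge0 n t G s x : (forall y, 0 <= G y) -> 0 <= Q n t G s x.
Proof.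
move=> G0; elim: n s x => [|n IH] s x /=; first by rewrite mule_ge0// lee_fin expR_ge0.
apply: integral_ge0 => u _; rewrite mule_ge0 ?lee_fin ?expR_ge0//.
by apply: (jump_ge0 JJ) => y; exact: IH.
Qed.

Lemma measurable_sv : measurable_fun setT (fun p : (R * R) * T => sv p.1.1 p.1.2 p.2).
Proof.
apply: measurableT_comp => //; apply: measurable_funB.
  by apply: measurable_funM => //; apply: measurable_funB; mproj.
apply: measurableT_comp; first exact: fine_measurable.
apply: (@measurable_integral_itv _ _ _ (fun p : (R * R) * T => p.1.1) (fun p => p.1.2)
  (fun p v => (l v p.2)%:E)); [by mproj|by mproj| |by move=> *; rewrite lee_fin].
by apply/measurable_EFinP; apply: (measurableT_comp ml (g := fun q : ((R * R) * T) * R => (q.2, q.1.2))); mproj.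
Qed.

(** The terminal function depends on the terminal time because the forward equation integrates
    inflow and outflow rates, which vary with time. *)
Lemma measurable_Q n (H : R -> T -> \bar R) : jointly H -> (forall t y, 0 <= H t y) ->
  measurable_fun setT (fun p : (R * R) * T => Q n p.1.1 (H p.1.1) p.1.2 p.2).
Proof.
move=> mH H0; elim: n => [|n IH] /=.
  apply: emeasurable_funM.
    by apply: (measurableT_comp mH (g := fun p : (R * R) * T => (p.1.1, p.2))); mproj.
  apply/measurable_EFinP.
  by apply: (measurableT_comp measurable_sv (g := fun p : (R * R) * T => ((p.1.2, p.1.1), p.2))); mproj.
apply: (@measurable_integral_itv _ _ _ (fun p : (R * R) * T => p.1.2) (fun p => p.1.1)
  (fun p u => (sv p.1.2 u p.2)%:E * J u p.2 (Q n p.1.1 (H p.1.1) u))); [by mproj|by mproj| |].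
  apply: emeasurable_funM.
    apply/measurable_EFinP.
    by apply: (measurableT_comp measurable_sv (g := fun q : ((R * R) * T) * R => ((q.1.1.2, q.2), q.1.2))); mproj.
  have := measurable_jump JJ IH (fun v u y => Q_ge0 n v u y (H0 v)).
  move=> h; apply: (measurableT_comp h (g := fun p : ((R * R) * T) * R => ((p.1.1.1, p.2), p.1.2))).
  by mproj.
move=> p u; rewrite mule_ge0 ?lee_fin ?expR_ge0//.
by apply: (jump_ge0 JJ) => y; exact: Q_ge0.
Qed.

Lemma measurable_Q_time n (H : R -> T -> \bar R) s x : jointly H -> (forall t y, 0 <= H t y) ->
  measurable_fun setT (fun v => Q n v (H v) s x).
Proof.
move=> mH H0; apply: (measurableT_comp (measurable_Q n mH H0) (g := fun v => ((v, s), x))).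
by mproj.
Qed.

Lemma jointly_cst G : measurable_fun setT G -> jointly (fun=> G).
Proof. by move=> mG; exact: (measurableT_comp mG measurable_snd). Qed.

Lemma jointly_lG G : measurable_fun setT G -> jointly (lG G).
Proof.
move=> mG; apply: emeasurable_funM; last exact: (measurableT_comp mG measurable_snd).
by apply/measurable_EFinP; exact: measurable_funD.
Qed.

Lemma jointly_jump G : measurable_fun setT G -> (forall y, 0 <= G y) ->
  jointly (fun v y => J v y G).
Proof.
move=> mG G0; have mG' : measurable_fun setT (fun p : (R * R) * T => G p.2).
  exact: (measurableT_comp mG measurable_snd).
have := measurable_jump JJ mG' (fun _ _ => G0).
move=> h; apply: (measurableT_comp h (g := fun p : R * T => ((p.1, p.1), p.2))).
by mproj.
Qed.

Lemma measurable_Q_state n t G s : measurable_fun setT G -> (forall y, 0 <= G y) ->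
  measurable_fun setT (Q n t G s).
Proof.
move=> mG G0; have mp : measurable_fun setT (fun x : T => ((t, s), x)) by mproj.
exact: (measurableT_comp (measurable_Q n (jointly_cst mG) (fun=> G0)) mp).
Qed.

Lemma jointly_Q n (H : R -> T -> \bar R) u : jointly H -> (forall t y, 0 <= H t y) ->
  jointly (fun v => Q n v (H v) u).
Proof.
move=> mH H0.
apply: (measurableT_comp (measurable_Q n mH H0) (g := fun p : R * T => ((p.1, u), p.2))).
by mproj.
Qed.

Lemma measurable_sv_time s x : measurable_fun setT (fun u => sv s u x).
Proof. by apply: (measurableT_comp measurable_sv (g := fun u => ((s, u), x))); mproj. Qed.

(** Exchanges the integration over the terminal time with that over the time of the first jump. *)
Lemma integral_QS m (H : R -> T -> \bar R) s t x : jointly H -> (forall t y, 0 <= H t y) ->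
  \int[leb]_(v in `[s, t]) Q m.+1 v (H v) s x =
  \int[leb]_(u in `[s, t]) ((sv s u x)%:E * J u x (fun y => \int[leb]_(v in `[u, t]) Q m v (H v) u y)).
Proof.
move=> mH H0 /=.
have mJ : measurable_fun setT (fun p : R * R => J p.1 x (Q m p.2 (H p.2) p.1)).
  have := measurable_jump JJ (measurable_Q m mH H0) (fun v u y => Q_ge0 m v u y (H0 v)).
  by move=> h; apply: (measurableT_comp h (g := fun p : R * R => ((p.2, p.1), x))); mproj.
have J0 u v : 0 <= J u x (Q m v (H v) u) by apply: (jump_ge0 JJ) => y; exact: Q_ge0.
rewrite (@triangle_swap _ (fun u v => (sv s u x)%:E * J u x (Q m v (H v) u))); last 2 first.
- apply: emeasurable_funM => //; apply/measurable_EFinP.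
  exact: (measurableT_comp (measurable_sv_time s x) measurable_fst).
- by move=> u v; rewrite mule_ge0 ?lee_fin ?expR_ge0.
apply: eq_integral => u _.
rewrite ge0_integralZl_EFin ?expR_ge0//; last first.
  apply: measurable_funTS; apply: (measurableT_comp mJ (g := fun v => (u, v))).
  by mproj.
by rewrite -(jump_integral JJ)//; [exact: jointly_Q|move=> v y; exact: Q_ge0].
Qed.

(** The integrated equation of the survival weight, with negative terms moved to the left so that it
    can be multiplied by a possibly infinite [G x]. *)
Lemma hazard_identity (s t : R) x : (s <= t)%R ->
  (sv s t x)%:E + \int[leb]_(v in `[s, t]) ((l v x + a') * sv s v x)%:E =
  1 + \int[leb]_(v in `[s, t]) (a * sv s v x)%:E.
Proof.
move=> st; have := @hazard_FTC R (l^~ x) (a - a') s t (@cl x) st; rewrite /= -/(sv s t x).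
have msv := measurable_sv_time s x.
have mlx : measurable_fun setT (l^~ x).
  by apply: (measurableT_comp ml (g := fun u => (u, x))); mproj.
have cL : {within `[s, t], continuous (fun u => \int[leb]_(v in `[s, u]) l v x)%R}.
  apply: (@parameterized_integral_continuous _ s t (l^~ x) st).
  apply: continuous_compact_integrable; first exact: segment_compact.
  by apply: continuous_subspaceT => v; exact: cl.
have cS : {within `[s, t], continuous (fun v => sv s v x)}.
  have cP : {within `[s, t], continuous (fun u => (a - a') * (u - s) - \int[leb]_(v in `[s, u]) l v x)%R}.
    move=> u; apply: cvgB.
      apply: continuous_subspaceT u => u.
      by apply: cvgM; [exact: cvg_cst|apply: cvgB; [exact: cvg_id|exact: cvg_cst]].
    exact: (cL u).
  by move=> u; exact: (cvg_comp _ _ (cP u) (@continuous_expR R _)).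
have ci (f : R -> R) : (forall u, {for u, continuous f}) ->
    leb.-integrable `[s, t] (fun v => (f v * sv s v x)%:E).
  move=> cf; apply: continuous_compact_integrable; first exact: segment_compact.
  move=> u; apply: cvgM; last exact: cS.
  by apply: continuous_subspaceT u => u; exact: cf.
have i1 : leb.-integrable `[s, t] (fun v => (a * sv s v x)%:E).
  by apply: ci => u; exact: cvg_cst.
have i2 : leb.-integrable `[s, t] (fun v => ((l v x + a') * sv s v x)%:E).
  by apply: (ci (fun v => l v x + a')%R) => u; apply: cvgD; [exact: cl|exact: cvg_cst].
have -> : \int[leb]_(v in `[s, t]) ((a - a' - l v x) * sv s v x)%:E =
    \int[leb]_(v in `[s, t]) (a * sv s v x)%:E - \int[leb]_(v in `[s, t]) ((l v x + a') * sv s v x)%:E.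
  rewrite -integralB; try by [exact: measurable_itv|exact: i1|exact: i2].
  by apply: eq_integral => v _; rewrite -EFinB; congr (_%:E); ring.
have f1 : \int[leb]_(v in `[s, t]) (a * sv s v x)%:E \is a fin_num.
  by apply: integrable_fin_num i1; exact: measurable_itv.
have f2 : \int[leb]_(v in `[s, t]) ((l v x + a') * sv s v x)%:E \is a fin_num.
  by apply: integrable_fin_num i2; exact: measurable_itv.
move: f1 f2; set A := \int[leb]_(v in _) (a * _)%:E; set B := \int[leb]_(v in _) _.
move=> /fineK <- /fineK <-; rewrite -!EFinB -!EFinD => -[h]; congr (_%:E).
by move: h; set u := fine A; set v := fine B => h; lra.
Qed.

(** The recursion splits off the first jump whereas the forward equation describes the last one.
    Induction on [n] reconciles them, since the integral over the first jump commutes with the time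
    integrals; for [n = 0] this is [hazard_identity] multiplied by [G x]. *)
Lemma forward_Q n (G : T -> \bar R) (s t : R) x : measurable_fun setT G -> (forall y, 0 <= G y) -> (s <= t)%R ->
  Q n t G s x + \int[leb]_(v in `[s, t]) Q n v (lG G v) s x =
  (if n is m.+1 then \int[leb]_(v in `[s, t]) Q m v (J v ^~ G) s x else G x) +
    \int[leb]_(v in `[s, t]) Q n v (fun y => a%:E * G y) s x.
Proof.
move=> mG G0; pose aG := (fun=> fun y => a%:E * G y) : R -> T -> \bar R.
have mlG := jointly_lG mG.
have lG0 v y : 0 <= lG G v y by rewrite mule_ge0// lee_fin addr_ge0.
have maG : jointly aG by apply: jointly_cst; exact: measurable_funeM.
have aG0 v y : 0 <= aG v y by rewrite mule_ge0.
have mJG := jointly_jump mG G0.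
have JG0 v y : 0 <= J v y G by exact: (jump_ge0 JJ).
have msv s' y := measurable_sv_time s' y.
elim: n s x => [|n IH] s x st.
  rewrite /=.
  have -> : \int[leb]_(v in `[s, t]) (lG G v x * (sv s v x)%:E) =
      G x * \int[leb]_(v in `[s, t]) ((l v x + a') * sv s v x)%:E.
    rewrite -ge0_integralZl//=.
    - by apply: eq_integral => v _; rewrite /lG [LHS]muleAC [LHS]muleC EFinM.
    - apply/measurable_EFinP; apply: measurable_funTS; apply: measurable_funM; last exact: msv.
      by apply: measurable_funD => //; apply: (measurableT_comp ml (g := fun u => (u, x))); mproj.
    - by move=> v _; rewrite lee_fin mulr_ge0 ?expR_ge0// addr_ge0.
  have -> : \int[leb]_(v in `[s, t]) (a%:E * G x * (sv s v x)%:E) =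
      G x * \int[leb]_(v in `[s, t]) (a * sv s v x)%:E.
    rewrite -ge0_integralZl//=.
    - by apply: eq_integral => v _; rewrite [LHS]muleAC [LHS]muleC EFinM.
    - by apply/measurable_EFinP; apply: measurable_funTS; apply: measurable_funM; [exact: measurable_cst|exact: msv].
    - by move=> v _; rewrite lee_fin mulr_ge0 ?expR_ge0.
  rewrite -ge0_muleDr ?lee_fin ?expR_ge0//; last first.
    by apply: integral_ge0 => v _; rewrite lee_fin mulr_ge0 ?expR_ge0// addr_ge0.
  rewrite hazard_identity// ge0_muleDr ?mule1//.
  by apply: integral_ge0 => v _; rewrite lee_fin mulr_ge0 ?expR_ge0.
have mQint (H : R -> T -> \bar R) m u : jointly H -> (forall t y, 0 <= H t y) ->
    measurable_fun setT (fun y => \int[leb]_(v in `[u, t]) Q m v (H v) u y).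
  move=> mH H0; apply: (@measurable_integral_itv _ _ _ (fun=> u) (fun=> t) (fun y v => Q m v (H v) u y));
    [by mproj|by mproj| |by move=> *; exact: Q_ge0].
  by apply: (measurableT_comp (measurable_Q m mH H0) (g := fun p : T * R => ((p.2, u), p.1))); mproj.
have mSJ (H : R -> T -> \bar R) : measurable_fun setT (fun p : R * T => H p.1 p.2) ->
    (forall u y, 0 <= H u y) -> measurable_fun `[s, t] (fun u => (sv s u x)%:E * J u x (H u)).
  move=> mH H0; apply: measurable_funTS; apply: emeasurable_funM; first exact/measurable_EFinP.
  have mH' : measurable_fun setT (fun p : (R * R) * T => H p.1.2 p.2).
    by apply: (measurableT_comp mH (g := fun p : (R * R) * T => (p.1.2, p.2))); mproj.
  have := measurable_jump JJ mH' (fun _ => H0).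
  by move=> h; apply: (measurableT_comp h (g := fun u => ((s, u), x))); mproj.
have SJ0 (H : R -> T -> \bar R) u : (forall u y, 0 <= H u y) -> 0 <= (sv s u x)%:E * J u x (H u).
  by move=> H0; rewrite mule_ge0 ?lee_fin ?expR_ge0//; exact: (jump_ge0 JJ).
have mQi (H : R -> T -> \bar R) m : jointly H -> (forall t y, 0 <= H t y) ->
    measurable_fun setT (fun p : R * T => \int[leb]_(v in `[p.1, t]) Q m v (H v) p.1 p.2).
  move=> mH H0; apply: (@measurable_integral_itv _ _ _ (fun p : R * T => p.1) (fun=> t) (fun p v => Q m v (H v) p.1 p.2));
    [by mproj|by mproj| |by move=> *; exact: Q_ge0].
  by apply: (measurableT_comp (measurable_Q m mH H0) (g := fun p : (R * T) * R => ((p.2, p.1.1), p.1.2))); mproj.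
have Qi0 (H : R -> T -> \bar R) m u y : (forall t y, 0 <= H t y) ->
   0 <= \int[leb]_(v in `[u, t]) Q m v (H v) u y.
  by move=> H0; apply: integral_ge0 => v _; exact: Q_ge0.
have mQG m : measurable_fun setT (fun p : R * T => Q m t G p.1 p.2).
  by apply: (measurableT_comp (measurable_Q m (jointly_cst mG) (fun=> G0)) (g := fun p : R * T => ((t, p.1), p.2))); mproj.
rewrite (integral_QS n s t x mlG lG0) (integral_QS n s t x maG aG0).
rewrite [X in X + _]/=.
rewrite -ge0_integralD//; last 4 first.
- by move=> u _; apply: SJ0 => ? ?; exact: Q_ge0.
- exact: (mSJ (fun u => Q n t G u) (mQG n) (fun u y => Q_ge0 n t u y G0)).
- by move=> u _; apply: (SJ0 (fun u y => \int[leb]_(v in `[u, t]) Q n v (lG G v) u y)) => ? ?; exact: Qi0.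
- by apply: (mSJ (fun u y => \int[leb]_(v in `[u, t]) Q n v (lG G v) u y)); [exact: mQi|move=> *; exact: Qi0].
(* [HJ] names the first term on the right of the induction hypothesis, so that the two cases of [n]
   are treated at once. *)
pose HJ u y := if n is m.+1 then \int[leb]_(v in `[u, t]) Q m v (J v ^~ G) u y else G y.
have mHJ : measurable_fun setT (fun p : R * T => HJ p.1 p.2).
  by rewrite /HJ; case: (n) => [|m]; [exact: jointly_cst|exact: mQi mJG JG0].
have HJ0 u y : 0 <= HJ u y by rewrite /HJ; case: (n) => [|m]; [exact: G0|exact: (Qi0 (fun v y => J v y G) m u y JG0)].
have -> : \int[leb]_(v in `[s, t]) Q n v (J v ^~ G) s x =
    \int[leb]_(u in `[s, t]) ((sv s u x)%:E * J u x (HJ u)).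
  rewrite /HJ; case: (n) => [|m]; last exact: (integral_QS m s t x mJG JG0).
  by apply: eq_integral => u _ /=; rewrite muleC.
have HJE u : (s <= u)%R -> (u <= t)%R -> forall y, Q n t G u y + \int[leb]_(v in `[u, t]) Q n v (lG G v) u y =
    HJ u y + \int[leb]_(v in `[u, t]) Q n v (aG v) u y.
  by move=> _ ut y; exact: IH.
clearbody HJ.
rewrite -ge0_integralD; last 5 first.
- exact: measurable_itv.
- by move=> u _; exact: (SJ0 HJ).
- exact: (mSJ HJ).
- by move=> u _; apply: (SJ0 (fun u y => \int[leb]_(v in `[u, t]) Q n v (aG v) u y)) => ? ?; exact: Qi0.
- by apply: (mSJ (fun u y => \int[leb]_(v in `[u, t]) Q n v (aG v) u y)); [exact: mQi|move=> *; exact: Qi0].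
apply: eq_integral => u; rewrite inE /= in_itv /= => /andP[su ut].
have mHJu : measurable_fun setT (HJ u).
  by apply: (measurableT_comp mHJ (g := fun y => (u, y))); mproj.
rewrite -!ge0_muleDr; try by [apply: (jump_ge0 JJ) => y; exact: Q_ge0|
  apply: (jump_ge0 JJ) => y; exact: Qi0|exact: (jump_ge0 JJ)].
congr (_ * _).
rewrite -!(jumpD JJ)//; try by [exact: mQint|move=> y; exact: Qi0|move=> y; exact: Q_ge0|exact: measurable_Q_state].
by congr (J u x _); apply/funext => y; exact: HJE.
Qed.

End discounted.
End jump_process.

Local Open Scope ereal_scope.

(** * The sum of Feller's series *)

Section minimal_semigroup.
Context d (T : measurableType d) {R : realType}.
Local Notation leb := (@lebesgue_measure R).
Variables (J : R -> T -> (T -> \bar R) -> \bar R) (l : R -> T -> R).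
Hypotheses (JJ : jump_operator J) (l_ge0 : forall u x, (0 <= l u x)%R)
  (ml : measurable_fun setT (fun p : R * T => l p.1 p.2))
  (cl : forall x u, {for u, continuous (l^~ x)}).

Section discounted.
Variables (a a' : R).
Hypotheses (a0 : (0 <= a)%R) (a'0 : (0 <= a')%R).
Let Q := Q J l a a'.
Let sv := sv l a a'.

Definition Pt t G s x : \bar R := \sum_(0 <= n <oo) Q n t G s x.

Lemma measurable_Q_integrand n t G s x : measurable_fun setT G -> (forall y, 0 <= G y) ->
  measurable_fun setT (fun u => (sv s u x)%:E * J u x (Q n t G u)).
Proof.
move=> mG G0; apply: emeasurable_funM.
  by apply/measurable_EFinP; exact: measurable_sv_time.
have mQ := measurable_Q JJ l_ge0 ml a a' n (jointly_cst mG) (fun=> G0).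
have := measurable_jump JJ mQ (fun v u y => Q_ge0 l JJ a a' n v u y G0).
by move=> h; apply: (measurableT_comp h (g := fun u => ((t, u), x))); mproj.
Qed.

Let integrand_ge0 n t G s u x : (forall y, 0 <= G y) -> 0 <= (sv s u x)%:E * J u x (Q n t G u).
Proof.
move=> G0; rewrite mule_ge0 ?lee_fin ?expR_ge0//.
by apply: (jump_ge0 JJ) => y; exact: (Q_ge0 _ JJ).
Qed.

Lemma QD n t G1 G2 s x : measurable_fun setT G1 -> measurable_fun setT G2 ->
  (forall y, 0 <= G1 y) -> (forall y, 0 <= G2 y) ->
  Q n t (fun y => G1 y + G2 y) s x = Q n t G1 s x + Q n t G2 s x.
Proof.
move=> mG1 mG2 G10 G20; elim: n s x => [|n IH] s x /=.
  by rewrite ge0_muleDl.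
rewrite -[RHS]ge0_integralD; last 5 first.
- exact: measurable_itv.
- by move=> u _; exact: integrand_ge0.
- by apply: measurable_funTS; exact: measurable_Q_integrand.
- by move=> u _; exact: integrand_ge0.
- by apply: measurable_funTS; exact: measurable_Q_integrand.
apply: eq_integral => u _; rewrite -ge0_muleDr.
- rewrite -(jumpD JJ); try by [exact: measurable_Q_state|move=> y; exact: (Q_ge0 _ JJ)].
  by congr (_ * J u x _); apply/funext => y; exact: IH.
- by apply: (jump_ge0 JJ) => y; exact: (Q_ge0 _ JJ).
- by apply: (jump_ge0 JJ) => y; exact: (Q_ge0 _ JJ).
Qed.

Lemma QZ n t (c : R) G s x : measurable_fun setT G -> (forall y, 0 <= G y) -> (0 <= c)%R ->
  Q n t (fun y => c%:E * G y) s x = c%:E * Q n t G s x.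
Proof.
move=> mG G0 c0; elim: n s x => [|n IH] s x /=; first by rewrite muleA.
rewrite -[RHS]ge0_integralZl_EFin; last 4 first.
- exact: measurable_itv.
- by move=> u _; exact: integrand_ge0.
- by apply: measurable_funTS; exact: measurable_Q_integrand.
- exact: c0.
apply: eq_integral => u _; rewrite [RHS]muleCA -[X in _ = _ * X](jumpZ JJ); last 3 first.
- exact: measurable_Q_state.
- by move=> y; exact: (Q_ge0 _ JJ).
- exact: c0.
by congr (_ * J u x _); apply/funext => y; exact: IH.
Qed.

Lemma le_Q n t G1 G2 s x : measurable_fun setT G1 -> measurable_fun setT G2 ->
  (forall y, 0 <= G1 y) -> (forall y, G1 y <= G2 y) -> Q n t G1 s x <= Q n t G2 s x.
Proof.
move=> mG1 mG2 G10 G12; have G20 y := le_trans (G10 y) (G12 y).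
elim: n s x => [|n IH] s x /=.
  by apply: lee_wpmul2r => //; rewrite lee_fin expR_ge0.
apply: ge0_le_integral.
- exact: measurable_itv.
- by move=> u _; exact: integrand_ge0.
- by apply: measurable_funTS; exact: measurable_Q_integrand.
- by apply: measurable_funTS; exact: measurable_Q_integrand.
move=> u _; apply: lee_wpmul2l; first by rewrite lee_fin expR_ge0.
apply: (le_jump JJ); try exact: measurable_Q_state.
- by move=> y; exact: (Q_ge0 _ JJ).
- by move=> y; exact: IH.
Qed.

Lemma Pt_ge0 t G s x : (forall y, 0 <= G y) -> 0 <= Pt t G s x.
Proof. by move=> G0; apply: nneseries_ge0 => n _ _; exact: (Q_ge0 _ JJ). Qed.

Lemma PtD t G1 G2 s x : measurable_fun setT G1 -> measurable_fun setT G2 ->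
  (forall y, 0 <= G1 y) -> (forall y, 0 <= G2 y) ->
  Pt t (fun y => G1 y + G2 y) s x = Pt t G1 s x + Pt t G2 s x.
Proof.
move=> mG1 mG2 G10 G20; rewrite /Pt -nneseriesD; last 2 first.
- by move=> n _ _; exact: (Q_ge0 _ JJ).
- by move=> n _ _; exact: (Q_ge0 _ JJ).
by apply: eq_eseriesr => n _; exact: QD.
Qed.

Lemma PtZ t (c : R) G s x : measurable_fun setT G -> (forall y, 0 <= G y) -> (0 <= c)%R ->
  Pt t (fun y => c%:E * G y) s x = c%:E * Pt t G s x.
Proof.
move=> mG G0 c0; rewrite /Pt -nneseriesZl; last by move=> n _; exact: (Q_ge0 _ JJ).
by apply: eq_eseriesr => n _; exact: QZ.
Qed.

Lemma le_Pt t G1 G2 s x : measurable_fun setT G1 -> measurable_fun setT G2 ->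
  (forall y, 0 <= G1 y) -> (forall y, G1 y <= G2 y) -> Pt t G1 s x <= Pt t G2 s x.
Proof.
move=> mG1 mG2 G10 G12; apply: lee_nneseries => n *; first exact: (Q_ge0 _ JJ).
exact: le_Q.
Qed.

Lemma measurable_Pt (H : R -> T -> \bar R) s x D : jointly H -> (forall t y, 0 <= H t y) ->
  measurable_fun D (fun v => Pt v (H v) s x).
Proof.
move=> mH H0; apply: measurable_funTS; rewrite /Pt.
apply: (ge0_emeasurable_sum (P := xpredT)) => [n v _ _|n _]; first exact: (Q_ge0 _ JJ).
exact: measurable_Q_time.
Qed.

Lemma integral_Pt (H : R -> T -> \bar R) s x D : measurable D -> jointly H -> (forall t y, 0 <= H t y) ->
  \int[leb]_(v in D) Pt v (H v) s x = \sum_(0 <= n <oo) \int[leb]_(v in D) Q n v (H v) s x.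
Proof.
move=> mD mH H0; rewrite -integral_nneseries//.
- by move=> n; apply: measurable_funTS; exact: measurable_Q_time.
- by move=> n v _; exact: (Q_ge0 _ JJ).
Qed.

(** Inflow into the term [n.+1] comes from the term [n], so summation shifts one series by an index
    and leaves the head [G x] over. *)
Lemma forward_Pt G (s t : R) x : measurable_fun setT G -> (forall y, 0 <= G y) -> (s <= t)%R ->
  Pt t G s x + \int[leb]_(v in `[s, t]) Pt v (lG l a' G v) s x =
  G x + \int[leb]_(v in `[s, t]) Pt v (J v ^~ G) s x +
    \int[leb]_(v in `[s, t]) Pt v (fun y => a%:E * G y) s x.
Proof.
move=> mG G0 st.
have mlG := jointly_lG ml a' mG.
have lG0 v y : 0 <= lG l a' G v y by rewrite mule_ge0// lee_fin addr_ge0.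
have mJG := jointly_jump JJ mG G0.
have JG0 v y : 0 <= J v y G by exact: (jump_ge0 JJ).
have maG : jointly (fun=> fun y => a%:E * G y) by apply: jointly_cst; exact: measurable_funeM.
have aG0 (v : R) y : 0 <= a%:E * G y by rewrite mule_ge0.
have i0 H n : (forall t y, 0 <= H t y) -> 0 <= \int[leb]_(v in `[s, t]) Q n v (H v) s x.
  by move=> H0; apply: integral_ge0 => v _; exact: (Q_ge0 _ JJ).
rewrite (integral_Pt s x (measurable_itv _) mlG lG0) (integral_Pt s x (measurable_itv _) mJG JG0).
rewrite (integral_Pt s x (measurable_itv _) maG aG0) /Pt.
rewrite -nneseriesD; last 2 first.
- by move=> n _ _; exact: (Q_ge0 _ JJ).
- by move=> n _ _; exact: i0.
rewrite (eq_eseriesr (fun n _ => forward_Q JJ l_ge0 ml cl a0 a'0 n x mG G0 st)).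
rewrite nneseriesD; last 2 first.
- by move=> [|n] _ _; [exact: G0|exact: (i0 (fun v y => J v y G) n JG0)].
- by move=> n _ _; exact: (i0 (fun=> fun y => a%:E * G y)).
congr (_ + _); rewrite nneseries_recl//; last first.
  by move=> [|n] _; [exact: G0|exact: (i0 (fun v y => J v y G) n JG0)].
congr (_ + _); rewrite -(@nneseries_addn _ _ 1%N); last first.
  by move=> [|n]; [exact: G0|exact: (i0 (fun v y => J v y G) n JG0)].
by apply: eq_eseriesr => n _; rewrite addn1.
Qed.

End discounted.

Lemma Q_discount (a a' : R) n t G (s : R) x : measurable_fun setT G -> (forall y, 0 <= G y) ->
  Q J l a a' n t G s x = (expR ((a - a') * (t - s)))%:E * Q J l 0 0 n t G s x.
Proof.
move=> mG G0; elim: n s x => [|n IH] s x /=.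
  rewrite muleCA -EFinM; congr (_ * _%:E).
  by rewrite /sv expRD subr0 mul0r add0r.
rewrite -ge0_integralZl_EFin; last 4 first.
- exact: measurable_itv.
- move=> u _; rewrite mule_ge0 ?lee_fin ?expR_ge0//.
  by apply: (jump_ge0 JJ) => y; exact: (Q_ge0 _ JJ).
- by apply: measurable_funTS; exact: measurable_Q_integrand.
- exact: expR_ge0.
apply: eq_integral => u _.
rewrite (_ : Q J l a a' n t G u = fun y => (expR ((a - a') * (t - u)))%:E * Q J l 0 0 n t G u y); last first.
  by apply/funext => y; exact: IH.
rewrite (jumpZ JJ); last 3 first.
- exact: measurable_Q_state.
- by move=> y; exact: (Q_ge0 _ JJ).
- exact: expR_ge0.
rewrite !muleA -!EFinM; congr (_%:E * _).
rewrite /sv expRD subr0 mul0r add0r mulrAC -expRD -mulrDr; congr (expR (_ * _) * _)%R.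
by ring.
Qed.

Lemma Pt_discount (a a' : R) t G (s : R) x : measurable_fun setT G -> (forall y, 0 <= G y) ->
  Pt a a' t G s x = (expR ((a - a') * (t - s)))%:E * Pt 0 0 t G s x.
Proof.
move=> mG G0; rewrite /Pt -nneseriesZl; last by move=> n _; exact: (Q_ge0 _ JJ).
by apply: eq_eseriesr => n _; exact: Q_discount.
Qed.

(* Telescoping: no finiteness is needed because only one term [\int Q_N (l W)] is kept. *)
Lemma Pt_supersolution (a' B : R) W (s t : R) x : (0 <= a')%R -> (0 <= B)%R ->
  measurable_fun setT W -> (forall y, 0 <= W y) ->
  (forall v y, J v y W <= lG l a' W v y + B%:E) -> (s <= t)%R ->
  Pt 0 a' t W s x <= W x + B%:E * \int[leb]_(v in `[s, t]) Pt 0 a' v (cst 1) s x.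
Proof.
move=> a'0 B0 mW W0 JW st.
pose q n := Q J l 0 a' n t W s x.
pose L n := \int[leb]_(v in `[s, t]) Q J l 0 a' n v (lG l a' W v) s x.
pose c n := \int[leb]_(v in `[s, t]) Q J l 0 a' n v (cst 1) s x.
have mlG := jointly_lG ml a' mW.
have lG0 v y : 0 <= lG l a' W v y by rewrite mule_ge0// lee_fin addr_ge0.
have mJW := jointly_jump JJ mW W0.
have JW0 v y : 0 <= J v y W by exact: (jump_ge0 JJ).
have L0 n : 0 <= L n by apply: integral_ge0 => v _; exact: (Q_ge0 _ JJ).
have c0 n : 0 <= c n by apply: integral_ge0 => v _; exact: (Q_ge0 _ JJ).
have q0 n : 0 <= q n by exact: (Q_ge0 _ JJ).
have qL n : q n + L n = if n is m.+1 then \int[leb]_(v in `[s, t]) Q J l 0 a' m v (J v ^~ W) s x else W x.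
  rewrite /q /L (forward_Q JJ l_ge0 ml cl (lexx 0%R) a'0 n x mW W0 st).
  rewrite [X in _ + X](_ : _ = 0) ?adde0//.
  apply: integral0_eq => v _.
  rewrite (QZ 0 a' n v s x mW W0 (lexx 0%R)); exact: mul0e.
have m1 : measurable_fun setT (cst 1 : T -> \bar R) by exact: measurable_cst.
have mQ1 n : measurable_fun setT (fun v => Q J l 0 a' n v (cst 1) s x).
  exact: (measurable_Q_time JJ l_ge0 ml 0 a' n s x (jointly_cst m1) (fun _ _ => lee01)).
have step n : \int[leb]_(v in `[s, t]) Q J l 0 a' n v (J v ^~ W) s x <= L n + B%:E * c n.
  have mv (H : R -> T -> \bar R) v : jointly H -> measurable_fun setT (H v).
    by move=> mH; apply: (measurableT_comp mH (g := fun y => (v, y))); mproj.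
  rewrite -ge0_integralZl_EFin; last 4 first.
  - exact: measurable_itv.
  - by move=> v _; exact: (Q_ge0 _ JJ).
  - by apply: measurable_funTS; exact: mQ1.
  - exact: B0.
  rewrite /L -ge0_integralD; last 5 first.
  - exact: measurable_itv.
  - by move=> v _; exact: (Q_ge0 _ JJ).
  - by apply: measurable_funTS; exact: measurable_Q_time.
  - by move=> v _; rewrite mule_ge0//; exact: (Q_ge0 _ JJ).
  - apply: measurable_funTS; apply: measurable_funeM.
    exact: mQ1.
  apply: ge0_le_integral.
  - exact: measurable_itv.
  - by move=> v _; exact: (Q_ge0 _ JJ).
  - by apply: measurable_funTS; exact: (measurable_Q_time JJ l_ge0 ml _ _ n s x mJW JW0).
  - apply: measurable_funTS; apply: emeasurable_funD.
      exact: measurable_Q_time.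
    apply: measurable_funeM.
    exact: mQ1.
  move=> v _.
  rewrite -(QZ 0 a' n v s x m1 (fun=> lee01) B0).
  rewrite -QD; last 4 first.
  - exact: mv mlG.
  - exact: measurable_funeM.
  - exact: lG0.
  - by move=> y; rewrite mule1 lee_fin.
  apply: le_Q.
  - exact: (mv (fun v y => J v y W)).
  - by apply: emeasurable_funD; [exact: mv mlG|exact: measurable_funeM].
  - exact: JW0.
  - by move=> y; rewrite mule1; exact: JW.
(* By [qL] and [step], passing to the next index replaces [L N] by [q N.+1 + L N.+1] at the cost
   [B c N]. *)
have tel N : \sum_(0 <= n < N.+1) q n + L N <= W x + B%:E * \sum_(0 <= n < N) c n.
  elim: N => [|N IH].
    by rewrite big_nat1 qL big_geq// mule0 adde0.
  rewrite big_nat_recr//= -addeA qL.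
  apply: le_trans (leeD2l _ (step N)) _.
  have sS : \sum_(0 <= n < N.+1) c n = \sum_(0 <= n < N) c n + c N by rewrite big_nat_recr.
  have e : B%:E * (\sum_(0 <= n < N) c n + c N) = B%:E * (\sum_(0 <= n < N) c n) + B%:E * c N.
    by apply: ge0_muleDr; [apply: sume_ge0 => i _; exact: c0|exact: c0].
  rewrite addeA sS e [X in _ <= X]addeA. apply: leeD; [exact: IH|exact: lexx].
rewrite (integral_Pt 0 a' s x (measurable_itv _) (jointly_cst (measurable_cst 1)) (fun _ _ => lee01)).
apply: lime_le; first by apply: is_cvg_nneseries => n _ _; exact: q0.
apply: nearW => N.
apply: (@le_trans _ _ (\sum_(0 <= n < N.+1) q n)).
  by rewrite big_nat_recr//= leeDl.
apply: le_trans (leeDl _ (L0 N)) _; apply: le_trans (tel N) _.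
apply: leeD2l; apply: lee_wpmul2l; first by rewrite lee_fin.
exact: nneseries_lim_ge.
Qed.

End minimal_semigroup.

Local Open Scope ereal_scope.

Lemma drift_sum_le {R : realType} (A B X Y Z b b' : R) : (0 <= A -> 0 <= B ->
  X + Z + b' + (Y - B + b) <= X + Y + (Z + A) + (b + b'))%R.
Proof. by move=> *; lra. Qed.

(** Subtracts two forward equations: [r] stands for rewards, [j] for inflow, [L] for outflow, [p]
    and [g] for final and initial values, [E] for constants. Finiteness permits the cancellation of
    [j] and [L]; [p1] is dropped by its sign. *)
Lemma forward_combine {R : realType} (r1 r2 j1 j2 L1 L2 p1 p2 g1 g2 E1 E2 : \bar R) :
  r1 \is a fin_num -> r2 \is a fin_num -> j1 \is a fin_num -> j2 \is a fin_num ->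
  L1 \is a fin_num -> L2 \is a fin_num -> p1 \is a fin_num -> p2 \is a fin_num ->
  g1 \is a fin_num -> g2 \is a fin_num -> E1 \is a fin_num -> E2 \is a fin_num ->
  r1 + j1 + L2 + E2 <= r2 + j2 + L1 + E1 -> p1 + L1 = g1 + j1 -> p2 + L2 = g2 + j2 ->
  0 <= p1 -> r1 - r2 <= g1 - g2 + p2 + (E1 - E2).
Proof.
do 12 move=> /fineK <-.
rewrite -!EFinD !lee_fin => h [h1] [h2] h3.
move: (fine r1) (fine r2) (fine j1) (fine j2) (fine L1) (fine L2) (fine p1) (fine p2)
  (fine g1) (fine g2) (fine E1) (fine E2) h h1 h2 h3 => *.
by lra.
Qed.

(** Rearranges an inequality with signed terms into one between sums of nonnegative terms, to which
    the monotonicity of the series applies. *)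
Lemma split_parts {R : realType} (A B : \bar R) (rho L1 L2 gam : R) :
  A \is a fin_num -> B \is a fin_num -> rho%:E + A + L2%:E <= B + (L1 + gam)%:E ->
  (Num.max rho 0)%:E + A + L2%:E + (Num.max (- gam) 0)%:E <=
  (Num.max (- rho) 0)%:E + B + L1%:E + (Num.max gam 0)%:E.
Proof.
move=> /fineK <- /fineK <-; rewrite -!EFinD !lee_fin.
move: (fine A) (fine B) => {}A {}B h.
have e (r : R) : (Num.max r 0 - Num.max (- r) 0 = r)%R.
  by case: (leP r 0%R) => hr; [rewrite max_l ?oppr_ge0// sub0r opprK|rewrite max_r ?subr0// oppr_le0 ltW].
have := e rho; have := e gam.
move: (Num.max rho 0)%R (Num.max (- rho) 0)%R (Num.max gam 0)%R (Num.max (- gam) 0)%R => *.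
by lra.
Qed.

Lemma growth_bound {R : realType} (e p b c w : R) : (1 <= e)%R -> (0 < c)%R -> (0 <= b)%R -> (0 <= w)%R ->
  (e * p <= w + b / c * (e - 1) -> p <= w + b / c)%R.
Proof.
move=> e1 c0 b0 w0 h; have k0 : (0 <= b / c)%R by rewrite divr_ge0// ltW.
move: h; set k := (b / c)%R in k0 * => h.
have e0 : (0 < e)%R := lt_le_trans ltr01 e1.
rewrite -(ler_pM2l e0); apply: le_trans h _.
have : (0 <= (e - 1) * w)%R by rewrite mulr_ge0// subr_ge0.
by move=> *; lra.
Qed.

(** * Moment bounds, non-explosion and the verification inequality *)

Section drift.
Context d (T : measurableType d) {R : realType}.
Local Notation leb := (@lebesgue_measure R).
Variables (J : R -> T -> (T -> \bar R) -> \bar R) (l : R -> T -> R).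
Hypotheses (JJ : jump_operator J) (l_ge0 : forall u x, (0 <= l u x)%R)
  (ml : measurable_fun setT (fun p : R * T => l p.1 p.2))
  (cl : forall x u, {for u, continuous (l^~ x)}).
Variables (w w' : T -> R) (c b c' b' M' : R).
Hypotheses (mw : measurable_fun setT w) (w1 : forall x, (1 <= w x)%R)
  (mw' : measurable_fun setT w') (w'0 : forall x, (0 <= w' x)%R)
  (c0 : (0 < c)%R) (b0 : (0 <= b)%R) (c'0 : (0 <= c')%R) (b'0 : (0 <= b')%R) (M'0 : (0 <= M')%R).
Hypotheses (Jw : forall u x, J u x (fun y => (w y)%:E) <= (l u x * w x - c * w x + b)%:E)
  (Jw' : forall u x, J u x (fun y => (w' y)%:E) <= (l u x * w' x + c' * w' x + b')%:E)
  (lw : forall u x, (l u x * w x <= M' * w' x)%R)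
  (J1 : forall u x, J u x (cst 1) = (l u x)%:E).

Local Notation Pt := (Pt J l).

Let w0 x : (0 <= w x)%R. Proof. exact: le_trans ler01 (w1 x). Qed.
Let m1 : measurable_fun setT (cst 1 : T -> \bar R). Proof. exact: measurable_cst. Qed.
(** Dominates, up to constants, the rates [l], the products [l w] and every function bounded by [w];
    finiteness of its mean justifies the cancellations below. *)
Let W y := (w' y + w y)%R.
Let W0 y : (0 <= W y)%R. Proof. exact: addr_ge0. Qed.
Let mW : measurable_fun setT (EFin \o W).
Proof. by apply/measurable_EFinP; exact: measurable_funD. Qed.
Let mEw : measurable_fun setT (EFin \o w). Proof. exact/measurable_EFinP. Qed.

Lemma Pt_le1 a' t x : (0 <= a')%R -> (0 <= t)%R -> Pt 0 a' t (cst 1) 0 x <= 1.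
Proof.
move=> a'0 t0.
have := @Pt_supersolution _ _ _ J l JJ l_ge0 ml cl a' 0 (cst 1) 0 t x a'0 (lexx _) m1 (fun=> lee01).
rewrite mul0e adde0; apply => //.
by move=> v y; rewrite J1 adde0 /lG mule1 lee_fin lerDl.
Qed.

Lemma integral_Pt1_le a' t x : (0 <= a')%R -> (0 <= t)%R ->
  \int[leb]_(v in `[0%R, t]) Pt 0 a' v (cst 1) 0 x <= t%:E.
Proof.
move=> a'0 t0; apply: (@le_trans _ _ (\int[leb]_(v in `[0%R, t]) (cst 1 v))).
  apply: ge0_le_integral.
  - exact: measurable_itv.
  - by move=> v _; exact: (Pt_ge0 _ JJ).
  - exact: (measurable_Pt JJ l_ge0 ml _ _ _ _ (jointly_cst m1) (fun _ _ => lee01)).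
  - exact: measurable_cst.
  - by move=> v; rewrite /= in_itv /= => /andP[v0 _]; exact: Pt_le1.
rewrite integral_cst; last exact: measurable_itv.
by rewrite mul1e /= lebesgue_measure_itv /= lte_fin; case: ltP => [_|]; rewrite ?sube0 ?lee_fin.
Qed.

(** Killing at rate [c'] absorbs the growth of [w'], so [W] becomes a supersolution up to the
    constant b + b'. Removing the killing costs the factor e^(c' t). *)
Lemma Pt_W_le (t : R) x : (0 <= t)%R ->
  Pt 0 0 t (EFin \o W) 0 x <= (expR (c' * t) * (W x + (b + b') * t))%:E.
Proof.
move=> t0.
have JWle v y : J v y (EFin \o W) <= lG l c' (EFin \o W) v y + (b + b')%:E.
  have -> : J v y (EFin \o W) = J v y (fun y => (w' y)%:E) + J v y (fun y => (w y)%:E).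
    rewrite -(jumpD JJ); [by []|exact/measurable_EFinP|exact/measurable_EFinP| |] => z;
      rewrite lee_fin; [exact: w'0|exact: w0].
  apply: le_trans (leeD (Jw' v y) (Jw v y)) _.
  rewrite /lG /= -!EFinD lee_fin /W.
  have h1 : (0 <= c' * w y)%R by rewrite mulr_ge0.
  have h2 : (0 <= c * w y)%R by rewrite mulr_ge0// ltW.
  by rewrite mulrDl !mulrDr; exact: drift_sum_le.
have := @Pt_supersolution _ _ _ J l JJ l_ge0 ml cl c' (b + b') (EFin \o W) 0 t x c'0
  (addr_ge0 b0 b'0) mW (fun y => W0 y) JWle t0.
rewrite (Pt_discount JJ l_ge0 ml 0 c' t 0 x mW (fun y => W0 y)) => h.
have {}h : (expR ((0 - c') * (t - 0)))%:E * Pt 0 0 t (EFin \o W) 0 x <= (W x + (b + b') * t)%:E.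
  apply: le_trans h _; rewrite [X in _ <= X]EFinD; apply: leeD; first exact: lexx.
  by rewrite [X in _ <= X]EFinM; apply: lee_wpmul2l; [rewrite lee_fin addr_ge0|exact: integral_Pt1_le].
have e : (expR (c' * t))%:E * ((expR ((0 - c') * (t - 0)))%:E * Pt 0 0 t (EFin \o W) 0 x) =
    Pt 0 0 t (EFin \o W) 0 x.
  have z : (c' * t + (0 - c') * (t - 0) = 0)%R by rewrite sub0r subr0 mulNr addrN.
  by rewrite muleA -EFinM -expRD z expR0 mul1e.
by rewrite -e EFinM; apply: lee_wpmul2l => //; rewrite lee_fin expR_ge0.
Qed.

Section dominated.
Variables (a a' : R) (k : R).
Hypothesis k0 : (0 <= k)%R.

Lemma Pt_fin G (t : R) x : (0 <= t)%R -> measurable_fun setT G ->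
  (forall y, 0 <= G y) -> (forall y, G y <= (k * W y)%:E) -> Pt a a' t G 0 x < +oo.
Proof.
move=> t0 mG G0 GW; rewrite (Pt_discount JJ l_ge0 ml a a' t 0 x mG G0).
apply: (@le_lt_trans _ _ ((expR ((a - a') * (t - 0)))%:E * (k%:E * Pt 0 0 t (EFin \o W) 0 x))).
  apply: lee_wpmul2l; first by rewrite lee_fin expR_ge0.
  rewrite -(PtZ JJ l_ge0 ml 0 0 t 0 x mW (fun y => W0 y) k0).
  by apply: (le_Pt JJ l_ge0 ml) => //; exact: measurable_funeM.
apply: (@le_lt_trans _ _ ((expR ((a - a') * (t - 0)))%:E * (k%:E * (expR (c' * t) * (W x + (b + b') * t))%:E))).
  apply: lee_wpmul2l; first by rewrite lee_fin expR_ge0.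
  by apply: lee_wpmul2l; [rewrite lee_fin|exact: Pt_W_le].
by rewrite -!EFinM ltry.
Qed.

Lemma integral_Pt_fin (H : R -> T -> \bar R) (t : R) x : (0 <= t)%R -> jointly H ->
  (forall v y, 0 <= H v y) -> (forall v y, H v y <= (k * W y)%:E) ->
  \int[leb]_(v in `[0%R, t]) Pt a a' v (H v) 0 x < +oo.
Proof.
move=> t0 mH H0 HW.
pose C := (expR (`|a - a'| * t) * (k * (expR (c' * t) * (W x + (b + b') * t))))%R.
have mHv v : measurable_fun setT (H v).
  by apply: (measurableT_comp mH (g := fun y => (v, y))); mproj.
apply: (@le_lt_trans _ _ (\int[leb]_(v in `[0%R, t]) (cst C%:E v))).
  apply: ge0_le_integral.
  - exact: measurable_itv.
  - by move=> v _; exact: (Pt_ge0 _ JJ).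
  - exact: (measurable_Pt JJ l_ge0 ml).
  - exact: measurable_cst.
  move=> v; rewrite /= in_itv /= => /andP[v0 vt].
  rewrite (Pt_discount JJ l_ge0 ml a a' v 0 x (mHv v) (H0 v)) /C EFinM.
  apply: lee_pmul.
  - by rewrite lee_fin expR_ge0.
  - exact: (Pt_ge0 _ JJ).
  - rewrite lee_fin ler_expR subr0; apply: (@le_trans _ _ (`|a - a'| * v)%R).
      by apply: ler_wpM2r => //; exact: ler_norm.
    by apply: ler_wpM2l => //; exact: normr_ge0.
  apply: (@le_trans _ _ (k%:E * Pt 0 0 v (EFin \o W) 0 x)).
    rewrite -(PtZ JJ l_ge0 ml 0 0 v 0 x mW (fun y => W0 y) k0).
    by apply: (le_Pt JJ l_ge0 ml) => //; exact: measurable_funeM.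
  rewrite EFinM; apply: lee_wpmul2l; first by rewrite lee_fin.
  apply: le_trans (Pt_W_le x v0) _; rewrite lee_fin.
  apply: ler_pM; first exact: expR_ge0.
  - by rewrite addr_ge0// mulr_ge0// addr_ge0.
  - by rewrite ler_expR ler_wpM2l.
  - by rewrite lerD2l ler_wpM2l// addr_ge0.
rewrite integral_cst; last exact: measurable_itv.
by rewrite /= lebesgue_measure_itv /= lte_fin; case: ifP => _; rewrite ?mule0 -?EFinD -?EFinM ltry.
Qed.

End dominated.

Let jointly_l : jointly (fun v y => (l v y)%:E). Proof. exact/measurable_EFinP. Qed.

Let l_W v y : (l v y)%:E <= (M' * W y)%:E.
Proof.
rewrite lee_fin; apply: (@le_trans _ _ (l v y * w y)%R); first by rewrite ler_peMr.
by apply: le_trans (lw v y) _; rewrite ler_wpM2l// lerDl.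
Qed.

(** For the constant 1 inflow and outflow coincide, and they cancel because they are finite. *)
Lemma Pt_mass_discount (a : R) (t : R) x : (0 <= a)%R -> (0 <= t)%R ->
  Pt a 0 t (cst 1) 0 x = 1 + \int[leb]_(v in `[0%R, t]) Pt a 0 v (fun=> a%:E) 0 x.
Proof.
move=> a0 t0.
have := forward_Pt JJ l_ge0 ml cl a0 (lexx 0%R) x m1 (fun=> lee01) t0.
have -> : lG l 0 (cst 1) = (fun v y => (l v y)%:E).
  by apply/funext => v; apply/funext => y; rewrite /lG addr0 mule1.
have -> : \int[leb]_(v in `[0%R, t]) Pt a 0 v (J v ^~ (cst 1)) 0 x =
    \int[leb]_(v in `[0%R, t]) Pt a 0 v (fun y => (l v y)%:E) 0 x.
  by apply: eq_integral => v _; congr (Pt a 0 v _ 0 x); apply/funext => y; rewrite J1.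
have -> : (fun y : T => a%:E * cst 1 y) = (fun=> a%:E) by apply/funext => y; rewrite mule1.
have fin := @integral_Pt_fin a 0 M' M'0 _ t x t0 jointly_l (fun v y => l_ge0 v y) l_W.
have fin0 : 0 <= \int[leb]_(v in `[0%R, t]) Pt a 0 v (fun y => (l v y)%:E) 0 x.
  by apply: integral_ge0 => v _; apply: (Pt_ge0 _ JJ) => y; exact: l_ge0.
move=> h; have f : \int[leb]_(v in `[0%R, t]) Pt a 0 v (fun y => (l v y)%:E) 0 x \is a fin_num.
  by rewrite ge0_fin_numE.
by rewrite -[LHS](addeK _ f) h [X in X - _]addeAC (addeK _ f).
Qed.

Lemma Pt_mass (t : R) x : (0 <= t)%R -> Pt 0 0 t (cst 1) 0 x = 1.
Proof.
move=> t0; rewrite (Pt_mass_discount x (lexx 0%R) t0) [X in _ + X](_ : _ = 0) ?adde0//.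
apply: integral0_eq => v _.
have := PtZ JJ l_ge0 ml 0 0 v 0 x m1 (fun=> lee01) (lexx 0%R).
by rewrite mul0e => <-; congr (Pt 0 0 v _ 0 x); apply/funext => y; rewrite mule1.
Qed.

(** The growth weight e^(c v) cancels the term -c w of the drift and leaves the constant [b];
    conservation of mass evaluates the weighted integral of [c] as e^(c t) - 1. Division by e^(c t)
    gives a bound uniform in time. *)
Lemma Pt_w_le (t : R) x : (0 <= t)%R -> Pt 0 0 t (EFin \o w) 0 x <= (w x + b / c)%:E.
Proof.
move=> t0.
have wE0 y : 0 <= (EFin \o w) y by rewrite lee_fin.
have := forward_Pt JJ l_ge0 ml cl (ltW c0) (lexx 0%R) x mEw wE0 t0.
have mlG := jointly_lG ml 0 mEw.
have lG0 v y : 0 <= lG l 0 (EFin \o w) v y by rewrite mule_ge0// lee_fin addr_ge0.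
set I := \int[leb]_(v in _) Pt c 0 v (lG _ _ _ _) 0 x.
have finI : I \is a fin_num.
  rewrite ge0_fin_numE; last by apply: integral_ge0 => v _; exact: (Pt_ge0 _ JJ).
  apply: (@integral_Pt_fin c 0 M' M'0 _ t x t0 mlG lG0) => v y.
  rewrite /lG addr0 /= lee_fin; apply: le_trans (lw v y) _.
  by rewrite ler_wpM2l// lerDl.
have mJw := jointly_jump JJ mEw wE0.
have Jw0 v y : 0 <= J v y (EFin \o w) by exact: (jump_ge0 JJ).
have mcw : measurable_fun setT (fun y => c%:E * (EFin \o w) y) by exact: measurable_funeM.
have cw0 y : 0 <= c%:E * (EFin \o w) y by rewrite mule_ge0// lee_fin ltW.
have mc : measurable_fun setT (cst c%:E : T -> \bar R) by exact: measurable_cst.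
have mb : measurable_fun setT (cst b%:E : T -> \bar R) by exact: measurable_cst.
have bnd : \int[leb]_(v in `[0%R, t]) Pt c 0 v (J v ^~ (EFin \o w)) 0 x +
    \int[leb]_(v in `[0%R, t]) Pt c 0 v (fun y => c%:E * (EFin \o w) y) 0 x <=
    I + (b / c)%:E * \int[leb]_(v in `[0%R, t]) Pt c 0 v (fun=> c%:E) 0 x.
  rewrite -ge0_integralZl_EFin; last 4 first.
  - exact: measurable_itv.
  - by move=> v _; apply: (Pt_ge0 _ JJ) => y; rewrite lee_fin ltW.
  - by apply: (measurable_Pt JJ l_ge0 ml); [exact: jointly_cst|move=> *; rewrite lee_fin ltW].
  - by rewrite divr_ge0// ltW.
  rewrite -ge0_integralD; last 5 first.
  - exact: measurable_itv.
  - by move=> v _; exact: (Pt_ge0 _ JJ).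
  - exact: (measurable_Pt JJ l_ge0 ml _ _ _ _ mJw Jw0).
  - by move=> v _; exact: (Pt_ge0 _ JJ).
  - exact: (measurable_Pt JJ l_ge0 ml _ _ _ _ (jointly_cst mcw) (fun=> cw0)).
  rewrite -ge0_integralD; last 5 first.
  - exact: measurable_itv.
  - by move=> v _; exact: (Pt_ge0 _ JJ).
  - exact: (measurable_Pt JJ l_ge0 ml).
  - move=> v _; apply: mule_ge0; first by rewrite lee_fin divr_ge0// ltW.
    by apply: (Pt_ge0 _ JJ) => y; rewrite lee_fin ltW.
  - apply: measurable_funeM.
    by apply: (measurable_Pt JJ l_ge0 ml); [exact: jointly_cst|move=> *; rewrite lee_fin ltW].
  have cst0 (y : T) : 0 <= c%:E by rewrite lee_fin ltW.
  apply: ge0_le_integral.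
  - exact: measurable_itv.
  - by move=> v _; rewrite adde_ge0//; exact: (Pt_ge0 _ JJ).
  - apply: emeasurable_funD.
      exact: (measurable_Pt JJ l_ge0 ml _ _ _ _ mJw Jw0).
    exact: (measurable_Pt JJ l_ge0 ml _ _ _ _ (jointly_cst mcw) (fun=> cw0)).
  - apply: emeasurable_funD; first exact: (measurable_Pt JJ l_ge0 ml).
    apply: measurable_funeM.
    exact: (measurable_Pt JJ l_ge0 ml _ _ _ _ (jointly_cst mc) (fun=> cst0)).
  have bc0 : (0 <= b / c)%R by rewrite divr_ge0// ltW.
  move=> v _; rewrite -(PtZ JJ l_ge0 ml c 0 v 0 x mc cst0 bc0).
  have mJv : measurable_fun setT (J v ^~ (EFin \o w)).
    by apply: (measurableT_comp mJw (g := fun y => (v, y))); mproj.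
  have mlv : measurable_fun setT (lG l 0 (EFin \o w) v).
    by apply: (measurableT_comp mlG (g := fun y => (v, y))); mproj.
  have bce : (fun y : T => (b / c)%:E * cst c%:E y) = cst b%:E.
    by apply/funext => y; rewrite /= -EFinM divfK// gt_eqF.
  rewrite bce -(PtD JJ l_ge0 ml c 0 v 0 x mJv mcw (Jw0 v) cw0).
  rewrite -(PtD JJ l_ge0 ml c 0 v 0 x mlv mb (lG0 v) (fun=> b0)).
  apply: (le_Pt JJ l_ge0 ml).
  - exact: emeasurable_funD.
  - exact: emeasurable_funD.
  - by move=> y; rewrite adde_ge0.
  move=> y; apply: le_trans (leeD (Jw v y) (lexx _)) _.
  rewrite /lG /= -!EFinM -!EFinD lee_fin addr0.
  by rewrite -addrA [(b + _)%R]addrC addrA subrK.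
have mass := Pt_mass_discount x (ltW c0) t0.
have Pc1 : Pt c 0 t (cst 1) 0 x = (expR (c * t))%:E.
  by rewrite (Pt_discount JJ l_ge0 ml c 0 t 0 x m1 (fun=> lee01)) Pt_mass// mule1 !subr0.
move: mass; rewrite Pc1.
have : 0 <= \int[leb]_(v in `[0%R, t]) Pt c 0 v (fun=> c%:E) 0 x.
  by apply: integral_ge0 => v _; apply: (Pt_ge0 _ JJ) => y; rewrite lee_fin ltW.
have pt0 : 0 <= Pt 0 0 t (EFin \o w) 0 x by exact: (Pt_ge0 _ JJ).
have ptfin : Pt 0 0 t (EFin \o w) 0 x \is a fin_num.
  rewrite ge0_fin_numE//; apply: (@Pt_fin 0 0 1 ler01) => // y.
  by rewrite lee_fin mul1r lerDr.
rewrite (Pt_discount JJ l_ge0 ml c 0 t 0 x mEw wE0) !subr0.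
move: bnd; set I1 := \int[leb]_(v in _) Pt c 0 v (J v ^~ _) 0 x.
set I2 := \int[leb]_(v in _) Pt c 0 v (fun y => c%:E * _) 0 x.
case: (\int[leb]_(v in `[0%R, t]) Pt c 0 v (fun=> c%:E) 0 x) => [r| |] bnd r0 mass eq; last 2 first.
  by [].
  by [].
case: mass => mass.
have : (expR (c * t))%:E * Pt 0 0 t (EFin \o w) 0 x + I <= (w x + b / c * (expR (c * t) - 1))%:E + I.
  have -> : (expR (c * t) - 1 = r)%R by rewrite mass addrAC subrr add0r.
  rewrite eq -addeA; apply: le_trans (leeD (lexx _) bnd) _.
  by rewrite addeA [X in _ <= X]addeC EFinD EFinM addeCA addeA.
rewrite leeD2rE// -(fineK ptfin) -EFinM !lee_fin.
apply: growth_bound => //; first by rewrite -expR0 ler_expR mulr_ge0// ltW.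
Qed.

Let jwfin v y (k : R) : (0 <= k)%R -> J v y (fun z => (k * w z)%:E) \is a fin_num.
Proof.
move=> k0.
have wE0 z : 0 <= (EFin \o w) z by rewrite lee_fin.
have -> : J v y (fun z => (k * w z)%:E) = k%:E * J v y (EFin \o w) by exact: (jumpZ JJ v y mEw wE0 k0).
rewrite fin_numM// ge0_fin_numE; last exact: (jump_ge0 JJ).
exact: le_lt_trans (Jw v y) (ltry _).
Qed.

Lemma jump_weighted_fin v y (C : R) (u : T -> R) : measurable_fun setT u -> (0 <= C)%R ->
  (forall z, `|u z| <= C * w z)%R ->
  J v y (fun z => (u z + C * w z)%:E) \is a fin_num.
Proof.
move=> mu C0 uC.
have uw z : (0 <= u z + C * w z)%R by rewrite -lerBlDr sub0r; have := uC z; rewrite ler_norml => /andP[].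
rewrite ge0_fin_numE; last by apply: (jump_ge0 JJ) => z; rewrite lee_fin.
have := jwfin v y (addr_ge0 C0 C0); rewrite ge0_fin_numE; last first.
  by apply: (jump_ge0 JJ) => z; rewrite lee_fin mulr_ge0// addr_ge0.
apply: le_lt_trans; apply: (le_jump JJ).
- by apply/measurable_EFinP; apply: measurable_funD => //; exact: measurable_funM.
- by apply/measurable_EFinP; exact: measurable_funM.
- by move=> z; rewrite lee_fin.
- by move=> z; rewrite lee_fin mulrDl lerD2r; apply: le_trans (uC z); exact: ler_norm.
Qed.

(** The last hypothesis is rho + J u - (l + alpha) u <= gam, written for the nonnegative functions u
    + C w and C w. Their forward equations, with killing at rate alpha as discount, are subtracted;
    the final value of u + C w is dropped and that of C w becomes the error term through
    [Pt_w_le]. *)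
Lemma verification (alpha gam M C : R) (rho : R -> T -> R) (u : T -> R) (t : R) x :
  (0 <= alpha)%R -> (0 <= M)%R -> (0 <= C)%R -> (0 <= t)%R ->
  measurable_fun setT (fun p : R * T => rho p.1 p.2) -> measurable_fun setT u ->
  (forall v y, `|rho v y| <= M * w y)%R -> (forall y, `|u y| <= C * w y)%R ->
  (forall v y, (rho v y)%:E + J v y (fun z => (u z + C * w z)%:E) + ((l v y + alpha) * (C * w y))%:E <=
     J v y (fun z => (C * w z)%:E) + ((l v y + alpha) * (u y + C * w y) + gam)%:E) ->
  \int[leb]_(v in `[0%R, t]) ((expR (- (alpha * v)))%:E *
     (Pt 0 0 v (fun y => (Num.max (rho v y) 0)%:E) 0 x - Pt 0 0 v (fun y => (Num.max (- rho v y) 0)%:E) 0 x)) <=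
  (u x + C * expR (- (alpha * t)) * (w x + b / c))%:E +
    gam%:E * \int[leb]_(v in `[0%R, t]) (expR (- (alpha * v)))%:E.
Proof.
move=> al0 M0 C0 t0 mrho mu rhoM uC H.
have uw z : (0 <= u z + C * w z)%R by rewrite -lerBlDr sub0r; have := uC z; rewrite ler_norml => /andP[].
have Cw z : (0 <= C * w z)%R by rewrite mulr_ge0.
pose G1 z := (u z + C * w z)%:E; pose G2 z := (C * w z)%:E.
have mG2 : measurable_fun setT G2 by apply/measurable_EFinP; exact: measurable_funM.
have mG1 : measurable_fun setT G1.
  by apply/measurable_EFinP; apply: measurable_funD => //; exact: measurable_funM.
have G10 z : 0 <= G1 z by rewrite lee_fin.
have G20 z : 0 <= G2 z by rewrite lee_fin.
pose rp v y := (Num.max (rho v y) 0)%:E; pose rm v y := (Num.max (- rho v y) 0)%:E.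
have rp0 v y : 0 <= rp v y by rewrite lee_fin le_max lexx orbT.
have rm0 v y : 0 <= rm v y by rewrite lee_fin le_max lexx orbT.
have mrp : jointly rp by apply/measurable_EFinP; apply: measurable_maxr => //; exact: measurable_cst.
have mrm : jointly rm.
  by apply/measurable_EFinP; apply: measurable_maxr; [exact: measurableT_comp mrho|exact: measurable_cst].
have Mw z : (0 <= M * w z)%R by rewrite mulr_ge0.
have rpM v y : rp v y <= (M * w y)%:E.
  by rewrite lee_fin ge_max Mw andbT; apply: le_trans (rhoM v y); exact: ler_norm.
have rmM v y : rm v y <= (M * w y)%:E.
  by rewrite lee_fin ge_max Mw andbT; apply: le_trans (rhoM v y); rewrite -normrN; exact: ler_norm.
have wW k y : (0 <= k)%R -> (k * w y <= k * W y)%R by move=> k0; rewrite ler_wpM2l// lerDr.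
have mJ1 := jointly_jump JJ mG1 G10; have mJ2 := jointly_jump JJ mG2 G20.
have J10 v y : 0 <= J v y G1 by exact: (jump_ge0 JJ).
have J20 v y : 0 <= J v y G2 by exact: (jump_ge0 JJ).
have mL1 := jointly_lG ml alpha mG1; have mL2 := jointly_lG ml alpha mG2.
have L10 v y : 0 <= lG l alpha G1 v y by rewrite mule_ge0// lee_fin addr_ge0.
have L20 v y : 0 <= lG l alpha G2 v y by rewrite mule_ge0// lee_fin addr_ge0.
have gp0 : (0 <= Num.max gam 0)%R by rewrite le_max lexx orbT.
have gm0 : (0 <= Num.max (- gam) 0)%R by rewrite le_max lexx orbT.
pose I H := \int[leb]_(v in `[0%R, t]) Pt 0 alpha v (H v) 0 x.
have I0 F : (forall v y, 0 <= F v y) -> 0 <= I F.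
  by move=> F0; apply: integral_ge0 => v _; exact: (Pt_ge0 _ JJ).
have Ifin F (k : R) : (0 <= k)%R -> jointly F -> (forall v y, 0 <= F v y) ->
    (forall v y, F v y <= (k * W y)%:E) -> I F \is a fin_num.
  move=> k0 mF F0 FW; rewrite ge0_fin_numE ?I0//.
  exact: (@integral_Pt_fin 0 alpha k k0 F t x t0 mF F0 FW).
have ID F1 F2 : jointly F1 -> jointly F2 -> (forall v y, 0 <= F1 v y) -> (forall v y, 0 <= F2 v y) ->
    I (fun v y => F1 v y + F2 v y) = I F1 + I F2.
  move=> m1' m2' p1 p2; rewrite /I -ge0_integralD; last 5 first.
  - exact: measurable_itv.
  - by move=> v _; exact: (Pt_ge0 _ JJ).
  - exact: (measurable_Pt JJ l_ge0 ml).
  - by move=> v _; exact: (Pt_ge0 _ JJ).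
  - exact: (measurable_Pt JJ l_ge0 ml).
  apply: eq_integral => v _; rewrite (PtD JJ l_ge0 ml)//.
    by apply: (measurableT_comp m1' (g := fun y => (v, y))); mproj.
  by apply: (measurableT_comp m2' (g := fun y => (v, y))); mproj.
have lI F1 F2 : jointly F1 -> jointly F2 -> (forall v y, 0 <= F1 v y) -> (forall v y, F1 v y <= F2 v y) ->
    I F1 <= I F2.
  move=> m1' m2' p1 p12; apply: ge0_le_integral.
  - exact: measurable_itv.
  - by move=> v _; exact: (Pt_ge0 _ JJ).
  - exact: (measurable_Pt JJ l_ge0 ml).
  - by apply: (measurable_Pt JJ l_ge0 ml) => // v y; exact: le_trans (p12 v y).
  - move=> v _; apply: (le_Pt JJ l_ge0 ml) => //.
      by apply: (measurableT_comp m1' (g := fun y => (v, y))); mproj.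
    by apply: (measurableT_comp m2' (g := fun y => (v, y))); mproj.
pose Ec (k : R) : R -> T -> \bar R := fun _ _ => k%:E.
have mEc k : jointly (Ec k) by exact: measurable_cst.
pose E := \int[leb]_(v in `[0%R, t]) (expR (- (alpha * v)))%:E.
have mexp D : measurable_fun D (fun v : R => (expR (- (alpha * v)))%:E).
  apply/measurable_EFinP; apply: measurable_funTS; apply: measurableT_comp => //.
  by apply: measurableT_comp => //; exact: measurable_funM.
(* By conservation of mass a constant integrates to a multiple of the discounted length [E] of the
   time interval. *)
have IEc k : (0 <= k)%R -> I (Ec k) = k%:E * E.
  move=> k0; rewrite /E -ge0_integralZl_EFin; last 4 first.
  - exact: measurable_itv.
  - by move=> v _; rewrite lee_fin expR_ge0.
  - exact: mexp.
  - exact: k0.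
  apply: eq_integral => v; rewrite inE /= in_itv /= => /andP[v0 _].
  rewrite (_ : Ec k v = fun y => k%:E * cst 1 y); last by apply/funext => y; rewrite mule1.
  rewrite (PtZ JJ l_ge0 ml 0 alpha v 0 x m1 (fun=> lee01) k0).
  by rewrite (Pt_discount JJ l_ge0 ml 0 alpha v 0 x m1 (fun=> lee01)) Pt_mass// mule1 sub0r subr0 mulNr.
have main : I rp + I (fun v y => J v y G1) + I (lG l alpha G2) + I (Ec (Num.max (- gam) 0)%R) <=
   I rm + I (fun v y => J v y G2) + I (lG l alpha G1) + I (Ec (Num.max gam 0)%R).
  have a1 : jointly (fun v y => rp v y + J v y G1) by exact: emeasurable_funD.
  have a2 : jointly (fun v y => rp v y + J v y G1 + lG l alpha G2 v y) by exact: emeasurable_funD.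
  have b1 : jointly (fun v y => rm v y + J v y G2) by exact: emeasurable_funD.
  have b2 : jointly (fun v y => rm v y + J v y G2 + lG l alpha G1 v y) by exact: emeasurable_funD.
  have a10 v y : 0 <= rp v y + J v y G1 by rewrite adde_ge0.
  have a20 v y : 0 <= rp v y + J v y G1 + lG l alpha G2 v y by rewrite adde_ge0.
  have b10 v y : 0 <= rm v y + J v y G2 by rewrite adde_ge0.
  have b20 v y : 0 <= rm v y + J v y G2 + lG l alpha G1 v y by rewrite adde_ge0.
  have e0 k v y : (0 <= k)%R -> 0 <= Ec k v y by rewrite lee_fin.
  rewrite -(ID _ _ mrp mJ1 rp0 J10) -(ID _ _ a1 mL2 a10 L20) -(ID _ _ a2 (mEc _) a20 (fun v y => e0 _ v y gm0)).
  rewrite -(ID _ _ mrm mJ2 rm0 J20) -(ID _ _ b1 mL1 b10 L10) -(ID _ _ b2 (mEc _) b20 (fun v y => e0 _ v y gp0)).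
  apply: lI.
  - by apply: emeasurable_funD.
  - by apply: emeasurable_funD.
  - by move=> v y; apply: adde_ge0; [exact: a20|exact: e0].
  move=> v y; apply: split_parts (H v y); first exact: jump_weighted_fin.
  exact: jwfin.
have fwd G : measurable_fun setT G -> (forall y, 0 <= G y) ->
    Pt 0 alpha t G 0 x + I (lG l alpha G) = G x + I (fun v y => J v y G).
  move=> mG G0; rewrite /I (forward_Pt JJ l_ge0 ml cl (lexx 0%R) al0 x mG G0 t0).
  rewrite [X in _ + X](_ : _ = 0) ?adde0//; apply: integral0_eq => v _.
  by rewrite (PtZ JJ l_ge0 ml 0 alpha v 0 x mG G0 (lexx 0%R)) mul0e.
have C20 : (0 <= C + C)%R by rewrite addr_ge0.
have G1W y : G1 y <= ((C + C) * w y)%:E.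
  by rewrite lee_fin mulrDl lerD2r; apply: le_trans (uC y); exact: ler_norm.
have G2W y : G2 y <= ((C + C) * w y)%:E by rewrite lee_fin mulrDl lerDl.
have Lfin G : measurable_fun setT G -> (forall y, 0 <= G y) -> (forall y, G y <= ((C + C) * w y)%:E) ->
    I (lG l alpha G) \is a fin_num.
  move=> mG G0 GW; apply: (Ifin _ ((C + C) * (M' + alpha))%R).
  - by rewrite mulr_ge0// addr_ge0.
  - exact: jointly_lG.
  - by move=> v y; rewrite mule_ge0// lee_fin addr_ge0.
  move=> v y; apply: (@le_trans _ _ ((l v y + alpha)%:E * ((C + C) * w y)%:E)).
    by apply: lee_wpmul2l; [rewrite lee_fin addr_ge0|exact: GW].
  rewrite lee_fin mulrCA -mulrA; apply: ler_wpM2l => //; rewrite mulrDl [leRHS]mulrDl.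
  apply: lerD; last exact: wW.
  by apply: le_trans (lw v y) _; rewrite ler_wpM2l// lerDl.
have PGfin G : measurable_fun setT G -> (forall y, 0 <= G y) -> (forall y, G y <= ((C + C) * w y)%:E) ->
    Pt 0 alpha t G 0 x \is a fin_num.
  move=> mG G0 GW; rewrite ge0_fin_numE; last exact: (Pt_ge0 _ JJ).
  apply: (@Pt_fin 0 alpha _ C20) => // y; apply: le_trans (GW y) _.
  by rewrite lee_fin; exact: wW.
(* Finiteness of the inflow is read off the forward equation, whose other terms are already
   finite. *)
have Jfin G : measurable_fun setT G -> (forall y, 0 <= G y) -> (forall y, G y <= ((C + C) * w y)%:E) ->
    I (fun v y => J v y G) \is a fin_num.
  move=> mG G0 GW; have := fwd G mG G0.
  have h1 := Lfin G mG G0 GW; have h2 := PGfin G mG G0 GW => e.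
  have : G x + I (fun v y => J v y G) \is a fin_num by rewrite -e fin_numD h2 h1.
  by rewrite fin_numD => /andP[].
have rfin r : jointly r -> (forall v y, 0 <= r v y) -> (forall v y, r v y <= (M * w y)%:E) -> I r \is a fin_num.
  move=> mr r0 rM; apply: (Ifin r M M0 mr r0) => v y; apply: le_trans (rM v y) _.
  by rewrite lee_fin; exact: wW.
have Efin : E \is a fin_num.
  have <- : I (Ec 1%R) = E by rewrite IEc// mul1e.
  apply: (Ifin _ 1%R) => // v y; rewrite lee_fin mul1r.
  by apply: le_trans (w1 y) _; rewrite lerDr.
have Efin' k : (0 <= k)%R -> I (Ec k) \is a fin_num by move=> k0; rewrite IEc// fin_numM.
have concl : I rp - I rm <= G1 x - G2 x + Pt 0 alpha t G2 0 x +
    (I (Ec (Num.max gam 0)%R) - I (Ec (Num.max (- gam) 0)%R)).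
  apply: (forward_combine _ _ _ _ _ _ _ _ _ _ _ _ main (fwd _ mG1 G10) (fwd _ mG2 G20)).
  - exact: rfin.
  - exact: rfin.
  - exact: Jfin.
  - exact: Jfin.
  - exact: Lfin.
  - exact: Lfin.
  - exact: PGfin.
  - exact: PGfin.
  - by [].
  - by [].
  - exact: Efin'.
  - exact: Efin'.
  - exact: (Pt_ge0 _ JJ).
have P2 : Pt 0 alpha t G2 0 x <= (C * expR (- (alpha * t)) * (w x + b / c))%:E.
  rewrite (Pt_discount JJ l_ge0 ml 0 alpha t 0 x mG2 G20) sub0r subr0 mulNr.
  rewrite (_ : G2 = fun y => C%:E * (EFin \o w) y)//.
  rewrite (PtZ JJ l_ge0 ml 0 0 t 0 x mEw _ C0); last by move=> y; rewrite lee_fin.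
  rewrite muleA -EFinM mulrC [leRHS]EFinM; apply: lee_wpmul2l; last exact: Pt_w_le.
  by rewrite lee_fin mulr_ge0// expR_ge0.
have EE : I (Ec (Num.max gam 0)%R) - I (Ec (Num.max (- gam) 0)%R) = gam%:E * E.
  rewrite !IEc// -(fineK Efin) -!EFinM -EFinB -mulrBl; congr (_ * _)%:E.
  by case: (leP gam 0%R) => hr; [rewrite max_l ?oppr_ge0// sub0r opprK|rewrite max_r ?subr0// oppr_le0 ltW].
have lhs : \int[leb]_(v in `[0%R, t]) ((expR (- (alpha * v)))%:E *
     (Pt 0 0 v (rp v) 0 x - Pt 0 0 v (rm v) 0 x)) = I rp - I rm.
  have mv (F : R -> T -> \bar R) v : jointly F -> measurable_fun setT (F v).
    by move=> mF; apply: (measurableT_comp mF (g := fun y => (v, y))); mproj.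
  rewrite /I -integralB; last 3 first.
  - exact: measurable_itv.
  - apply/integrableP; split; first exact: (measurable_Pt JJ l_ge0 ml).
    have := rfin _ mrp rp0 rpM; rewrite ge0_fin_numE ?I0//; apply: le_lt_trans.
    rewrite le_eqVlt; apply/orP; left; apply/eqP; apply: eq_integral => v _.
    by rewrite gee0_abs//; exact: (Pt_ge0 _ JJ).
  - apply/integrableP; split; first exact: (measurable_Pt JJ l_ge0 ml).
    have := rfin _ mrm rm0 rmM; rewrite ge0_fin_numE ?I0//; apply: le_lt_trans.
    rewrite le_eqVlt; apply/orP; left; apply/eqP; apply: eq_integral => v _.
    by rewrite gee0_abs//; exact: (Pt_ge0 _ JJ).
  apply: eq_integral => v; rewrite inE /= in_itv /= => /andP[v0 _].
  rewrite (Pt_discount JJ l_ge0 ml 0 alpha v 0 x (mv _ v mrp) (rp0 v)).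
  rewrite (Pt_discount JJ l_ge0 ml 0 alpha v 0 x (mv _ v mrm) (rm0 v)).
  rewrite sub0r subr0 mulNr muleBr//.
  apply: fin_num_adde_defr; rewrite ge0_fin_numE; last exact: (Pt_ge0 _ JJ).
  apply: (@Pt_fin 0 0 M M0 _ v x v0 (mv _ v mrp) (rp0 v)) => y.
  by apply: le_trans (rpM v y) _; rewrite lee_fin; exact: wW.
rewrite lhs; apply: le_trans concl _; rewrite EE; apply: leeD; last exact: lexx.
rewrite EFinD; apply: leeD => //.
by rewrite /G1 /G2 -EFinB lee_fin addrK.
Qed.

End drift.

Local Open Scope ereal_scope.

(** * Concentrated measures and families of finite measures *)

Section concentrated.
Context d (T : measurableType d) {R : realType} (mu : {measure set T -> \bar R}) (D : set T).
Hypotheses (mD : measurable D) (muD : mu (~` D) = 0).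
Import HBNNSimple.

Let ge0_integral_concentrated (f : T -> \bar R) : (forall x, 0 <= f x) ->
  \int[mu]_x f x = \int[mu]_x (f \_ D) x.
Proof.
move=> f0; have fD0 x : 0 <= (f \_ D) x by rewrite patchE; case: ifP.
apply/eqP; rewrite eq_le; apply/andP; split; rewrite !ge0_integralTE//; last first.
  apply: ereal_sup_le => _ [h hf <-].
  exists h => // x; apply: le_trans (hf x) _.
  by rewrite patchE; case: ifP.
apply: ge_ereal_sup => _ [h hf <-]; apply: ereal_sup_ubound.
exists (proj_nnsfun h mD) => [x|].
  rewrite /= patchE mindicE; case: (x \in D) => /=; last by rewrite mulr0.
  by rewrite mulr1; exact: hf.
rewrite -!integralT_nnsfun.
transitivity (\int[mu]_(x in D) (h x)%:E).
  rewrite [RHS]integral_mkcond; apply: eq_integral => x _.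
  by rewrite /= patchE mindicE; case: (x \in D); rewrite /= ?mulr1 ?mulr0.
rewrite (@ge0_negligible_integral _ _ _ mu setT (~` D)) ?setTD ?setCK//.
- exact: measurableC.
- exact/measurable_EFinP.
- by move=> x _; rewrite lee_fin.
Qed.

(** Stated for arbitrary [f], as rates and rewards are not assumed measurable at inadmissible
    actions. The integral of a nonnegative function is a supremum over simple functions, and
    restricting a simple function to [D] leaves its integral unchanged. *)
Lemma integral_concentrated (f : T -> \bar R) : \int[mu]_x f x = \int[mu]_(x in D) f x.
Proof.
rewrite [RHS]integral_mkcond [LHS]integralE [RHS]integralE.
rewrite !unlock.
congr (_ - _).
  rewrite ge0_integral_concentrated; last by move=> x; rewrite le_max lexx orbT.
  by apply: eq_integral => x _; rewrite /= !patchE; case: ifP; rewrite ?maxxx.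
rewrite ge0_integral_concentrated; last by move=> x; rewrite le_max lexx orbT.
by apply: eq_integral => x _; rewrite /= !patchE; case: ifP; rewrite ?oppe0 ?maxxx.
Qed.

End concentrated.

Section rescaled_kernel.
Context d d' (X : measurableType d) (Y : measurableType d') {R : realType}.
Variable k : X -> {measure set Y -> \bar R}.
Hypotheses (mk : forall U, measurable U -> measurable_fun setT (k ^~ U))
  (kfin : forall x, k x setT < +oo).

(** Division by one plus the total mass bounds the masses uniformly and is possible also at mass
    zero. *)
Let scale x : {nonneg R} := NngNum (ltW (ltr_wpDr (fine_ge0 (measure_ge0 (k x) setT)) ltr01) :
  (0 <= 1 + fine (k x setT))%R).
Let iscale x : {nonneg R} := (((scale x)%:num^-1)%:nng)%R.
Let rk x : {measure set Y -> \bar R} := mscale (iscale x) (k x).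

Let mscl : measurable_fun setT (fun x => (scale x)%:num).
Proof.
apply: measurable_funD; first exact: measurable_cst.
by apply: measurableT_comp; [exact: fine_measurable|exact: mk].
Qed.

Let measurable_rk U : measurable U -> measurable_fun setT (rk ^~ U).
Proof.
move=> mU; apply: emeasurable_funM; last exact: mk.
apply/measurable_EFinP.
rewrite (_ : (fun x => _) = fun x => expR (- ln (scale x)%:num)).
  by apply: measurableT_comp => //; apply: measurableT_comp => //; apply: (measurableT_comp (@measurable_ln R)).
by apply/funext => x; rewrite expRN lnK// posrE /= ltr_wpDr.
Qed.

HB.instance Definition _ := isKernel.Build _ _ X Y R rk measurable_rk.

Let rk_uub : measure_fam_uub rk.
Proof.
exists 2%R => x; rewrite /rk /= /mscale /=.
have kf : k x setT \is a fin_num by rewrite ge0_fin_numE.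
rewrite -[X in _ * X](fineK kf) -EFinM lte_fin.
have f0 : (0 <= fine (k x setT))%R by exact: fine_ge0.
rewrite mulrC ltr_pdivrMr; last by rewrite ltr_wpDr.
by move: (fine _) f0 => z z0; lra.
Qed.

HB.instance Definition _ := Kernel_isFinite.Build _ _ X Y R rk rk_uub.

Lemma measurable_integral_transition (F : X * Y -> \bar R) :
  measurable_fun setT F -> (forall p, 0 <= F p) ->
  measurable_fun setT (fun x => \int[k x]_y F (x, y)).
Proof.
move=> mF F0.
have mr : measurable_fun setT (fun x => \int[rk x]_y F (x, y)).
  exact: (@measurable_fun_integral_finite_kernel _ _ X Y R F rk F0 mF).
rewrite (_ : (fun x => _) = (fun x => ((scale x)%:num)%:E * \int[rk x]_y F (x, y))).
  by apply: emeasurable_funM => //; exact/measurable_EFinP.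
apply/funext => x; rewrite /rk ge0_integral_mscale//; last first.
  by apply: (measurableT_comp mF (g := fun y => (x, y))); mproj.
by rewrite muleA -EFinM divff ?mul1e//= gt_eqF// ltr_wpDr.
Qed.

End rescaled_kernel.

Section tonelli_finite.
Context d (Y : measurableType d) {R : realType} (m : {measure set Y -> \bar R}).
Hypothesis mfin : m setT < +oo.
Local Notation leb := (@lebesgue_measure R).

Let m' : set Y -> \bar R := m.
HB.instance Definition _ := Measure.on m'.
Let m'_fin : fin_num_fun m'.
Proof.
move=> U mU; rewrite ge0_fin_numE//; apply: le_lt_trans mfin.
by apply: le_measure; rewrite ?inE.
Qed.
HB.instance Definition _ := Measure_isFinite.Build _ Y R m' m'_fin.

Lemma tonelli_finite (D : set R) (F : R -> Y -> \bar R) : measurable D ->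
  measurable_fun setT (fun p : R * Y => F p.1 p.2) -> (forall v y, 0 <= F v y) ->
  \int[m]_y \int[leb]_(v in D) F v y = \int[leb]_(v in D) \int[m]_y F v y.
Proof.
move=> mD mF F0.
pose G (p : R * Y) := F p.1 p.2 * (\1_D p.1)%:E.
have G0 p : 0 <= G p by rewrite mule_ge0// lee_fin.
have mG : measurable_fun setT G.
  apply: emeasurable_funM => //; apply/measurable_EFinP.
  exact: (measurableT_comp (measurable_indic mD) measurable_fst).
have := @fubini_tonelli _ _ _ _ R leb m' G mG G0; rewrite /fubini_F /fubini_G /= => h.
transitivity (\int[m']_y \int[leb]_v G (v, y)).
  apply: eq_integral => y _; rewrite [LHS]integral_mkcond; apply: eq_integral => v _.
  by rewrite patchE /G /= indicE; case: (v \in D); rewrite ?mule1 ?mule0.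
rewrite -h [RHS]integral_mkcond; apply: eq_integral => v _.
rewrite patchE; case: ifPn => vD.
  by apply: eq_integral => y _; rewrite /G /= indicE vD mule1.
by apply: integral0_eq => y _; rewrite /G /= indicE (negbTE vD) mule0.
Qed.

End tonelli_finite.

(** * Controlled jump process *)

Local Open Scope ereal_scope.

Section transition_rates.
Context {R : realType} {S A : completePseudoMetricType R}.
Variables (Aset : S -> set A) (qm : S -> A -> {measure set (borel S) -> \bar R}) (r : S -> A -> R).
Local Notation SB := (borel S).
Local Notation AB := (borel A).
Hypothesis ok : model_ok Aset qm r.

Let pS : polish S. Proof. by case: ok. Qed.
Let pA : polish A. Proof. by case: ok => _ []. Qed.

Lemma measurable_singleton (T : completePseudoMetricType R) : polish T ->
  forall x : T, measurable ([set x] : set (borel T)).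
Proof.
move=> pT x; rewrite -(setCK [set x]); apply: measurableC; apply: sub_sigma_algebra.
by apply: closed_openC; apply: accessible_closed_set1; exact: hausdorff_accessible pT.1.
Qed.

Lemma measurable_graph : measurable (K Aset). Proof. by case: ok => _ [_ [_ []]]. Qed.

Definition offdiag (x : SB) : set SB := ~` [set x].

Lemma measurable_offdiag x : measurable (offdiag x).
Proof. by apply: measurableC; exact: measurable_singleton. Qed.

Lemma rate_lty x a : Aset x a -> qm x a (offdiag x) < +oo.
Proof. by case: ok => _ [_ [_ [_ [h _]]]]; exact: h. Qed.

Lemma measurable_q (D : set SB) : measurable D ->
  measurable_fun (K Aset) (fun xa : SB * AB => q qm xa.1 xa.2 D).
Proof. by case: ok => _ [_ [_ [_ [_ [h _]]]]]; exact: h. Qed.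

(* [- q({x}|x,a)] is the supremum of [- q(B|x,a)] over the basic open neighbourhoods B of x. *)
Lemma measurable_rate :
  measurable_fun (K Aset) (fun xa : SB * AB => qm xa.1 xa.2 (offdiag xa.1)).
Proof.
have [d dd] := polish_dense_seq pS.
have oB i : measurable (base d i : set SB) by apply: sub_sigma_algebra; exact: open_base.
pose g n (xa : SB * AB) : \bar R := if `[< base d n xa.1 >] then - q qm xa.1 xa.2 (base d n) else 0.
have mg n : measurable_fun (K Aset) (g n).
  apply: measurable_fun_if.
  - exact: measurable_graph.
  - apply: measurable_funTS; apply: (measurable_fun_bool true).
    rewrite (_ : _ @^-1` _ = [set xa : SB * AB | base d n xa.1]); first by have := @measurable_fst _ _ SB AB measurableT _ (oB n); rewrite setTI.
    by apply/seteqP; split=> xa /= /asboolP.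
  - apply: (measurable_funS measurable_graph); first exact: subIsetl.
    by apply: measurableT_comp => //; exact: measurable_q.
  - exact: measurable_cst.
have gE n x a : Aset x a -> base d n x -> g n (x, a) = qm x a (~` base d n).
  move=> xa nx.
  have f : qm x a (offdiag x) \is a fin_num by rewrite ge0_fin_numE//; exact: rate_lty.
  rewrite /g /q !asboolT//= -/(offdiag x) oppeB; last first.
    by apply: fin_num_adde_defl; rewrite fin_numN.
  have e : offdiag x = (base d n `&` offdiag x) `|` ~` base d n.
    apply/seteqP; split=> [y yx|y [[]//|ny yx]]; last by apply: ny; rewrite yx.
    by have [?|?] := pselect (base d n y); [left|right].
  rewrite [X in _ + X](_ : _ = qm x a (base d n `&` offdiag x) + qm x a (~` base d n)).
    rewrite addeA [X in X + _]addeC subee ?add0e//.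
    rewrite ge0_fin_numE//; apply: le_lt_trans (rate_lty xa).
    by apply: le_measure; rewrite ?inE//; [apply: measurableI => //|]; exact: measurable_offdiag.
  rewrite -measureU//; [by rewrite -e| |exact: measurableC|].
    by apply: measurableI => //; exact: measurable_offdiag.
  by apply/seteqP; split=> y // [[]].
apply: (eq_measurable_fun (fun xa => esups (g ^~ xa) 0%N)); last exact: measurable_fun_esups.
move=> [x a]; rewrite inE => /= xa; rewrite /esups /=.
have gle n : g n (x, a) <= qm x a (offdiag x).
  have [nx|nx] := pselect (base d n x); last by rewrite /g asboolF.
  rewrite gE//; apply: le_measure; rewrite ?inE; [exact: measurableC|exact: measurable_offdiag|].
  by move=> y ny yx; apply: ny; rewrite yx.
apply/eqP; rewrite eq_le; apply/andP; split.
  by apply: ge_ereal_sup => _ [n _ <-]; exact: gle.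
(* These sets increase to the complement of [x], so their measures converge to the full jump rate,
   while each is contained in the complement of a small basic set around [x]. *)
pose E m : set SB := ~` (interior (ball x (2 / m.+1%:R : R)) : set S).
have mE m : measurable (E m).
  by apply: measurableC; apply: sub_sigma_algebra; exact: open_interior.
have EU : \bigcup_m E m = offdiag x.
  apply/seteqP; split=> [y [m _ Em] yx|y yx].
    by apply: Em; rewrite yx; apply: nbhsx_ballx; rewrite divr_gt0.
  have /eqP/(hausdorffP pS.1)[U [V [yU xV _ _ UV]]] : y <> x by [].
  have [e /= e0 eV] := (nbhs_ballP x V).1 xV.
  have [m _ /(_ m (leqnn m)) /= me] := near_infty_natSinv_lt (PosNum (divr_gt0 e0 (ltr0Sn _ 1))).
  exists m => // /interior_subset xy.
  apply: (UV y); split; first exact: nbhs_singleton yU.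
  apply: eV; apply: le_ball xy.
  by rewrite mulrC -ler_pdivlMr// ltW.
have ndE : nondecreasing_seq E.
  move=> m n mn; apply/subsetPset; apply: subsetC; apply: interiorS; apply: le_ball.
  by rewrite ler_pM2l// lef_pV2 ?posrE// ler_nat.
have := nondecreasing_cvg_mu (mu := qm x a) mE _ ndE.
rewrite EU => /(_ (measurable_offdiag x)) cE.
rewrite -(cvg_lim _ cE)//; apply: lime_le.
  by apply/cvg_ex; exists (qm x a (offdiag x)).
apply: nearW => m /=.
have [i im ix] := base_cover dd m x.
apply: (@le_trans _ _ (g i (x, a))); last by apply: ereal_sup_ubound; exists i.
rewrite gE//; apply: le_measure; rewrite ?inE//; first exact: measurableC.
apply: subsetC; rewrite -[X in X `<=` _](interior_id _).1; last exact: open_base.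
by apply: interiorS => y iy; have := base_ball ix iy; rewrite im.
Qed.

Lemma measurable_jump_measure (D : set SB) : measurable D ->
  measurable_fun (K Aset) (fun xa : SB * AB => qm xa.1 xa.2 (D `&` offdiag xa.1)).
Proof.
move=> mD.
apply: (eq_measurable_fun (fun xa : SB * AB =>
    q qm xa.1 xa.2 D + qm xa.1 xa.2 (offdiag xa.1) * (\1_D xa.1)%:E)).
  move=> [x a]; rewrite inE /= => xa.
  have f : qm x a (offdiag x) \is a fin_num by rewrite ge0_fin_numE//; exact: rate_lty.
  rewrite /q indicE; have [Dx|Dx] := pselect (D x).
    by rewrite asboolT// mem_set// mule1 subeK.
  by rewrite asboolF// memNset// mule0 adde0 sube0.
apply: emeasurable_funD; first exact: measurable_q.
apply: emeasurable_funM; first exact: measurable_rate.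
apply/measurable_EFinP; apply: measurable_funTS.
exact: (measurableT_comp (measurable_indic mD) measurable_fst).
Qed.

Let jumps (xa : SB * AB) : {measure set SB -> \bar R} := mrestr (qm xa.1 xa.2) (measurable_offdiag xa.1).
Let nojump : {measure set SB -> \bar R} := mzero.

(** Set to zero outside the graph, so that every pair carries a finite measure depending measurably
    on it. *)
Definition qk (xa : SB * AB) := if `[< K Aset xa >] then jumps xa else nojump.

Lemma measurable_qk (U : set SB) : measurable U -> measurable_fun setT (fun xa => qk xa U).
Proof.
move=> mU; rewrite (_ : (fun xa => _) =
    (fun xa : SB * AB => qm xa.1 xa.2 (U `&` offdiag xa.1)) \_ (K Aset)).
  apply: (measurable_restrictT _ (@measurable_graph)).1.
  exact: (measurable_jump_measure mU).
apply/funext => xa; rewrite patchE /qk; have [h|h] := pselect (K Aset xa).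
  by rewrite asboolT// mem_set.
by rewrite asboolF// memNset.
Qed.

Lemma qk_lty xa : qk xa setT < +oo.
Proof.
rewrite /qk; case: asboolP => [h|_]; last by rewrite /mzero ltry.
by rewrite /= /mrestr setTI; exact: rate_lty.
Qed.

Lemma integral_qk x a (h : SB -> \bar R) : Aset x a ->
  \int[qk (x, a)]_y h y = \int[qm x a]_(y in offdiag x) h y.
Proof.
move=> xa; rewrite /qk asboolT//=.
rewrite (integral_concentrated (measurable_offdiag x)); last first.
  by rewrite /= /mrestr setICl measure0.
apply: eq_measure_integral => E mE Ex; rewrite /= /mrestr.
by congr (qm x a _); apply/setIidl.
Qed.

Lemma qk_setT x a : Aset x a -> qk (x, a) setT = qm x a (offdiag x).
Proof. by move=> xa; rewrite /qk asboolT//= /mrestr setTI. Qed.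

End transition_rates.

Local Open Scope ereal_scope.

Lemma fin_num_bounds {R : realType} (x : \bar R) (k : R) : 0 <= x -> x <= k%:E -> x \is a fin_num.
Proof. by move=> x0 xk; rewrite ge0_fin_numE//; exact: le_lt_trans xk (ltry _). Qed.

Lemma unshift_inequality {R : realType} (r l p1 p2 D J1 J2 al u gam : R) :
  (r + (p2 + D) + J2 + p1 * l <= J1 + (u + p1) * l + (al * u + gam + p2 + D) ->
   r + J2 + (l + al) * p1 <= J1 + ((l + al) * (u + p1) + gam))%R.
Proof.
rewrite !mulrDl !mulrDr [(u * l)%R]mulrC [(p1 * l)%R]mulrC.
move: (al * u)%R (al * p1)%R (l * u)%R (l * p1)%R => *; lra.
Qed.

(** * The process under an admissible policy *)

Section policy_process.
Context {R : realType} {S A : completePseudoMetricType R}.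
Variables (Aset : S -> set A) (qm : S -> A -> {measure set (borel S) -> \bar R}) (r : S -> A -> R).
Local Notation SB := (borel S).
Local Notation AB := (borel A).
Local Notation leb := (@lebesgue_measure R).
Hypothesis ok : model_ok Aset qm r.
Variables (w w' : S -> R) (c b Mq M c' b' M' : R).
Hypotheses (mw : measurable_fun [set: SB] (w : SB -> R)) (w1 : forall x, (1 <= w x)%R)
  (c0 : (0 < c)%R) (b0 : (0 <= b)%R)
  (Hw : forall x a, Aset x a -> qint qm w x a <= (- (c * w x) + b)%:E)
  (Hq : forall x, qx Aset qm x <= (Mq * w x)%:E)
  (M0 : (0 < M)%R) (Hr : forall x a, Aset x a -> (`|r x a| <= M * w x)%R)
  (mw' : measurable_fun [set: SB] (w' : SB -> R)) (w'0 : forall x, (0 <= w' x)%R)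
  (c'0 : (0 < c')%R) (b'0 : (0 <= b')%R) (M'0 : (0 < M')%R)
  (Hqw : forall x, qx Aset qm x * (w x)%:E <= (M' * w' x)%:E)
  (Hw' : forall x a, Aset x a -> qint qm w' x a <= (c' * w' x + b')%:E).
Variable pi : policy S A.
Hypothesis api : admissible Aset pi.
Local Notation jk := (qk ok).

Let w0 x : (0 <= w x)%R. Proof. exact: le_trans ler01 (w1 x). Qed.
Let mA x : measurable (Aset x : set AB). Proof. by case: ok => _ [_ []]. Qed.

Lemma policy_section t x : (0 <= t)%R -> pi t x (Aset x) = 1.
Proof. by case: api => -[h _] _; exact: h. Qed.

Lemma prob_null (P : probability AB R) (B : set AB) : measurable B -> P B = 1 -> P (~` B) = 0.
Proof. by move=> mB PB; rewrite probability_setC// PB subee. Qed.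

Lemma admissible_nonempty x : exists a, Aset x a.
Proof.
apply: contrapT => /forallNP h.
have : Aset x = set0 by apply/seteqP; split=> a // /h.
have := policy_section x (lexx 0%R) => /[swap] ->.
by rewrite measure0 => /eqP; rewrite lt_eqF// lte01.
Qed.

Lemma rate_le_qx x a : Aset x a -> qm x a (offdiag x) <= qx Aset qm x.
Proof. by move=> xa; apply: ereal_sup_ubound; exists a. Qed.

Lemma qx_ge0 x : 0 <= qx Aset qm x.
Proof. by have [a xa] := admissible_nonempty x; apply: le_trans (rate_le_qx xa). Qed.

Lemma qx_fin x : qx Aset qm x \is a fin_num.
Proof. exact: fin_num_bounds (qx_ge0 x) (Hq x). Qed.

Lemma policy_continuous x (h : AB -> R) : measurable_fun setT h ->
  (exists C : R, forall a, (`|h a| <= C)%R) ->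
  forall t, (0 <= t)%R -> forall U, nbhs (\int[pi t x]_a (h a)%:E) U ->
  exists2 W, nbhs t W & forall s, W s -> (0 <= s)%R -> U (\int[pi s x]_a (h a)%:E).
Proof.
move=> mh hC t t0 U tU; case: api => _ /(_ x h mh hC) cpi.
have nt : nonneg_times t by rewrite /nonneg_times /= in_itv /= t0.
have [W tW WU] := within_continuous_near cpi nt tU.
by exists W => // s Ws s0; apply: WU => //; rewrite /nonneg_times /= in_itv /= s0.
Qed.

(** Continuity in time upgrades measurability in [x] at each time to joint measurability: the time
    [|u|] is rounded down to multiples of 1/(n+1). *)
Lemma measurable_policy (B : set AB) : measurable B ->
  measurable_fun setT (fun p : R * SB => pi `|p.1|%R p.2 B).
Proof.
move=> mB.
pose tr n (u : R) : R := ((Num.truncn (n.+1%:R * `|u|))%:R / n.+1%:R)%R.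
have tr0 n u : (0 <= tr n u)%R by rewrite divr_ge0.
have n0 n : (0 < n.+1%:R :> R)%R by [].
apply: (@emeasurable_fun_cvg _ _ _ _ (fun n (p : R * SB) => pi (tr n p.1) p.2 B)).
  move=> n.
  pose E k : set (R * SB) := [set p | (k%:R <= n.+1%:R * `|p.1| < k.+1%:R)%R].
  have mabs : measurable_fun setT (fun p : R * SB => n.+1%:R * `|p.1|)%R.
    apply: measurable_funM; first exact: measurable_cst.
    by apply: measurableT_comp => //; exact: measurable_fst.
  have mE k : measurable (E k).
    rewrite (_ : E k = (fun p : R * SB => n.+1%:R * `|p.1|)%R @^-1` `[k%:R, k.+1%:R[%classic).
      by rewrite -[X in measurable X]setTI; exact: mabs.
    by apply/seteqP; split=> p /=; rewrite in_itv.
  have EU : \bigcup_k E k = setT.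
    apply/seteqP; split=> // p _; exists (Num.truncn (n.+1%:R * `|p.1|)%R) => //.
    by rewrite /E /=; apply: truncn_itv; rewrite mulr_ge0.
  rewrite -EU; apply/measurable_fun_bigcup => // k.
  suff h : measurable_fun (E k) (fun p : R * SB => pi (k%:R / n.+1%:R)%R p.2 B).
    apply: eq_measurable_fun h => p; rewrite inE => Ep; rewrite /tr (_ : Num.truncn _ = k)//.
    by apply/truncn_def.
  apply: measurable_funTS.
  have mpi : measurable_fun setT (fun x : SB => pi (k%:R / n.+1%:R)%R x B).
    by case: api => -[_ [h _]] _; apply: h => //; rewrite divr_ge0.
  exact: (measurableT_comp mpi measurable_snd).
move=> [u x] _ /=.
have iB t : pi t x B = \int[pi t x]_a (\1_B a)%:E by rewrite integral_indic// setIT.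
under eq_fun do rewrite iB.
rewrite iB => U tU.
have [||W tW WU] := policy_continuous (x := x) (h := \1_B) _ _ (normr_ge0 u) tU.
- exact: measurable_indic.
- by exists 1%R => a; rewrite indicE; case: (_ \in _); rewrite ?normr1 ?normr0.
have ctr : tr n u @[n --> \oo] --> `|u|%R.
  apply/cvgrPdist_le => e e0.
  have [m _ me] := near_infty_natSinv_lt (PosNum e0); exists m => // n /= mn.
  apply: le_trans (ltW (me n mn)) => /=.
  have /andP[h1 h2] : (((Num.truncn (n.+1%:R * `|u|))%:R : R) <= n.+1%:R * `|u| < (Num.truncn (n.+1%:R * `|u|)).+1%:R)%R.
    by apply: truncn_itv; rewrite mulr_ge0.
  rewrite ger0_norm; last by rewrite subr_ge0 /tr ler_pdivrMr// [X in (_ <= X)%R]mulrC.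
  rewrite lerBlDr /tr -[X in (_ <= X + _)%R]mul1r -mulrDl ler_pdivlMr// [X in (X <= _)%R]mulrC.
  by rewrite addrC natr1; exact: ltW.
have [m _ mW] := ctr _ tW.
by exists m => // n /= mn; apply: WU; [exact: mW|exact: tr0].
Qed.

(* Policies are extended to negative times by [|u|]. *)
Definition Jp (u : R) (x : SB) (h : SB -> \bar R) : \bar R :=
  \int[pi `|u|%R x]_a \int[jk (x, a)]_y h y.

Lemma measurable_inner d (X : measurableType d) (xi : X -> SB) (F : X -> SB -> \bar R) :
  measurable_fun setT xi -> measurable_fun setT (fun p : X * SB => F p.1 p.2) ->
  (forall p y, 0 <= F p y) ->
  measurable_fun setT (fun p : X * AB => \int[jk (xi p.1, p.2)]_y F p.1 y).
Proof.
move=> mxi mF F0.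
have mk U : measurable U -> measurable_fun setT (fun p : X * AB => jk (xi p.1, p.2) U).
  move=> mU; apply: (measurableT_comp (measurable_qk ok mU) (g := fun p : X * AB => (xi p.1, p.2))).
  by apply: measurable_fun_pair; [exact: (measurableT_comp mxi measurable_fst)|exact: measurable_snd].
have := @measurable_integral_transition _ _ _ SB R (fun p : X * AB => jk (xi p.1, p.2)) mk
  (fun p => qk_lty ok _) (fun z => F z.1.1 z.2).
apply; last by move=> z; exact: F0.
by apply: (measurableT_comp mF (g := fun z : (X * AB) * SB => (z.1.1, z.2))); mproj.
Qed.

Lemma measurable_inner_section x (h : SB -> \bar R) : measurable_fun setT h -> (forall y, 0 <= h y) ->
  measurable_fun setT (fun a : AB => \int[jk (x, a)]_y h y).
Proof.
move=> mh h0.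
have := @measurable_inner _ SB (fun=> x) (fun _ y => h y) (measurable_cst _) (measurableT_comp mh measurable_snd) (fun _ => h0).
by move=> hh; apply: (measurableT_comp hh (g := fun a : AB => (x, a))); mproj.
Qed.

Lemma measurable_outer d (X : measurableType d) (ui : X -> R) (xi : X -> SB) (F : X -> AB -> \bar R) :
  measurable_fun setT ui -> measurable_fun setT xi ->
  measurable_fun setT (fun p : X * AB => F p.1 p.2) -> (forall p a, 0 <= F p a) ->
  measurable_fun setT (fun p : X => \int[pi `|ui p|%R (xi p)]_a F p a).
Proof.
move=> mui mxi mF F0.
have mk U : measurable U -> measurable_fun setT (fun p : X => pi `|ui p|%R (xi p) U).
  move=> mU; apply: (measurableT_comp (measurable_policy mU) (g := fun p : X => (ui p, xi p))).
  exact: measurable_fun_pair.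
have pf p : pi `|ui p|%R (xi p) setT < +oo by rewrite probability_setT ltry.
exact: (@measurable_integral_transition _ _ X AB R (fun p : X => pi `|ui p|%R (xi p)) mk pf (fun z => F z.1 z.2) mF (fun z => F0 _ _)).
Qed.

Lemma jump_operator_policy : jump_operator Jp.
Proof.
have i0 x a (h : SB -> \bar R) : (forall y, 0 <= h y) -> 0 <= \int[jk (x, a)]_y h y.
  by move=> h0; apply: integral_ge0.
split.
- by move=> u x h h0; apply: integral_ge0 => a _; exact: i0.
- move=> u x h1 h2 mh1 mh2 h10 h20; rewrite /Jp -ge0_integralD; last 5 first.
  + exact: measurableT.
  + by move=> a _; exact: i0.
  + exact: measurable_inner_section.
  + by move=> a _; exact: i0.
  + exact: measurable_inner_section.
  by apply: eq_integral => a _; rewrite ge0_integralD.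
- move=> u x k h mh h0 k0; rewrite /Jp -ge0_integralZl_EFin; last 4 first.
  + exact: measurableT.
  + by move=> a _; exact: i0.
  + exact: measurable_inner_section.
  + exact: k0.
  by apply: eq_integral => a _; rewrite ge0_integralZl_EFin.
- move=> u x h1 h2 mh1 mh2 h10 h12; apply: ge0_le_integral => //.
  + by move=> a _; exact: i0.
  + exact: measurable_inner_section.
  + by apply: measurable_inner_section => // y; exact: le_trans (h12 y).
  by move=> a _; apply: ge0_le_integral.
- move=> u x F D mD mF F0; rewrite /Jp.
  transitivity (\int[pi `|u|%R x]_a \int[leb]_(v in D) \int[jk (x, a)]_y F v y).
    by apply: eq_integral => a _; apply: (tonelli_finite (qk_lty ok (x, a)) mD mF F0).
  have pfin : pi `|u|%R x setT < +oo by rewrite probability_setT ltry.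
  apply: (tonelli_finite pfin mD (F := fun v a => \int[jk (x, a)]_y F v y)).
    exact: (@measurable_inner _ R (fun=> x) F (measurable_cst _) mF F0).
  by move=> v a; exact: i0.
- move=> F mF F0.
  apply: (@measurable_outer _ ((R * R) * SB)%type (fun p => p.1.2) (fun p => p.2)
    (fun p a => \int[jk (p.2, a)]_y F p.1.1 p.1.2 y)); [by mproj|by mproj| |].
    apply: (@measurable_inner _ ((R * R) * SB)%type (fun p => p.2) (fun p y => F p.1.1 p.1.2 y)).
    - by mproj.
    - by apply: (measurableT_comp mF (g := fun z : ((R * R) * SB) * SB => (z.1.1, z.2))); mproj.
    - by move=> p y; exact: F0.
  by move=> p a; exact: i0.
Qed.

Lemma le_integral_policy t x (B : set AB) (f1 f2 : AB -> \bar R) : measurable B -> pi t x B = 1 ->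
  measurable_fun setT f1 -> measurable_fun setT f2 -> (forall a, 0 <= f1 a) ->
  (forall a, B a -> f1 a <= f2 a) -> \int[pi t x]_a f1 a <= \int[pi t x]_a f2 a.
Proof.
move=> mB PB mf1 mf2 f10 f12; have nB := prob_null mB PB.
rewrite (integral_concentrated mB nB f1) (integral_concentrated mB nB f2).
by apply: ge0_le_integral => //; exact: measurable_funTS.
Qed.

Lemma integral_policy_cst t x (k : R) : \int[pi t x]_a (cst k%:E a) = k%:E.
Proof.
rewrite integral_cst; last exact: measurableT.
by rewrite -[RHS]mule1; congr (_ * _); exact: probability_setT.
Qed.

Lemma lamE t x : (0 <= t)%R -> lam qm pi t x = \int[pi t x]_a jk (x, a) setT.
Proof.
move=> t0; have nB := prob_null (mA x) (policy_section x t0).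
rewrite /lam (integral_concentrated (mA x) nB) [RHS](integral_concentrated (mA x) nB).
by apply: eq_integral => a; rewrite inE => xa; rewrite qk_setT.
Qed.

Let mqkT x : measurable_fun setT (fun a : AB => jk (x, a) setT).
Proof. by apply: (measurableT_comp (measurable_qk ok measurableT) (g := fun a => (x, a))); mproj. Qed.

Lemma lam_le_qx t x : (0 <= t)%R -> lam qm pi t x <= qx Aset qm x.
Proof.
move=> t0; rewrite (lamE x t0) -(fineK (qx_fin x)) -(integral_policy_cst t x).
apply: (le_integral_policy (mA x) (policy_section x t0)) => // a xa.
by rewrite qk_setT// fineK ?qx_fin//; exact: rate_le_qx.
Qed.

Definition lp (u : R) (x : SB) : R := fine (lam qm pi `|u|%R x).

Lemma lpE u x : (lp u x)%:E = lam qm pi `|u|%R x.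
Proof.
rewrite /lp fineK//; apply: fin_num_bounds (le_trans (lam_le_qx x (normr_ge0 u)) (Hq x)).
by apply: integral_ge0.
Qed.

Lemma lp_ge0 u x : (0 <= lp u x)%R.
Proof. by apply: fine_ge0; exact: integral_ge0. Qed.

Lemma measurable_lp : measurable_fun setT (fun p : R * SB => lp p.1 p.2).
Proof.
apply: measurableT_comp; first exact: fine_measurable.
rewrite (_ : (fun p => _) = (fun p : R * SB => \int[pi `|p.1|%R p.2]_a jk (p.2, a) setT)); last first.
  by apply/funext => p; rewrite lamE.
apply: (@measurable_outer _ (R * SB)%type fst snd (fun p a => jk (p.2, a) setT)) => //.
by apply: (measurableT_comp (measurable_qk ok measurableT) (g := fun z : (R * SB) * AB => (z.1.2, z.2))); mproj.
Qed.

(** Admissibility applies because for fixed [x] the jump rate is a measurable function of the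
    action, bounded by q(x). *)
Lemma continuous_lp x u : {for u, continuous (lp ^~ x)}.
Proof.
have qb a : jk (x, a) setT <= (fine (qx Aset qm x))%:E.
  rewrite fineK ?qx_fin//; have [xa|xa] := pselect (Aset x a).
    by rewrite qk_setT//; exact: rate_le_qx.
  by rewrite /qk asboolF//=; exact: qx_ge0.
have qf a : jk (x, a) setT \is a fin_num by exact: fin_num_bounds (measure_ge0 _ _) (qb a).
pose h (a : AB) : R := fine (jk (x, a) setT).
have lamh t : (0 <= t)%R -> lam qm pi t x = \int[pi t x]_a (h a)%:E.
  by move=> t0; rewrite (lamE x t0); apply: eq_integral => a _; rewrite /h fineK.
have mh : measurable_fun setT h.
  by apply: measurableT_comp; [exact: fine_measurable|exact: mqkT].
have hb : exists C : R, forall a, (`|h a| <= C)%R.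
  exists (fine (qx Aset qm x)) => a; rewrite ger0_norm; last exact: fine_ge0.
  by rewrite -lee_fin /h fineK.
have cvgl : lam qm pi `|v|%R x @[v --> u] --> (lp u x)%:E.
  rewrite lpE => U; rewrite lamh// => uU.
  have [W uW WU] := policy_continuous mh hb (normr_ge0 u) uU.
  have h' : nbhs u (fun v => W `|v|%R) by exact: (@norm_continuous _ R u _ uW).
  by apply: (filterS _ h') => v Wv; rewrite /= lamh//; exact: WU.
exact: (fine_cvg cvgl).
Qed.

Lemma Jp_one u x : Jp u x (cst 1) = (lp u x)%:E.
Proof.
rewrite lpE lamE// /Jp; apply: eq_integral => a _.
by rewrite integral_cst// mul1e.
Qed.

Lemma lp_w u x : (lp u x * w x <= M' * w' x)%R.
Proof.
rewrite -lee_fin EFinM; apply: le_trans (Hqw x); apply: lee_wpmul2r; first by rewrite lee_fin.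
by rewrite lpE; exact: lam_le_qx.
Qed.

Lemma integral_lp_scale u x (k : R) : (0 <= k)%R ->
  \int[pi `|u|%R x]_a (k%:E * jk (x, a) setT) = (k * lp u x)%:E.
Proof.
move=> k0; have mq := mqkT x.
rewrite ge0_integralZl_EFin//.
by rewrite -(lamE x (normr_ge0 u)) -lpE.
Qed.

Lemma Jp_drift (V : SB -> R) (k : R) u x : measurable_fun setT V -> (forall y, (0 <= V y)%R) ->
  (forall a, Aset x a -> qint qm V x a <= k%:E) ->
  Jp u x (fun y => (V y)%:E) <= (lp u x * V x + k)%:E.
Proof.
move=> mV V0 h.
(* The constant is split into its positive and negative parts to keep both integrands
   nonnegative. *)
pose kp := Num.max k 0%R; pose kn := Num.max (- k)%R 0%R.
have kE : (kp - kn = k)%R.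
  by rewrite /kp /kn; case: (leP k 0%R) => hr; [rewrite max_l ?oppr_ge0// sub0r opprK|rewrite max_r ?subr0// oppr_le0 ltW].
have kp0 : (0 <= kp)%R by rewrite le_max lexx orbT.
have kn0 : (0 <= kn)%R by rewrite le_max lexx orbT.
have mI := @measurable_inner_section x (fun y => (V y)%:E) ((measurable_EFinP _ _).2 mV) V0.
have I0 a : 0 <= \int[jk (x, a)]_y (V y)%:E by apply: integral_ge0 => y _; rewrite lee_fin.
have mq := mqkT x.
have : \int[pi `|u|%R x]_a (\int[jk (x, a)]_y (V y)%:E + (cst kn%:E a)) <=
    \int[pi `|u|%R x]_a ((V x)%:E * jk (x, a) setT + (cst kp%:E a)).
  apply: (le_integral_policy (mA x) (policy_section x (normr_ge0 u))).
  - by apply: emeasurable_funD.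
  - by apply: emeasurable_funD => //; exact: measurable_funeM.
  - by move=> a; rewrite adde_ge0.
  move=> a xa; have := h a xa; rewrite /qint integral_qk// qk_setT// -/(offdiag x).
  have f : qm x a (offdiag x) \is a fin_num by rewrite ge0_fin_numE//; exact: (rate_lty ok).
  rewrite -(fineK f) -EFinM -kE.
  case: (\int[qm x a]_(y in offdiag x) (V y)%:E) => [z||]; [|by []|by move=> _; exact: leNye].
  by rewrite -!EFinD !lee_fin => *; lra.
have -> : \int[pi `|u|%R x]_a (\int[jk (x, a)]_y (V y)%:E + (cst kn%:E a)) =
    Jp u x (fun y => (V y)%:E) + kn%:E.
  by rewrite ge0_integralD// integral_policy_cst.
have mVq : measurable_fun setT (fun a : AB => (V x)%:E * jk (x, a) setT) by exact: measurable_funeM.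
have Vq0 a : 0 <= (V x)%:E * jk (x, a) setT by rewrite mule_ge0// lee_fin.
have -> : \int[pi `|u|%R x]_a ((V x)%:E * jk (x, a) setT + (cst kp%:E a)) = (V x * lp u x)%:E + kp%:E.
  by rewrite ge0_integralD// integral_policy_cst integral_lp_scale.
rewrite -kE.
case: (Jp u x _) => [z||]; [|by []|by move=> _; exact: leNye].
by rewrite -!EFinD !lee_fin => *; lra.
Qed.

Lemma Jp_w u x : Jp u x (fun y => (w y)%:E) <= (lp u x * w x - c * w x + b)%:E.
Proof. by rewrite -addrA; apply: Jp_drift => // a; exact: Hw. Qed.

Lemma Jp_w' u x : Jp u x (fun y => (w' y)%:E) <= (lp u x * w' x + c' * w' x + b')%:E.
Proof. by rewrite -addrA; apply: Jp_drift => // a; exact: Hw'. Qed.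

(** Vanishing outside the graph, it is measurable and bounded by M w everywhere. *)
Definition rK : SB * AB -> R := (fun xa : SB * AB => r xa.1 xa.2) \_ (K Aset).

Lemma measurable_rK : measurable_fun setT rK.
Proof.
apply: (measurable_restrictT _ (@measurable_graph _ _ _ _ _ _ ok)).1.
by case: ok => _ [_ [_ [_ [_ [_ []]]]]].
Qed.

Lemma rKE x a : Aset x a -> rK (x, a) = r x a.
Proof. by move=> xa; rewrite /rK patchE mem_set. Qed.

Lemma rK_bound x a : (`|rK (x, a)| <= M * w x)%R.
Proof.
rewrite /rK patchE; case: ifPn => [/set_mem xa|_]; first exact: Hr.
by rewrite /point /= normr0 mulr_ge0// ltW.
Qed.

Let mrK x : measurable_fun setT (fun a : AB => rK (x, a)).
Proof. by apply: (measurableT_comp measurable_rK (g := fun a => (x, a))); mproj. Qed.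

Let integrable_rK t x : (pi t x).-integrable setT (fun a => (rK (x, a))%:E).
Proof.
apply: (@le_integrable _ _ _ _ _ measurableT _ (cst (M * w x)%:E)).
- exact/measurable_EFinP.
- by move=> a _ /=; rewrite lee_fin; apply: le_trans (rK_bound x a) _; exact: ler_norm.
- exact: (@finite_measure_integrable_cst _ AB R (pi t x) setT (M * w x)%R measurableT).
Qed.

Definition rho (u : R) (x : SB) : R := fine (rpi r pi `|u|%R x).

Lemma rpiE t x : (0 <= t)%R -> rpi r pi t x = \int[pi t x]_a (rK (x, a))%:E.
Proof.
move=> t0; have nB := prob_null (mA x) (policy_section x t0).
rewrite /rpi (integral_concentrated (mA x) nB) [RHS](integral_concentrated (mA x) nB).
by apply: eq_integral => a; rewrite inE => xa; rewrite rKE.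
Qed.

Lemma rhoE u x : (rho u x)%:E = rpi r pi `|u|%R x.
Proof. by rewrite /rho fineK// rpiE//; exact: (integrable_fin_num measurableT (integrable_rK _ _)). Qed.

Lemma integral_rK_shift u x (D : R) :
  \int[pi `|u|%R x]_a (rK (x, a) + D)%:E = (rho u x + D)%:E.
Proof.
under eq_integral do rewrite EFinD.
have ic := @finite_measure_integrable_cst _ AB R (pi `|u|%R x) setT D measurableT.
rewrite (integralD measurableT (integrable_rK _ _) ic).
by rewrite EFinD rhoE rpiE// integral_policy_cst.
Qed.

Let shift_ge0 x a : (0 <= rK (x, a) + M * w x)%R.
Proof. by rewrite -lerBlDr sub0r; have := rK_bound x a; rewrite ler_norml => /andP[]. Qed.

Lemma rho_bound u x : (`|rho u x| <= M * w x)%R.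
Proof.
rewrite ler_norml; apply/andP; split.
  rewrite -subr_ge0 opprK -lee_fin -integral_rK_shift.
  by apply: integral_ge0 => a _; rewrite lee_fin; exact: shift_ge0.
rewrite -(lerD2r (M * w x)%R) -lee_fin -integral_rK_shift -(integral_policy_cst `|u|%R x).
apply: (le_integral_policy measurableT (probability_setT _)).
- by apply/measurable_EFinP; exact: measurable_funD.
- exact: measurable_cst.
- by move=> a; rewrite lee_fin; exact: shift_ge0.
- by move=> a _; rewrite lee_fin lerD2r; apply: le_trans (rK_bound x a); exact: ler_norm.
Qed.

Lemma measurable_rho : measurable_fun setT (fun p : R * SB => rho p.1 p.2).
Proof.
pose I (p : R * SB) := \int[pi `|p.1|%R p.2]_a (rK (p.2, a) + M * w p.2)%:E.
have mI : measurable_fun setT I.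
  apply: (@measurable_outer _ (R * SB)%type fst snd (fun p a => (rK (p.2, a) + M * w p.2)%:E)) => //.
    apply/measurable_EFinP; apply: measurable_funD.
      by apply: (measurableT_comp measurable_rK (g := fun z : (R * SB) * AB => (z.1.2, z.2))); mproj.
    apply: measurable_funM => //.
    by apply: (measurableT_comp mw (g := fun z : (R * SB) * AB => z.1.2)); mproj.
  by move=> p a; rewrite lee_fin; exact: shift_ge0.
rewrite (_ : (fun p => _) = (fun p => fine (I p) - M * w p.2)%R).
  apply: measurable_funB; first by apply: measurableT_comp => //; exact: fine_measurable.
  by apply: measurable_funM => //; exact: (measurableT_comp mw measurable_snd).
by apply/funext => p; rewrite /I integral_rK_shift /= addrK.
Qed.

Lemma survE s u x : (0 <= s)%R -> surv qm pi s u x = (sv lp 0 0 s u x)%:E.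
Proof.
move=> s0; rewrite /surv /sv subr0 mul0r sub0r.
have -> : \int[leb]_(v in `[s, u]) lam qm pi v x = \int[leb]_(v in `[s, u]) (lp v x)%:E.
  apply: eq_integral => v; rewrite inE /= in_itv /= => /andP[sv' _].
  by rewrite lpE ger0_norm// (le_trans s0).
have f : \int[leb]_(v in `[s, u]) (lp v x)%:E \is a fin_num.
  apply: integrable_fin_num => //.
  apply: continuous_compact_integrable; first exact: segment_compact.
  by apply: continuous_subspaceT => v; exact: continuous_lp.
by rewrite -(fineK f).
Qed.

Lemma jumpE t x h : (0 <= t)%R -> jump qm pi t x h = Jp t x h.
Proof.
move=> t0; have nB := prob_null (mA x) (policy_section x t0).
rewrite /jump /Jp ger0_norm// (integral_concentrated (mA x) nB) [RHS](integral_concentrated (mA x) nB).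
by apply: eq_integral => a; rewrite inE => xa; rewrite integral_qk.
Qed.

(** Feller's terms of the model are the abstract terms without weights; from a nonnegative starting
    time on, the extension by [|u|] changes nothing. *)
Lemma PnE n t G s x : (0 <= s)%R -> Pn qm pi t G n s x = Q Jp lp 0 0 n t G s x.
Proof.
elim: n s x => [|n IH] s x s0 /=; first by rewrite survE.
apply: eq_integral => u; rewrite inE /= in_itv /= => /andP[su _].
have u0 := le_trans s0 su.
rewrite survE// jumpE//; congr (_ * Jp u x _).
by apply/funext => y; exact: IH.
Qed.

Lemma ErewE x t : (0 <= t)%R -> Erew qm r pi x t =
  Pt Jp lp 0 0 t (fun y => (Num.max (rho t y) 0)%:E) 0 x -
  Pt Jp lp 0 0 t (fun y => (Num.max (- rho t y) 0)%:E) 0 x.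
Proof.
move=> t0; rewrite /Erew /Pmin /Pt.
have rt y : rpi r pi t y = (rho t y)%:E by rewrite rhoE ger0_norm.
congr (_ - _); apply: eq_eseriesr => n _; rewrite PnE//; congr (Q _ _ _ _ _ _ _ _ _);
  by apply/funext => y; rewrite rt EFin_max.
Qed.

Lemma Pt_reward_le (G : SB -> R) x t : (0 <= t)%R -> measurable_fun setT G ->
  (forall y, (0 <= G y)%R) -> (forall y, (G y <= M * w y)%R) ->
  Pt Jp lp 0 0 t (fun y => (G y)%:E) 0 x <= (M * (w x + b / c))%:E.
Proof.
move=> t0 mG G0 GM; have JJ := jump_operator_policy.
have mEw : measurable_fun setT (fun y : SB => (w y)%:E) by exact/measurable_EFinP.
have le1 : Pt Jp lp 0 0 t (fun y => (G y)%:E) 0 x <= Pt Jp lp 0 0 t (fun y => M%:E * (w y)%:E) 0 x.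
  apply: (le_Pt JJ lp_ge0 measurable_lp).
  - exact/measurable_EFinP.
  - exact: measurable_funeM.
  - by move=> y; rewrite lee_fin.
  - by move=> y; rewrite -EFinM lee_fin.
apply: le_trans le1 _; rewrite (PtZ JJ lp_ge0 measurable_lp) ?lee_fin//; last exact: ltW.
rewrite EFinM; apply: lee_wpmul2l; first by rewrite lee_fin ltW.
exact: (@Pt_w_le _ SB R Jp lp JJ lp_ge0 measurable_lp continuous_lp w w' c b c' b' M'
  mw w1 mw' w'0 c0 b0 (ltW c'0) b'0 (ltW M'0) Jp_w Jp_w' lp_w Jp_one t x t0).
Qed.

Let rp t y := Num.max (rho t y) 0%R.
Let rm t y := Num.max (- rho t y)%R 0%R.

Let mrp : measurable_fun setT (fun p : R * SB => rp p.1 p.2).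
Proof. by apply: measurable_maxr; [exact: measurable_rho|exact: measurable_cst]. Qed.

Let mrm : measurable_fun setT (fun p : R * SB => rm p.1 p.2).
Proof. by apply: measurable_maxr; [exact: measurableT_comp measurable_rho|exact: measurable_cst]. Qed.

Let rp0 t y : (0 <= rp t y)%R. Proof. by rewrite le_max lexx orbT. Qed.
Let rm0 t y : (0 <= rm t y)%R. Proof. by rewrite le_max lexx orbT. Qed.

Let rpM t y : (rp t y <= M * w y)%R.
Proof. by rewrite ge_max mulr_ge0 ?(ltW M0)// andbT; apply: le_trans (rho_bound t y); exact: ler_norm. Qed.

Let rmM t y : (rm t y <= M * w y)%R.
Proof.
rewrite ge_max mulr_ge0 ?(ltW M0)// andbT; apply: le_trans (rho_bound t y).
by rewrite -normrN; exact: ler_norm.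
Qed.

Let Pt_rp x t : (0 <= t)%R -> Pt Jp lp 0 0 t (fun y => (rp t y)%:E) 0 x <= (M * (w x + b / c))%:E.
Proof.
move=> t0; apply: Pt_reward_le => //.
by apply: (measurableT_comp mrp (g := fun y => (t, y))); mproj.
Qed.

Let Pt_rm x t : (0 <= t)%R -> Pt Jp lp 0 0 t (fun y => (rm t y)%:E) 0 x <= (M * (w x + b / c))%:E.
Proof.
move=> t0; apply: Pt_reward_le => //.
by apply: (measurableT_comp mrm (g := fun y => (t, y))); mproj.
Qed.

(** The bound is uniform in time, which supplies the integrable majorant for discounted integrals
    over the half-line. *)
Lemma Erew_bound x t : (0 <= t)%R -> `|Erew qm r pi x t| <= (M * (w x + b / c))%:E.
Proof.
move=> t0; rewrite ErewE// -/(rp t) -/(rm t); have := Pt_rp x t0; have := Pt_rm x t0.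
have : 0 <= Pt Jp lp 0 0 t (fun y => (rp t y)%:E) 0 x.
  by apply: (Pt_ge0 _ jump_operator_policy) => y; rewrite lee_fin.
have : 0 <= Pt Jp lp 0 0 t (fun y => (rm t y)%:E) 0 x.
  by apply: (Pt_ge0 _ jump_operator_policy) => y; rewrite lee_fin.
case: (Pt _ _ _ _ _ _ _ _) => [z||]//; case: (Pt _ _ _ _ _ _ _ _) => [z'||]//.
rewrite -EFinB abse_EFin !lee_fin ler_norml.
by move: (M * _)%R => k *; apply/andP; split; lra.
Qed.

Lemma measurable_Erew x : measurable_fun (@nonneg_times R) (Erew qm r pi x).
Proof.
apply: (eq_measurable_fun (fun t => Pt Jp lp 0 0 t (fun y => (rp t y)%:E) 0 x -
  Pt Jp lp 0 0 t (fun y => (rm t y)%:E) 0 x)).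
  by move=> t; rewrite inE /nonneg_times /= in_itv /= andbT => t0; rewrite ErewE.
apply: emeasurable_funB.
  apply: (measurable_Pt jump_operator_policy lp_ge0 measurable_lp 0 0 (H := fun t y => (rp t y)%:E)).
    exact/measurable_EFinP.
  by move=> t y; rewrite lee_fin.
apply: (measurable_Pt jump_operator_policy lp_ge0 measurable_lp 0 0 (H := fun t y => (rm t y)%:E)).
  exact/measurable_EFinP.
by move=> t y; rewrite lee_fin.
Qed.

Lemma rpiN t x : (0 <= t)%R -> rpi (fun y a => - r y a)%R pi t x = - rpi r pi t x.
Proof.
move=> t0; have : rpi r pi t x \is a fin_num by rewrite -{1}(ger0_norm t0) -rhoE.
rewrite /rpi integralE => h; rewrite -integralE -integralN//.
by move: h; case: (\int[_]_(_ in _) _) => [z||]; case: (\int[_]_(_ in _) _) => [z'||].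
Qed.

(** Lets lower bounds for a stationary policy be derived as upper bounds for the reward [- r]. *)
Lemma ErewN x t : (0 <= t)%R -> Erew qm (fun y a => - r y a)%R pi x t = - Erew qm r pi x t.
Proof.
move=> t0.
have e1 : (fun y => maxe (rpi (fun y a => - r y a)%R pi t y) 0) = (fun y => maxe (- rpi r pi t y) 0).
  by apply/funext => y; rewrite rpiN.
have e2 : (fun y => maxe (- rpi (fun y a => - r y a)%R pi t y) 0) = (fun y => maxe (rpi r pi t y) 0).
  by apply/funext => y; rewrite rpiN// oppeK.
rewrite /Erew e1 e2; have := ErewE x t0; rewrite /Erew => h.
have := Erew_bound x t0; rewrite /Erew.
by case: (Pmin _ _ _ _ _ _) => [z||]; case: (Pmin _ _ _ _ _ _) => [z'||]//= _; rewrite opprB.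
Qed.

(** The set [B y] carries the policy: it is [Aset y] when the inequality holds for all actions, and
    the single action [f y] for a stationary policy. *)
Lemma policy_verification (alpha gam C : R) (u : S -> R) (B : S -> set A) t x :
  (0 <= alpha)%R -> (0 <= C)%R -> measurable_fun [set: SB] (u : SB -> R) ->
  (forall y, `|u y| <= C * w y)%R ->
  (forall y, measurable (B y : set AB)) -> (forall y, B y `<=` Aset y) ->
  (forall s y, (0 <= s)%R -> pi s y (B y) = 1) ->
  (forall y a, B y a -> (r y a)%:E + qint qm u y a <= (alpha * u y + gam)%:E) ->
  (0 <= t)%R ->
  \int[leb]_(v in `[0%R, t]) ((expR (- (alpha * v)))%:E * Erew qm r pi x v) <=
  (u x + C * expR (- (alpha * t)) * (w x + b / c))%:E +
    gam%:E * \int[leb]_(v in `[0%R, t]) (expR (- (alpha * v)))%:E.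
Proof.
move=> al0 C0 mu uC mB BA PB H t0.
have JJ := jump_operator_policy.
have := @verification _ SB R Jp lp JJ lp_ge0 measurable_lp continuous_lp w w' c b c' b' M'
  mw w1 mw' w'0 c0 b0 (ltW c'0) b'0 (ltW M'0) Jp_w Jp_w' lp_w Jp_one
  alpha gam M C rho u t x al0 (ltW M0) C0 t0 measurable_rho mu rho_bound uC.
have -> : \int[leb]_(v in `[0%R, t]) ((expR (- (alpha * v)))%:E * Erew qm r pi x v) =
  \int[leb]_(v in `[0%R, t]) ((expR (- (alpha * v)))%:E *
    (Pt Jp lp 0 0 v (fun y => (Num.max (rho v y) 0)%:E) 0 x -
     Pt Jp lp 0 0 v (fun y => (Num.max (- rho v y) 0)%:E) 0 x)).
  by apply: eq_integral => v; rewrite inE /= in_itv /= => /andP[v0 _]; rewrite ErewE.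
apply => v y.
have jf1 := @jump_weighted_fin _ SB R Jp lp JJ w c b mw w1 Jp_w v y C u mu C0 uC.
have z0 : (forall z : SB, `|cst 0%R z : R| <= C * w z)%R by move=> z; rewrite normr0 mulr_ge0.
have jf2 := @jump_weighted_fin _ SB R Jp lp JJ w c b mw w1 Jp_w v y C (cst 0%R) (measurable_cst _) C0 z0.
have uw z : (0 <= u z + C * w z)%R by rewrite -lerBlDr sub0r; have := uC z; rewrite ler_norml => /andP[].
have Cw z : (0 <= C * w z)%R by rewrite mulr_ge0.
have e2 : (fun z : SB => (cst 0%R z + C * w z)%:E) = (fun z => (C * w z)%:E).
  by apply/funext => z; rewrite add0r.
rewrite e2 in jf2.
(* M w + D is added to both sides, which makes the reward on the left and the constant [E] on the
   right nonnegative. *)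
pose D := `|alpha * u y + gam|%R.
have D0 : (0 <= D)%R by exact: normr_ge0.
have mCw : measurable_fun setT (fun z : SB => (C * w z)%:E).
  by apply/measurable_EFinP; exact: measurable_funM.
have muw : measurable_fun setT (fun z : SB => (u z + C * w z)%:E).
  by apply/measurable_EFinP; apply: measurable_funD => //; exact: measurable_funM.
have mI1 := @measurable_inner_section y _ muw uw.
have mI2 := @measurable_inner_section y _ mCw Cw.
have I10 a : 0 <= \int[jk (y, a)]_z (u z + C * w z)%:E by apply: integral_ge0 => z _; rewrite lee_fin.
have I20 a : 0 <= \int[jk (y, a)]_z (C * w z)%:E by apply: integral_ge0 => z _; rewrite lee_fin.
have mq := mqkT y.
have R0 a : 0 <= (rK (y, a) + (M * w y + D))%:E by rewrite lee_fin addrA addr_ge0.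
have mR : measurable_fun setT (fun a : AB => (rK (y, a) + (M * w y + D))%:E).
  by apply/measurable_EFinP; exact: measurable_funD.
have q0 k a : (0 <= k)%R -> 0 <= k%:E * jk (y, a) setT by move=> k0; rewrite mule_ge0.
pose E := (alpha * u y + gam + M * w y + D)%R.
have E0 : (0 <= E)%R.
  have h1 : (0 <= alpha * u y + gam + D)%R.
    by rewrite -lerBlDr sub0r; have := lexx D; rewrite {1}/D ler_norml => /andP[].
  by rewrite /E addrAC addr_ge0// mulr_ge0// ltW.
have key : \int[pi `|v|%R y]_a ((rK (y, a) + (M * w y + D))%:E +
      \int[jk (y, a)]_z (u z + C * w z)%:E + (C * w y)%:E * jk (y, a) setT) <=
    \int[pi `|v|%R y]_a (\int[jk (y, a)]_z (C * w z)%:E + (u y + C * w y)%:E * jk (y, a) setT + cst E%:E a).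
  apply: (le_integral_policy (mB y) (PB _ y (normr_ge0 v))).
  - by apply: emeasurable_funD; [exact: emeasurable_funD|exact: measurable_funeM].
  - apply: emeasurable_funD => //.
    by apply: emeasurable_funD; [|exact: measurable_funeM].
  - by move=> a; apply: adde_ge0; [exact: adde_ge0|exact: q0].
  move=> a Ba; have ya := BA y a Ba.
  rewrite rKE// !integral_qk// qk_setT//; have := H y a Ba; rewrite /qint -/(offdiag y).
  have f : qm y a (offdiag y) \is a fin_num by rewrite ge0_fin_numE//; exact: (rate_lty ok).
  have mo := measurable_offdiag ok y.
  have I2fin : \int[qm y a]_(z in offdiag y) (C * w z)%:E \is a fin_num.
    have := Hw ya; rewrite /qint -/(offdiag y) -(fineK f).
    have -> : \int[qm y a]_(z in offdiag y) (C * w z)%:E = C%:E * \int[qm y a]_(z in offdiag y) (w z)%:E.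
      rewrite -ge0_integralZl_EFin//; last exact/measurable_EFinP/measurable_funTS.
      by move=> z _; rewrite lee_fin.
    have : 0 <= \int[qm y a]_(z in offdiag y) (w z)%:E by apply: integral_ge0 => z _; rewrite lee_fin.
    by case: (\int[qm y a]_(z in offdiag y) (w z)%:E).
  have i2 : (qm y a).-integrable (offdiag y) (fun z => (C * w z)%:E).
    apply/integrableP; split; first exact: measurable_funTS.
    under eq_integral do rewrite gee0_abs ?lee_fin//.
    by rewrite ltey_eq I2fin.
  have iu : (qm y a).-integrable (offdiag y) (fun z => (u z)%:E).
    apply: (le_integrable mo _ _ i2); first exact/measurable_EFinP/measurable_funTS.
    by move=> z _; rewrite /= lee_fin; apply: le_trans (uC z) _; exact: ler_norm.
  have -> : \int[qm y a]_(z in offdiag y) (u z + C * w z)%:E =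
      \int[qm y a]_(z in offdiag y) (u z)%:E + \int[qm y a]_(z in offdiag y) (C * w z)%:E.
    by rewrite -integralD//.
  have fu := integrable_fin_num mo iu.
  rewrite -(fineK f) -(fineK I2fin) -(fineK fu) -!EFinM -!EFinB -!EFinD !lee_fin /E.
  move: (fine _) (fine _) (fine _) => lam' J2 Ju.
  move: (r y a) (u y) (w y) => r' u' w'' h.
  rewrite !mulrDl; move: (C * w'' * lam')%R (u' * lam')%R (M * w'')%R h => p1 p2 p3 h.
  by lra.
have mCq : measurable_fun setT (fun a : AB => (C * w y)%:E * jk (y, a) setT) by exact: measurable_funeM.
have muq : measurable_fun setT (fun a : AB => (u y + C * w y)%:E * jk (y, a) setT) by exact: measurable_funeM.
have e1 : \int[pi `|v|%R y]_a ((rK (y, a) + (M * w y + D))%:E +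
      \int[jk (y, a)]_z (u z + C * w z)%:E + (C * w y)%:E * jk (y, a) setT) =
    (rho v y + (M * w y + D))%:E + Jp v y (fun z => (u z + C * w z)%:E) + (C * w y * lp v y)%:E.
  rewrite ge0_integralD//; try by [move=> a _; exact: adde_ge0|exact: emeasurable_funD|move=> a _; exact: q0].
  by rewrite ge0_integralD// integral_rK_shift integral_lp_scale.
have e3 : \int[pi `|v|%R y]_a (\int[jk (y, a)]_z (C * w z)%:E + (u y + C * w y)%:E * jk (y, a) setT + cst E%:E a) =
    Jp v y (fun z => (C * w z)%:E) + ((u y + C * w y) * lp v y)%:E + E%:E.
  rewrite ge0_integralD//; try by [move=> a _; apply: adde_ge0 => //; exact: q0|exact: emeasurable_funD].
  rewrite ge0_integralD//; try by [move=> a _; exact: q0].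
  by rewrite integral_lp_scale// integral_policy_cst.
move: key; rewrite e1 e3.
move: jf1 jf2 => /fineK <- /fineK <-; rewrite -!EFinD !lee_fin /E.
move: (fine _) (fine _) => J1 J2.
move: (rho v y) (lp v y) (C * w y)%R (M * w y)%R => r' l' p1 p2.
exact: unshift_inequality.
Qed.

End policy_process.

(** * Optimality equations *)

Local Open Scope ring_scope.

Section bellman.
Context {R : realType} {S A : completePseudoMetricType R}.
Variables (Aset : S -> set A) (qm : S -> A -> {measure set (borel S) -> \bar R}) (r : S -> A -> R).
Local Notation SB := (borel S).
Local Notation AB := (borel A).
Hypothesis ok : model_ok Aset qm r.
Variables (w : S -> R) (c b Mq : R).
Hypotheses (mw : measurable_fun [set: SB] (w : SB -> R)) (w1 : forall x, 1 <= w x)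
  (c0 : 0 < c) (b0 : 0 <= b) (Mq0 : 0 < Mq)
  (Hw : forall x a, Aset x a -> (qint qm w x a <= (- (c * w x) + b)%:E)%E)
  (Hq : forall x, (qx Aset qm x <= (Mq * w x)%:E)%E)
  (cA : forall x, compact (Aset x)) (cr : forall x, {within Aset x, continuous (r x)})
  (cq : forall x (u : S -> R), measurable_fun [set: SB] (u : SB -> R) ->
     (exists C : R, forall y, `|u y| <= C) -> {within Aset x, continuous (qint qm u x)})
  (cqw : forall x, {within Aset x, continuous (qint qm w x)})
  (nA : forall x, exists a, Aset x a).
Local Notation jk := (qk ok).

Let w0 x : 0 <= w x. Proof. exact: le_trans ler01 (w1 x). Qed.

Definition lamr (xa : SB * AB) : R := fine (jk xa setT).
Definition IQ (u : SB -> R) (xa : SB * AB) : R := \int[jk xa]_y u y.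
(* Adding [Mq w u] makes [r + q u] monotone in [u], because [Mq w] dominates the total jump rate. *)
Definition hamiltonian (u : SB -> R) (x : S) (a : A) : R :=
  r x a + IQ u (x, a) + (Mq * w x - lamr (x, a)) * u x.

Let qk_fin xa : jk xa setT \is a fin_num.
Proof. by rewrite ge0_fin_numE//; exact: qk_lty. Qed.

Lemma lamr_le x a : lamr (x, a) <= Mq * w x.
Proof.
rewrite -lee_fin /lamr fineK//; have [xa|xa] := pselect (Aset x a).
  rewrite qk_setT//; apply: le_trans (Hq x); exact: rate_le_qx.
by rewrite /qk asboolF//= lee_fin mulr_ge0// ltW.
Qed.

Let int_w_fin xa : (\int[jk xa]_y (w y)%:E)%E \is a fin_num.
Proof.
case: xa => x a; have [xa|xa] := pselect (Aset x a); last first.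
  rewrite /qk asboolF//= integral_measure_zero//.
have := Hw xa; rewrite /qint -/(offdiag x) -(integral_qk ok _ xa) -(qk_setT ok xa) -(fineK (qk_fin (x, a))).
have : (0 <= \int[jk (x, a)]_y (w y)%:E)%E by apply: integral_ge0 => y _; rewrite lee_fin.
by case: (\int[jk (x, a)]_y (w y)%:E)%E.
Qed.

Lemma integrable_w xa : (jk xa).-integrable setT (EFin \o w).
Proof.
apply/integrableP; split; first exact/measurable_EFinP.
rewrite (eq_integral (fun y : SB => (w y)%:E)); last by move=> y _; rewrite /= ger0_norm.
by rewrite ltey_eq int_w_fin.
Qed.

Section weighted.
Variable u : SB -> R.
Hypotheses (mu : measurable_fun setT u) (uw : exists C, forall y, `|u y| <= C * w y).

Lemma integrable_Bw xa : (jk xa).-integrable setT (EFin \o u).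
Proof.
have [C uC] := uw.
have iC : (jk xa).-integrable setT (fun y => (C%:E * (EFin \o w) y)%E).
  exact: (@integrableZl _ _ _ _ _ measurableT C _ (integrable_w xa)).
apply: (le_integrable measurableT _ _ iC); first exact/measurable_EFinP.
move=> y _ /=; rewrite lee_fin; apply: le_trans (uC y) _; exact: ler_norm.
Qed.

Lemma IQE xa : (\int[jk xa]_y (u y)%:E)%E = (IQ u xa)%:E.
Proof. by rewrite /IQ /Rintegral fineK//; exact: (integrable_fin_num measurableT (integrable_Bw _)). Qed.

Lemma qintE x a : Aset x a -> qint qm u x a = (IQ u (x, a) - u x * lamr (x, a))%:E.
Proof.
move=> xa; rewrite /qint -/(offdiag x) -(integral_qk ok _ xa) -(qk_setT ok xa).
by rewrite IQE -(fineK (qk_fin (x, a))).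
Qed.

Lemma hamiltonian_qint x a : Aset x a ->
  ((r x a)%:E + qint qm u x a)%E = (hamiltonian u x a - Mq * w x * u x)%:E.
Proof. by move=> xa; rewrite qintE// -EFinD; congr (_%:E); rewrite /hamiltonian; ring. Qed.

Lemma measurable_IQ : measurable_fun setT (IQ u).
Proof.
have mp (f : SB -> R) : measurable_fun setT f -> (forall y, 0 <= f y) ->
    measurable_fun setT (fun xa : SB * AB => fine (\int[jk xa]_y (f y)%:E)%E).
  move=> mf f0; apply: measurableT_comp; first exact: fine_measurable.
  have mF : measurable_fun setT (fun z : (SB * AB) * SB => (f z.2)%:E).
    by apply/measurable_EFinP; exact: (measurableT_comp mf measurable_snd).
  exact: (@measurable_integral_transition _ _ _ SB R jk (fun U mU => @measurable_qk _ _ _ _ _ _ ok U mU) (qk_lty ok)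
    (fun z => (f z.2)%:E) mF (fun z => f0 z.2)).
have [C uC] := uw.
have mCw : measurable_fun setT (fun y : SB => C * w y) by exact: measurable_funM.
have Cw0 y : 0 <= C * w y by exact: le_trans (normr_ge0 _) (uC y).
have m1 := mp _ (measurable_funD mu mCw) (fun y => _); have m2 := mp _ mCw Cw0.
have uCw y : 0 <= u y + C * w y by rewrite -lerBlDr sub0r; have := uC y; rewrite ler_norml => /andP[].
rewrite (_ : IQ u = fun xa => fine (\int[jk xa]_y (u y + C * w y)%:E)%E - fine (\int[jk xa]_y (C * w y)%:E)%E).
  by apply: measurable_funB => //; exact: m1.
apply/funext => xa.
have iC : (jk xa).-integrable setT (EFin \o (fun y => C * w y)).
  by apply: (@integrableZl _ _ _ _ _ measurableT C _ (integrable_w xa)).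
by have := RintegralD measurableT (integrable_Bw xa) iC; rewrite /IQ /Rintegral => ->; rewrite addrK.
Qed.

Lemma measurable_hamiltonian : measurable_fun (K Aset) (fun xa : SB * AB => hamiltonian u xa.1 xa.2).
Proof.
have mr : measurable_fun (K Aset) (fun xa : SB * AB => r xa.1 xa.2).
  by case: ok => _ [_ [_ [_ [_ [_ []]]]]].
apply: measurable_funD.
  apply: measurable_funD => //; apply: measurable_funTS.
  by apply: (eq_measurable_fun (IQ u)); [case|exact: measurable_IQ].
apply: measurable_funM; last by apply: measurable_funTS; exact: (measurableT_comp mu measurable_fst).
apply: measurable_funB.
  by apply: measurable_funTS; apply: measurable_funM => //; exact: (measurableT_comp mw measurable_fst).
apply: measurable_funTS; apply: (eq_measurable_fun lamr); first by case.
by apply: measurableT_comp; [exact: fine_measurable|apply: measurable_qk].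
Qed.

End weighted.

Lemma le_IQ (u v : SB -> R) xa : measurable_fun setT u -> measurable_fun setT v ->
  (exists C, forall y, `|u y| <= C * w y) -> (exists C, forall y, `|v y| <= C * w y) ->
  (forall y, u y <= v y) -> IQ u xa <= IQ v xa.
Proof. by move=> mu mv uw vw uv; apply: le_Rintegral => //; exact: integrable_Bw. Qed.

Lemma le_hamiltonian (u v : SB -> R) x a : measurable_fun setT u -> measurable_fun setT v ->
  (exists C, forall y, `|u y| <= C * w y) -> (exists C, forall y, `|v y| <= C * w y) ->
  (forall y, u y <= v y) -> hamiltonian u x a <= hamiltonian v x a.
Proof.
move=> mu mv uw vw uv; apply: lerD.
  by rewrite lerD2l; exact: le_IQ.
by apply: ler_wpM2l => //; rewrite subr_ge0; exact: lamr_le.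
Qed.

Lemma cvg_IQ (u_ : nat -> SB -> R) (u : SB -> R) C xa : (forall n, measurable_fun setT (u_ n)) ->
  (forall n y, `|u_ n y| <= C * w y) -> (forall y, u_ n y @[n --> \oo] --> u y) ->
  IQ (u_ n) xa @[n --> \oo] --> IQ u xa.
Proof.
move=> mu uC cu.
have mul : measurable_fun setT u by exact: (@measurable_fun_cvg _ _ _ _ u_ u mu (fun y _ => cu y)).
have uCl y : `|u y| <= C * w y.
  have h : `|u_ n y| @[n --> \oo] --> `|u y| by apply: cvg_norm; exact: cu.
  rewrite -(cvg_lim (@Rhausdorff R) h); apply: limr_le; first by apply/cvg_ex; exists `|u y|.
  by apply: nearW => n; exact: uC.
have iC : (jk xa).-integrable setT (fun y => (C * w y)%:E).
  by apply: (@integrableZl _ _ _ _ _ measurableT C _ (integrable_w xa)).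
have := @dominated_cvg _ SB R (jk xa) setT measurableT (fun n => EFin \o u_ n) (EFin \o u)
  (fun y => (C * w y)%:E) (fun n => (measurable_EFinP _ _).2 (mu n)) _ (fun _ _ => isT) iC.
have -> : (\int[jk xa]_y (EFin \o u) y)%E = (IQ u xa)%:E by apply: IQE => //; exists C.
move=> h; apply: (fine_cvg (h _ _)).
- by move=> y _; apply: cvg_EFin; [exact: nearW|exact: cu].
- by move=> n y _ /=; rewrite lee_fin.
Qed.

Lemma cvg_hamiltonian (u_ : nat -> SB -> R) (u : SB -> R) C x a : (forall n, measurable_fun setT (u_ n)) ->
  (forall n y, `|u_ n y| <= C * w y) -> (forall y, u_ n y @[n --> \oo] --> u y) ->
  hamiltonian (u_ n) x a @[n --> \oo] --> hamiltonian u x a.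
Proof.
move=> mu uC cu; apply: cvgD; last by apply: cvgM; [exact: cvg_cst|exact: cu].
by apply: cvgD; [exact: cvg_cst|exact: (@cvg_IQ u_ u C (x, a) mu uC cu)].
Qed.

Let contA x (f : A -> R) := {within Aset x, continuous f}.

Let contA_cvg x f : contA x f <-> forall a, Aset x a -> f b @[b --> within (Aset x) (nbhs a)] --> f a.
Proof. exact: (@subspace_continuousP A (Aset x) R f). Qed.

Let within_eq x (a : A) (f g : A -> R) (l : R) : (forall z, Aset x z -> f z = g z) ->
  f z @[z --> within (Aset x) (nbhs a)] --> l -> g z @[z --> within (Aset x) (nbhs a)] --> l.
Proof.
move=> fg; apply: cvg_trans; apply: near_eq_cvg.
have : \forall z \near nbhs a, Aset x z -> f z = g z by apply: nearW => z; exact: fg.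
exact.
Qed.

Let contA_qint x (u : SB -> R) : measurable_fun setT u -> (exists C, forall y, `|u y| <= C * w y) ->
  {within Aset x, continuous (qint qm u x)} ->
  contA x (fun a => IQ u (x, a) - u x * lamr (x, a)).
Proof.
move=> mu uw /subspace_continuousP h; apply/contA_cvg => a xa.
have : qint qm u x z @[z --> within (Aset x) (nbhs a)] --> qint qm u x a := h a xa.
rewrite (qintE mu uw xa) => /fine_cvg; apply: within_eq => z xz.
by rewrite /= (qintE mu uw xz).
Qed.

Let contAD x f g : contA x f -> contA x g -> contA x (fun a => f a + g a).
Proof. by move=> /contA_cvg hf /contA_cvg hg; apply/contA_cvg => a xa; apply: cvgD; [exact: hf|exact: hg]. Qed.

Let contAM x f k : contA x f -> contA x (fun a => k * f a).
Proof. by move=> /contA_cvg hf; apply/contA_cvg => a xa; apply: cvgM; [exact: cvg_cst|exact: hf]. Qed.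

Let contA_ext x f g : contA x f -> (forall a, Aset x a -> f a = g a) -> contA x g.
Proof.
move=> /contA_cvg hf fg; apply/contA_cvg => a xa; rewrite -fg//.
by apply: within_eq (hf a xa).
Qed.

Let bounded_Bw (u : SB -> R) : (exists C : R, forall y, `|u y| <= C) -> exists C, forall y, `|u y| <= C * w y.
Proof.
move=> [C uC]; exists C => y; apply: le_trans (uC y) _.
by rewrite ler_peMr//; exact: le_trans (normr_ge0 _) (uC y).
Qed.

(** The indicator of [x] is a bounded function whose integral against q(.|x,a) is minus the jump
    rate. *)
Let cont_lamr x : contA x (fun a => lamr (x, a)).
Proof.
have m1 : measurable_fun setT (\1_[set x] : SB -> R).
  by apply: measurable_indic; apply: measurable_singleton; case: ok.
have b1 : exists C : R, forall y : SB, `|(\1_[set x] : SB -> R) y| <= C.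
  by exists 1 => y; rewrite indicE; case: (_ \in _); rewrite ?normr1 ?normr0.
have := @contAM x _ (-1) (contA_qint m1 (bounded_Bw b1) (cq m1 b1)).
move=> h; apply: (contA_ext h) => a xa.
have -> : IQ \1_[set x] (x, a) = 0.
  rewrite /IQ /Rintegral integral_qk// (eq_integral (cst 0%E)); last first.
    by move=> y; rewrite inE => yx; rewrite /= indicE memNset.
  by rewrite integral0.
by rewrite indicE mem_set// mul1r sub0r mulN1r opprK.
Qed.

Let cont_IQ_bounded x (u : SB -> R) : measurable_fun setT u -> (exists C : R, forall y, `|u y| <= C) ->
  contA x (fun a => IQ u (x, a)).
Proof.
move=> mu ub; have := contAD (contA_qint mu (bounded_Bw ub) (cq mu ub)) (@contAM x _ (u x) (@cont_lamr x)).
by move=> h; apply: (contA_ext h) => a _; rewrite subrK.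
Qed.

Let cont_IQ_w x : contA x (fun a => IQ w (x, a)).
Proof.
have ww : exists C, forall y, `|w y| <= C * w y by exists 1 => y; rewrite mul1r ger0_norm.
have := contAD (contA_qint mw ww (@cqw x)) (@contAM x _ (w x) (@cont_lamr x)).
by move=> h; apply: (contA_ext h) => a _; rewrite subrK.
Qed.

Lemma IQZ k (u : SB -> R) xa : measurable_fun setT u -> (exists C, forall y, `|u y| <= C * w y) ->
  IQ (fun y => k * u y) xa = k * IQ u xa.
Proof. by move=> mu uw; apply: RintegralZl => //; exact: integrable_Bw. Qed.

Let IQD (u v : SB -> R) xa : measurable_fun setT u -> (exists C, forall y, `|u y| <= C * w y) ->
  measurable_fun setT v -> (exists C, forall y, `|v y| <= C * w y) ->
  IQ (fun y => u y + v y) xa = IQ u xa + IQ v xa.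
Proof. by move=> mu uw mv vw; apply: RintegralD => //; exact: integrable_Bw. Qed.

(* [u + C w >= 0] is the increasing limit of its bounded truncations. *)
Let lsc_IQ x (u : SB -> R) a (e : R) : measurable_fun setT u -> (exists C, forall y, `|u y| <= C * w y) ->
  Aset x a -> 0 < e ->
  exists2 W, nbhs a W & forall z, W z -> Aset x z -> IQ u (x, a) - e < IQ u (x, z).
Proof.
move=> mu [C uC] xa e0.
have Cw y : 0 <= C * w y by exact: le_trans (normr_ge0 _) (uC y).
have C0 : 0 <= C by rewrite -(pmulr_lge0 _ (lt_le_trans ltr01 (w1 point))).
have v0 y : 0 <= u y + C * w y by rewrite -lerBlDr sub0r; have := uC y; rewrite ler_norml => /andP[].
pose v (y : SB) := u y + C * w y; pose vN N (y : SB) := Num.min (v y) N%:R.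
have mCw : measurable_fun setT (fun y : SB => C * w y) by exact: measurable_funM.
have mv : measurable_fun setT v by exact: measurable_funD.
have mvN N : measurable_fun setT (vN N) by apply: measurable_minr => //; exact: measurable_cst.
have vw y : `|v y| <= (C + C) * w y.
  by rewrite ger0_norm ?v0// /v mulrDl lerD2r; apply: le_trans (uC y); exact: ler_norm.
have vN0 N y : 0 <= vN N y by rewrite le_min v0 ler0n.
have vNw N y : `|vN N y| <= (C + C) * w y.
  by rewrite ger0_norm//; apply: le_trans (vw y); rewrite ger0_norm ?v0// ge_min lexx.
have vNb N : exists K : R, forall y, `|vN N y| <= K.
  by exists N%:R => y; rewrite ger0_norm// ge_min lexx orbT.
have cvN y : vN N y @[N --> \oo] --> v y.
  apply: cvg_near_cst; exists (Num.truncn (v y)).+1 => // N /= hN.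
  rewrite /vN min_l//; apply: le_trans (ltW (truncnS_gt (v y))) _.
  by rewrite ler_nat.
have ww : exists C, forall y, `|w y| <= C * w y by exists 1 => y; rewrite mul1r ger0_norm.
have Bv : exists C, forall y, `|v y| <= C * w y by exists (C + C).
have Bu : exists C, forall y, `|u y| <= C * w y by exists C.
have BCw : exists K, forall y, `|C * w y| <= K * w y by exists C => y; rewrite ger0_norm.
have IQv z : IQ v (x, z) = IQ u (x, z) + C * IQ w (x, z).
  by rewrite -(IQZ C (x, z) mw ww) -IQD.
have e3 : 0 < e / 3 by rewrite divr_gt0.
have [N _ /(_ N (leqnn N)) hN] : \forall N \near \oo, IQ v (x, a) - e / 3 < IQ (vN N) (x, a).
  have := @cvg_IQ vN v (C + C) (x, a) mvN vNw cvN => /cvgrPdist_lt /(_ _ e3).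
  apply: filterS => N; rewrite ltr_distlC => /andP[h _]; exact: h.
have near (f : A -> R) : contA x f -> exists2 W, nbhs a W & forall z, W z -> Aset x z -> `|f a - f z| < e / 3.
  move=> cf; apply: (within_continuous_near (U := [set y | `|f a - y| < e / 3]) cf xa).
  by apply/nbhs_ballP; exists (e / 3).
have [W1 aW1 h1] := near _ (cont_IQ_bounded (mvN N) (vNb N)).
have [W2 aW2 h2] := near _ (@contAM x _ C (@cont_IQ_w x)).
exists (W1 `&` W2); first exact: filterI.
move=> z [/h1 {}h1 /h2 {}h2] xz.
have := h1 xz; have := h2 xz; rewrite !ltr_distlC => /andP[k1 k2] /andP[k3 k4].
have le1 : IQ (vN N) (x, z) <= IQ v (x, z).
  apply: le_IQ => //; first by exists (C + C).
  by move=> y; rewrite ge_min lexx.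
move: hN le1 k1 k2 k3 k4; rewrite !IQv.
move: (IQ u (x, a)) (IQ u (x, z)) (C * IQ w (x, a)) (C * IQ w (x, z)) (IQ (vN N) (x, a)) (IQ (vN N) (x, z)).
by move=> *; lra.
Qed.

(** Lower semicontinuity for [u] and for [- u]. *)
Let cont_IQ x (u : SB -> R) : measurable_fun setT u -> (exists C, forall y, `|u y| <= C * w y) ->
  contA x (fun a => IQ u (x, a)).
Proof.
move=> mu uw; apply: near_within_continuous => a U xa /nbhs_ballP[e /= e0 eU].
have [W1 aW1 h1] := lsc_IQ mu uw xa e0.
have mNu : measurable_fun setT (fun y : SB => -1 * u y) by exact: measurable_funM.
have Nuw : exists C, forall y : SB, `|-1 * u y| <= C * w y.
  by have [C uC] := uw; exists C => y; rewrite mulN1r normrN.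
have [W2 aW2 h2] := lsc_IQ mNu Nuw xa e0.
exists (W1 `&` W2); first exact: filterI.
move=> z [W1z W2z] xz; apply: eU; rewrite /ball /= ltr_distlC.
have k1 := h1 z W1z xz; have := h2 z W2z xz; rewrite !IQZ// => k2.
by apply/andP; split; lra.
Qed.

Lemma continuous_hamiltonian x (u : SB -> R) : measurable_fun setT u -> (exists C, forall y, `|u y| <= C * w y) ->
  {within Aset x, continuous (hamiltonian u x)}.
Proof.
move=> mu uw.
have h := contAD (contAD (@cr x) (@cont_IQ x u mu uw)) (@contAM x _ (- u x) (@cont_lamr x)).
have k : contA x (cst (Mq * w x * u x)) by apply: cst_continuous.
by apply: (contA_ext (contAD h k)) => a _; rewrite /hamiltonian /=; ring.
Qed.

Lemma argmax_hamiltonian (u : SB -> R) : measurable_fun setT u -> (exists C, forall y, `|u y| <= C * w y) ->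
  exists f : S -> A, stationary Aset f /\ forall x a, Aset x a -> hamiltonian u x a <= hamiltonian u x (f x).
Proof.
move=> mu uw; have [pS [pA _]] := ok.
have [f [mf fK fm]] := @measurable_argmax _ _ _ pS pA (K Aset) (hamiltonian u) (@measurable_graph _ _ _ _ _ _ ok)
  cA nA (measurable_hamiltonian mu uw) (fun x => continuous_hamiltonian mu uw).
by exists f.
Qed.

Lemma measurable_hamiltonian_selector (u : SB -> R) (f : S -> A) : measurable_fun setT u ->
  (exists C, forall y, `|u y| <= C * w y) -> stationary Aset f ->
  measurable_fun setT (fun x : SB => hamiltonian u x (f x)).
Proof.
move=> mu uw [mf fA].
have mg : measurable_fun setT (fun x : SB => (x, f x) : SB * AB) by exact: measurable_fun_pair.
apply: (measurable_comp (@measurable_graph _ _ _ _ _ _ ok) _ (measurable_hamiltonian mu uw) mg).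
by move=> _ [x _ <-]; exact: fA.
Qed.

(** The superlevel sets are compact and decreasing, so one action belongs to all of them; at this
    action dominated convergence gives the limit. *)
Lemma dini_hamiltonian (u_ : nat -> SB -> R) (u : SB -> R) C x k : (forall n, measurable_fun setT (u_ n)) ->
  (forall n y, `|u_ n y| <= C * w y) -> (forall n y, u_ n.+1 y <= u_ n y) ->
  (forall y, u_ n y @[n --> \oo] --> u y) ->
  (forall n, exists2 a, Aset x a & k <= hamiltonian (u_ n) x a) -> exists2 a, Aset x a & k <= hamiltonian u x a.
Proof.
move=> mu uC du cu ex; have [pS [pA _]] := ok.
have Bw n : exists C, forall y, `|u_ n y| <= C * w y by exists C.
pose D n := Aset x `&` [set a | k <= hamiltonian (u_ n) x a].
have cD n : compact (D n) by apply: compact_superlevel; [exact: cA|exact: continuous_hamiltonian].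
have nD n : D n !=set0 by have [a xa ka] := ex n; exists a.
have dD n : D n.+1 `<=` D n.
  by move=> a [xa ka]; split; [exact: xa|apply: le_trans ka _; exact: le_hamiltonian].
have [a aP] := compact_bigcap_nonempty pA.1 cD nD dD.
have [xa _] := aP 0%N; exists a => //.
have cH := @cvg_hamiltonian u_ u C x a mu uC cu.
rewrite -(cvg_lim _ cH)//; apply: limr_ge; first by apply/cvg_ex; exists (hamiltonian u x a).
by apply: nearW => n; have [] := aP n.
Qed.

Definition hamiltonian_max (u : SB -> R) (x : S) : R := sup [set hamiltonian u x a | a in Aset x].

Lemma hamiltonian_maxE u x a0 : Aset x a0 -> (forall a, Aset x a -> hamiltonian u x a <= hamiltonian u x a0) ->
  hamiltonian_max u x = hamiltonian u x a0.
Proof.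
move=> xa0 hm; apply/eqP; rewrite eq_le; apply/andP; split.
  by apply: ge_sup; [exists (hamiltonian u x a0); exists a0|move=> _ [a xa <-]; exact: hm].
apply: ub_le_sup; last by exists a0.
by exists (hamiltonian u x a0) => _ [a xa <-]; exact: hm.
Qed.

Lemma hamiltonian_max_ge (u : SB -> R) x a : measurable_fun setT u -> (exists C, forall y, `|u y| <= C * w y) ->
  Aset x a -> hamiltonian u x a <= hamiltonian_max u x.
Proof.
by move=> mu uw xa; have [f [[_ fA] fm]] := argmax_hamiltonian mu uw; rewrite (hamiltonian_maxE (fA x) (fm x))//; exact: fm.
Qed.

Lemma hamiltonian_max_attained (u : SB -> R) : measurable_fun setT u -> (exists C, forall y, `|u y| <= C * w y) ->
  exists2 f, stationary Aset f & forall x, hamiltonian_max u x = hamiltonian u x (f x).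
Proof.
move=> mu uw; have [f [[mf fA] fm]] := argmax_hamiltonian mu uw.
by exists f => // x; exact: hamiltonian_maxE (fA x) (fm x).
Qed.

Let hamiltonian_affine x a k (e : R) : Aset x a ->
  hamiltonian (fun y => k * w y + e) x a =
  r x a + k * (IQ w (x, a) - w x * lamr (x, a)) + Mq * w x * (k * w x + e).
Proof.
move=> xa.
have ww : exists C, forall y, `|w y| <= C * w y by exists 1 => y; rewrite mul1r ger0_norm.
have kw : exists C, forall y : SB, `|k * w y| <= C * w y by exists `|k| => y; rewrite normrM (ger0_norm (w0 y)).
have ew : exists C, forall y : SB, `|(cst e : SB -> R) y| <= C * w y.
  by apply: bounded_Bw; exists `|e|.
rewrite /hamiltonian; have -> : IQ (fun y => k * w y + e) (x, a) = k * IQ w (x, a) + e * lamr (x, a).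
  rewrite (@IQD (fun y => k * w y) (cst e))//; last exact: measurable_funM.
  rewrite IQZ//; congr (_ + _).
  by rewrite /IQ Rintegral_cst.
by ring.
Qed.

(** * Value iteration for the discounted equation *)

Section discounted.
Variables (M alpha : R).
Hypotheses (M0 : 0 < M) (Hr : forall x a, Aset x a -> `|r x a| <= M * w x) (al0 : 0 < alpha).

Let ka := M / c.
Let be := ka * b / alpha.
(** The constants are chosen so that |r| + q U <= alpha U: the drift condition bounds M w + (M/c) q
    w by M b / c, which is [alpha * be]. *)
Let U (y : SB) : R := ka * w y + be.
(** Fixed points solve alpha u = sup_a (r + q u). [T] preserves the measurable functions lying
    between [- U] and [U], and it is monotone on them. *)
Let T (u : SB -> R) (x : SB) : R := hamiltonian_max u x / (alpha + Mq * w x).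
Let un n := iter n T U.

Let ka0 : 0 <= ka. Proof. by apply: divr_ge0; exact: ltW. Qed.
Let be0 : 0 <= be. Proof. exact: divr_ge0 (mulr_ge0 ka0 b0) (ltW al0). Qed.
Let am0 x : 0 < alpha + Mq * w x. Proof. exact: ltr_wpDr (mulr_ge0 (ltW Mq0) (w0 x)) al0. Qed.

Let mU : measurable_fun setT U.
Proof. by apply: measurable_funD => //; exact: measurable_funM. Qed.

Let U_le y : U y <= (ka + be) * w y.
Proof. by rewrite mulrDl lerD2l ler_peMr. Qed.

Let U_Bw (u : SB -> R) : (forall y, `|u y| <= U y) -> exists C, forall y, `|u y| <= C * w y.
Proof. by move=> h; exists (ka + be) => y; apply: le_trans (h y) (U_le y). Qed.

Let drift_w x a : Aset x a -> IQ w (x, a) - w x * lamr (x, a) <= - (c * w x) + b.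
Proof.
move=> xa; rewrite -lee_fin -qintE//; first exact: Hw.
by exists 1 => y; rewrite mul1r ger0_norm.
Qed.

Let drift_U x a : Aset x a -> M * w x + ka * (IQ w (x, a) - w x * lamr (x, a)) <= alpha * U x.
Proof.
move=> xa; have h : ka * (IQ w (x, a) - w x * lamr (x, a)) <= ka * (- (c * w x) + b).
  by apply: ler_wpM2l => //; exact: drift_w.
have e1 : ka * (- (c * w x) + b) = - (M * w x) + alpha * be.
  by rewrite /be /ka; field; rewrite !gt_eqF.
have h2 : alpha * be <= alpha * U x.
  by rewrite ler_pM2l// /U lerDr mulr_ge0.
by move: h h2; rewrite e1; move: (IQ _ _ - _) (M * w x) (alpha * be) (alpha * U x) => *; lra.
Qed.

Let HU x a : Aset x a -> hamiltonian U x a <= (alpha + Mq * w x) * U x.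
Proof.
move=> xa; rewrite hamiltonian_affine// mulrDl lerD2r; apply: le_trans (drift_U xa).
by rewrite lerD2r; apply: le_trans (Hr xa); exact: ler_norm.
Qed.

Let HNU x a : Aset x a -> - ((alpha + Mq * w x) * U x) <= hamiltonian (fun y => - U y) x a.
Proof.
move=> xa; rewrite (_ : (fun y => - U y) = fun y => (- ka) * w y + - be); last first.
  by apply/funext => y; rewrite /U; ring.
rewrite hamiltonian_affine//; have := drift_U xa; have := Hr xa; rewrite ler_norml => /andP[h1 _] h2.
have e : Mq * w x * (- ka * w x + - be) = - (Mq * w x * U x) by rewrite /U; ring.
rewrite e mulrDl opprD lerD2r mulNr.
by move: h1 h2; move: (ka * _) (M * w x) (alpha * U x) (r x a) => *; lra.
Qed.

Let T_bound (u : SB -> R) : measurable_fun setT u -> (forall y, `|u y| <= U y) ->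
  measurable_fun setT (T u) /\ forall y, `|T u y| <= U y.
Proof.
move=> mu uU; have Bu := U_Bw uU.
have [f sf fE] := hamiltonian_max_attained mu Bu; have [mf fA] := sf.
have BU : exists C, forall y, `|U y| <= C * w y.
  by apply: U_Bw => y; rewrite ger0_norm// (le_trans (normr_ge0 _) (uU y)).
split.
  rewrite (_ : T u = fun x => hamiltonian u x (f x) * (alpha + Mq * w x)^-1); last first.
    by apply/funext => x; rewrite /T fE.
  apply: measurable_funM; first exact: measurable_hamiltonian_selector.
  rewrite (_ : (fun x => _) = (@powR R ^~ (-1)) \o (fun x => alpha + Mq * w x)); last first.
    by apply/funext => x /=; rewrite powR_inv1// ltW.
  apply: measurableT_comp; first exact: measurable_powR.
  by apply: measurable_funD => //; exact: measurable_funM.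
move=> x; rewrite /T ler_norml ler_pdivlMr// ler_pdivrMr// fE; apply/andP; split.
  rewrite mulNr mulrC; apply: le_trans (HNU (fA x)) _; apply: le_hamiltonian => //.
  + exact: measurableT_comp.
  + by have [C h] := BU; exists C => y; rewrite normrN.
  + by move=> y; have := uU y; rewrite ler_norml => /andP[].
rewrite mulrC; apply: le_trans (HU (fA x)); apply: le_hamiltonian => //.
by move=> y; have := uU y; rewrite ler_norml => /andP[].
Qed.

Let un_bound n : measurable_fun setT (un n) /\ forall y, `|un n y| <= U y.
Proof.
elim: n => [|n [mn bn]] /=; last exact: T_bound.
split=> // y; rewrite ger0_norm ?lexx//.
by rewrite /U addr_ge0// mulr_ge0.
Qed.

Let mun n : measurable_fun setT (un n). Proof. by case: (un_bound n). Qed.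
Let unU n y : `|un n y| <= U y. Proof. by case: (un_bound n). Qed.
Let unB n : exists C, forall y, `|un n y| <= C * w y. Proof. exact: U_Bw (unU n). Qed.

Let un_dec n y : un n.+1 y <= un n y.
Proof.
elim: n y => [y|n IH y].
  by have := unU 1 y; rewrite ler_norml => /andP[].
rewrite /un !iterS -/(un n) -/(un n.+1) /T ler_pM2r ?invr_gt0//.
have [f [_ fA] ->] := hamiltonian_max_attained (mun n.+1) (unB n.+1).
apply: le_trans (hamiltonian_max_ge (mun n) (unB n) (fA y)).
exact: le_hamiltonian (unB _) (unB _) IH.
Qed.

Lemma discounted_equation : exists u : SB -> R, [/\ measurable_fun setT u,
  forall y, `|u y| <= M / c * w y + M / c * b / alpha,
  forall x a, Aset x a -> hamiltonian u x a <= (alpha + Mq * w x) * u x &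
  exists2 f, stationary Aset f & forall x, hamiltonian u x (f x) = (alpha + Mq * w x) * u x].
Proof.
have cun y : cvgn (un ^~ y).
  apply: nonincreasing_is_cvgn.
    by apply/nonincreasing_seqP => n; exact: un_dec.
  exists (- U y) => _ [n _ <-]; by have := unU n y; rewrite ler_norml => /andP[].
pose u (y : SB) := limn (un ^~ y).
have cu y : un n y @[n --> \oo] --> u y by exact: cun.
have mu : measurable_fun setT u by exact: (@measurable_fun_cvg _ _ _ _ un u mun (fun y _ => cu y)).
have unC n y : `|un n y| <= (ka + be) * w y by exact: le_trans (unU n y) (U_le y).
have uU y : `|u y| <= U y.
  have h : `|un n y| @[n --> \oo] --> `|u y| by apply: cvg_norm; exact: cu.
  rewrite -(cvg_lim (@Rhausdorff R) h); apply: limr_le; first by apply/cvg_ex; exists `|u y|.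
  by apply: nearW => n; exact: unU.
have Bu := U_Bw uU.
have uun n y : u y <= un n y.
  apply: (@nonincreasing_cvgn_ge _ (un ^~ y)); last exact: cun.
  by apply/nonincreasing_seqP => k; exact: un_dec.
have unS n x : (alpha + Mq * w x) * un n.+1 x = hamiltonian_max (un n) x.
  by rewrite /un iterS -/(un n) /T mulrCA mulfV ?mulr1// gt_eqF.
(* The limit lies below all iterates, so its Hamiltonian at a fixed action bounds every one of them
   from below. *)
have le x a : Aset x a -> hamiltonian u x a <= (alpha + Mq * w x) * u x.
  move=> xa; rewrite mulrC -ler_pdivrMr//; apply: limr_ge => //; apply: nearW => n.
  rewrite ler_pdivrMr//; apply: le_trans (_ : hamiltonian u x a <= hamiltonian (un n) x a) _.
    exact: le_hamiltonian (Bu) (unB n) (uun n).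
  apply: le_trans (hamiltonian_max_ge (mun n) (unB n) xa) _; rewrite -unS [X in _ <= X]mulrC ler_pM2l//.
(* The maximizing action varies with the iterate, hence the compactness argument. *)
have ge x : exists2 a, Aset x a & (alpha + Mq * w x) * u x <= hamiltonian u x a.
  apply: (@dini_hamiltonian un u (ka + be)) => // n.
  have [f [_ fA] fE] := hamiltonian_max_attained (mun n) (unB n).
  by exists (f x) => //; rewrite -fE -unS ler_pM2l//; exact: uun.
exists u; split=> //; have [f sf fE] := hamiltonian_max_attained mu Bu; exists f => // x.
apply: le_anti; apply/andP; split; first exact: le (sf.2 x).
rewrite -fE.
have [a xa h] := ge x; exact: le_trans h (hamiltonian_max_ge mu Bu xa).
Qed.

End discounted.

Lemma hamiltonian_shift (u : SB -> R) (e : R) x a : measurable_fun setT u ->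
  (exists C, forall y, `|u y| <= C * w y) ->
  hamiltonian (fun y => u y + e) x a = hamiltonian u x a + Mq * w x * e.
Proof.
move=> mu uw.
have ew : exists C, forall y : SB, `|(cst e : SB -> R) y| <= C * w y.
  by apply: bounded_Bw; exists `|e|.
rewrite /hamiltonian (@IQD u (cst e))//.
have -> : IQ (cst e) (x, a) = e * lamr (x, a) by rewrite /IQ Rintegral_cst.
by rewrite /=; ring.
Qed.

(** * Limits of relative values as the discount vanishes *)

Section vanishing_discount.
Variables (h : nat -> SB -> R) (eps : nat -> S -> R) (C g : R).
Hypotheses (mh : forall n, measurable_fun setT (h n)) (hC : forall n y, `|h n y| <= C * w y)
  (ceps : forall x, eps n x @[n --> \oo] --> g)
  (hle : forall n x a, Aset x a -> hamiltonian (h n) x a <= eps n x + Mq * w x * h n x)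
  (hge : forall n x, exists2 a, Aset x a & eps n x + Mq * w x * h n x <= hamiltonian (h n) x a).

Let ub y : has_ubound (range (h ^~ y)).
Proof. by exists (C * w y) => _ [n _ <-]; apply: le_trans (hC n y); exact: ler_norm. Qed.

Let lb y : has_lbound (range (h ^~ y)).
Proof. by exists (- (C * w y)) => _ [n _ <-]; have := hC n y; rewrite ler_norml => /andP[]. Qed.

Let subrange (v : nat -> R) N : sdrop v N `<=` range v.
Proof. by move=> _ [n _ <-]; exists n. Qed.

Let sdrop_neq0 (v : nat -> R) N : sdrop v N !=set0.
Proof. by exists (v N), N => //=. Qed.

Let h_le_sups N n y : (N <= n)%N -> h n y <= sups (h ^~ y) N.
Proof. by move=> Nn; apply: ub_le_sup; [exact: subset_has_ubound (ub y)|exists n]. Qed.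

Let infs_le_h N n y : (N <= n)%N -> infs (h ^~ y) N <= h n y.
Proof. by move=> Nn; apply: ge_inf; [exact: subset_has_lbound (lb y)|exists n]. Qed.

Let sups_bound N y : `|sups (h ^~ y) N| <= C * w y.
Proof.
rewrite ler_norml; apply/andP; split.
  by apply: le_trans (h_le_sups y (leqnn N)); have := hC N y; rewrite ler_norml => /andP[].
by apply: ge_sup => // _ [n _ <-]; apply: le_trans (hC n y); exact: ler_norm.
Qed.

Let infs_bound N y : `|infs (h ^~ y) N| <= C * w y.
Proof.
rewrite ler_norml; apply/andP; split.
  by apply: lb_le_inf => // _ [n _ <-]; have := hC n y; rewrite ler_norml => /andP[].
by apply: le_trans (infs_le_h y (leqnn N)) _; apply: le_trans (hC N y); exact: ler_norm.
Qed.

Let msups N : measurable_fun setT (fun y : SB => sups (h ^~ y) N).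
Proof. by apply: measurable_fun_sups => // y _; exact: ub. Qed.

Let minfs N : measurable_fun setT (fun y : SB => infs (h ^~ y) N).
Proof. by apply: measurable_fun_infs => // y _; exact: lb. Qed.

Let lim_bound (v_ : nat -> SB -> R) (v : SB -> R) : (forall n y, `|v_ n y| <= C * w y) ->
  (forall y, v_ n y @[n --> \oo] --> v y) -> forall y, `|v y| <= C * w y.
Proof.
move=> vC cv y; have k : `|v_ n y| @[n --> \oo] --> `|v y| by apply: cvg_norm; exact: cv.
rewrite -(cvg_lim (@Rhausdorff R) k); apply: limr_le; first by apply/cvg_ex; exists `|v y|.
by apply: nearW => n; exact: vC.
Qed.

Let mw0 x : 0 < Mq * w x. Proof. exact: mulr_gt0 Mq0 (lt_le_trans ltr01 (w1 x)). Qed.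

Let eps_near x N (d : R) : 0 < d -> exists2 n0, (N <= n0)%N & forall n, (n0 <= n)%N -> `|g - eps n x| < d.
Proof.
move=> d0; have /cvgrPdist_lt/(_ _ d0)[n1 _ hn] := ceps x.
exists (maxn N n1); first exact: leq_maxl.
by move=> n; rewrite geq_max => /andP[_ h1]; exact: hn.
Qed.

(** From index [N] on, every [h n] lies below the supremum [sups], so monotonicity bounds all late
    [h n x] by the maximal Hamiltonian of that supremum, up to [d]. Hence so is [u2 x]. As [N] grows
    the suprema decrease to [u2], and [dini_hamiltonian] applies. *)
Lemma limsup_subsolution : exists u2 : SB -> R, [/\ measurable_fun setT u2,
  forall y, `|u2 y| <= C * w y & forall x, exists2 a, Aset x a & g + Mq * w x * u2 x <= hamiltonian u2 x a].
Proof.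
have cs y : cvgn (sups (h ^~ y)) by apply/cvg_ex; exists (inf (range (sups (h ^~ y)))); exact: cvg_sups_inf.
pose u2 (y : SB) := limn (sups (h ^~ y)).
have cu y : sups (h ^~ y) n @[n --> \oo] --> u2 y by exact: cs.
have mu2 : measurable_fun setT u2.
  exact: (@measurable_fun_cvg _ _ _ _ (fun n y => sups (h ^~ y) n) u2 msups (fun y _ => cu y)).
have dec y : nonincreasing_seq (sups (h ^~ y)) by exact: nonincreasing_sups.
exists u2; split=> //; first exact: (lim_bound sups_bound cu).
move=> x; apply: (@dini_hamiltonian (fun n y => sups (h ^~ y) n) u2 C x) => // [n y|N].
  by move/nonincreasing_seqP: (dec y); exact.
pose sN y := sups (h ^~ y) N.
have BN : exists C, forall y, `|sN y| <= C * w y by exists C => y; exact: sups_bound.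
have Bh n : exists C, forall y, `|h n y| <= C * w y by exists C => y; exact: hC.
have [f [_ fA] fE] := hamiltonian_max_attained (msups N) BN.
exists (f x) => //; rewrite -fE; apply/ler_addgt0Pr => d d0.
have [n0 Nn0 hn0] := eps_near x N d0.
have key n : (n0 <= n)%N -> Mq * w x * h n x <= hamiltonian_max sN x - g + d.
  move=> nn; have [a xa ha] := hge n x; have := hn0 n nn; rewrite ltr_distlC => /andP[h1 _].
  have le1 : hamiltonian (h n) x a <= hamiltonian_max sN x.
    apply: le_trans (hamiltonian_max_ge (msups N) BN xa); apply: le_hamiltonian => // y.
    exact: h_le_sups (leq_trans Nn0 nn).
  by move: ha h1 le1; move: (eps n x) (hamiltonian _ _ _) (hamiltonian_max _ _) (Mq * w x * _) => *; lra.
have : u2 x <= (hamiltonian_max sN x - g + d) / (Mq * w x).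
  apply: (@le_trans _ _ (sups (h ^~ x) n0)); first exact: nonincreasing_cvgn_ge.
  apply: ge_sup => // _ [n nn <-]; rewrite ler_pdivlMr// mulrC; exact: key.
rewrite ler_pdivlMr// mulrC.
by move: (Mq * w x * u2 x) (hamiltonian_max sN x) => *; lra.
Qed.

(** The mirror image for each fixed action: the infima increase to [u1], and the limit is taken by
    dominated convergence. *)
Lemma liminf_supersolution : exists u1 : SB -> R, [/\ measurable_fun setT u1,
  forall y, `|u1 y| <= C * w y & forall x a, Aset x a -> hamiltonian u1 x a <= g + Mq * w x * u1 x].
Proof.
have ci y : cvgn (infs (h ^~ y)) by apply/cvg_ex; exists (sup (range (infs (h ^~ y)))); exact: cvg_infs_sup.
pose u1 (y : SB) := limn (infs (h ^~ y)).
have cu y : infs (h ^~ y) n @[n --> \oo] --> u1 y by exact: ci.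
have mu1 : measurable_fun setT u1.
  exact: (@measurable_fun_cvg _ _ _ _ (fun n y => infs (h ^~ y) n) u1 minfs (fun y _ => cu y)).
have inc y : nondecreasing_seq (infs (h ^~ y)) by exact: nondecreasing_infs.
exists u1; split=> //; first exact: (lim_bound infs_bound cu).
move=> x a xa.
have cH := @cvg_hamiltonian (fun n y => infs (h ^~ y) n) u1 C x a minfs infs_bound cu.
rewrite -(cvg_lim (@Rhausdorff R) cH); apply: limr_le; first by apply/cvg_ex; exists (hamiltonian u1 x a).
apply: nearW => N; pose iN y := infs (h ^~ y) N; rewrite -/iN.
have BN : exists C, forall y, `|iN y| <= C * w y by exists C => y; exact: infs_bound.
have Bh n : exists C, forall y, `|h n y| <= C * w y by exists C => y; exact: hC.
apply/ler_addgt0Pr => d d0.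
have [n0 Nn0 hn0] := eps_near x N d0.
have key n : (n0 <= n)%N -> hamiltonian iN x a - g - d <= Mq * w x * h n x.
  move=> nn; have ha := hle n xa; have := hn0 n nn; rewrite ltr_distlC => /andP[_ h1].
  have le1 : hamiltonian iN x a <= hamiltonian (h n) x a.
    by apply: (@le_hamiltonian iN (h n) x a (minfs N) (mh n) BN (Bh n)) => y; apply: infs_le_h; exact: leq_trans Nn0 nn.
  by move: ha h1 le1; move: (eps n x) (hamiltonian iN _ _) (hamiltonian (h n) _ _) (Mq * w x * _) => *; lra.
have : (hamiltonian iN x a - g - d) / (Mq * w x) <= u1 x.
  apply: (@le_trans _ _ (infs (h ^~ x) n0)); last exact: nondecreasing_cvgn_le.
  apply: lb_le_inf => // _ [n nn <-]; rewrite ler_pdivrMr// mulrC; exact: key.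
rewrite ler_pdivrMr// mulrC.
by move: (Mq * w x * u1 x) (hamiltonian iN x a) => *; lra.
Qed.

End vanishing_discount.

End bellman.

(** * Discounted and average rewards *)

Local Open Scope ereal_scope.

Section half_line.
Context {R : realType}.
Local Notation leb := (@lebesgue_measure R).
Local Notation D := (@nonneg_times R).

Let mD : measurable D. Proof. exact: measurable_itv. Qed.

Let mexp (E : set R) (alpha : R) : measurable_fun E (fun t : R => (expR (- (alpha * t)))%:E).
Proof.
apply: measurable_funTS; apply/measurable_EFinP; apply: measurableT_comp => //.
by apply: measurableT_comp => //; exact: measurable_funM.
Qed.

(** Up to the factor 1/alpha the integrand is the density of an exponential law. *)
Lemma integrable_expR_halfline (alpha : R) : (0 < alpha)%R ->
  leb.-integrable D (fun t => (expR (- (alpha * t)))%:E).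
Proof.
move=> al0; apply/integrableP; split; first exact: mexp.
apply: (@le_lt_trans _ _ (\int[leb]_(t in D) (alpha^-1%:E * (exponential_pdf alpha t)%:E))).
  rewrite le_eqVlt; apply/orP; left; apply/eqP.
  apply: eq_integral => t; rewrite inE /nonneg_times /= in_itv /= andbT => t0.
  rewrite /= ger0_norm ?expR_ge0// exponential_pdfE// -EFinM mulrA mulVf ?mul1r ?gt_eqF//.
  by rewrite mulNr.
have mp (E : set R) : measurable_fun E (fun t => (exponential_pdf alpha t)%:E).
  by apply/measurable_EFinP; apply: measurable_funTS; exact: measurable_exponential_pdf.
have p0 t : 0 <= (exponential_pdf alpha t)%:E by rewrite lee_fin exponential_pdf_ge0// ltW.
rewrite ge0_integralZl_EFin//; [|exact: mp|by rewrite invr_ge0 ltW].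
apply: (@le_lt_trans _ _ (alpha^-1%:E * \int[leb]_t (exponential_pdf alpha t)%:E)).
  apply: lee_wpmul2l; first by rewrite lee_fin invr_ge0 ltW.
  apply: ge0_subset_integral => //; exact: mp.
by rewrite integral_exponential_pdf// mule1 ltry.
Qed.

Lemma expR_cvg0 (alpha B a : R) : (0 < alpha)%R ->
  (a + B * expR (- (alpha * n%:R)))%:E @[n --> \oo] --> a%:E.
Proof.
move=> al0; apply: cvg_EFin; first exact: nearW.
have h : expR (- (alpha * n%:R)) @[n --> \oo] --> (0 : R)%R.
  have k1 : (alpha * t)%R @[t --> +oo%R] --> +oo%R by move=> V; apply: (gt0_cvgMry al0 (f := id)).
  have k : (alpha * n%:R)%R @[n --> \oo] --> +oo%R by exact: (cvg_comp _ _ (@cvgr_idn R) k1).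
  exact: (cvg_comp _ _ k (@cvgr_expR R)).
rewrite -[X in _ --> X]addr0 -(mulr0 B).
by apply: cvgD; [exact: cvg_cst|apply: cvgM; [exact: cvg_cst|exact: h]].
Qed.

Lemma halfline_le (alpha a B k : R) (f : R -> \bar R) : (0 < alpha)%R -> measurable_fun D f ->
  (forall t, (0 <= t)%R -> `|f t| <= k%:E) ->
  (forall n, \int[leb]_(t in `[0%R, n%:R]) ((expR (- (alpha * t)))%:E * f t) <=
    (a + B * expR (- (alpha * n%:R)))%:E) ->
  \int[leb]_(t in D) ((expR (- (alpha * t)))%:E * f t) <= a%:E.
Proof.
move=> al0 mf fk fle; pose F t := (expR (- (alpha * t)))%:E * f t.
have mF : measurable_fun D F by exact: emeasurable_funM.
have Fk t : D t -> `|F t| <= k%:E * (expR (- (alpha * t)))%:E.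
  rewrite /nonneg_times /= in_itv /= andbT => t0.
  rewrite abseM gee0_abs ?lee_fin ?expR_ge0// muleC; apply: lee_wpmul2r; last exact: fk.
  by rewrite lee_fin expR_ge0.
have Fn n : \int[leb]_(t in `[0%R, n%:R]) F t = \int[leb]_(t in D) (F \_ `[0%R, n%:R]) t.
  rewrite -integral_mkcondr; congr (integral _ _ _).
  apply/seteqP; split=> t; rewrite /nonneg_times /= !in_itv /= ?andbT; last by case.
  by move=> /andP[t0 tn]; split=> //; rewrite t0.
have cF : \int[leb]_(t in D) (F \_ `[0%R, n%:R]) t @[n --> \oo] --> \int[leb]_(t in D) F t.
  apply: (@dominated_cvg _ _ _ leb D mD (fun n => F \_ `[0%R, n%:R]) F (fun t => k%:E * (expR (- (alpha * t)))%:E)).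
  - move=> n; apply: (measurable_funS measurableT) => //.
    have e : (F \_ `[0%R, n%:R]) = ((F \_ D) \_ `[0%R, n%:R]).
      apply/funext => t; rewrite !patchE; case: ifPn => //; rewrite inE /= in_itv /= => /andP[t0 _].
      by rewrite mem_set// /nonneg_times /= in_itv /= t0.
    rewrite e; apply: (measurable_restrictT _ _).1; first exact: measurable_itv.
    by apply: measurable_funTS; apply: (measurable_restrictT _ mD).1.
  - move=> t Dt; apply: cvg_near_cst; exists (Num.truncn t).+1 => // n /= nt.
    rewrite patchE mem_set//= in_itv /=; move: Dt; rewrite /nonneg_times /= in_itv /= andbT => -> /=.
    by apply: le_trans (ltW (truncnS_gt t)) _; rewrite ler_nat.
  - by move=> t _; rewrite -EFinM.
  - by apply: integrableZl => //; exact: integrable_expR_halfline.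
  - move=> n t Dt; rewrite patchE; case: ifPn => _; first exact: Fk.
    by apply: le_trans (Fk t Dt); rewrite [X in `|X| <= _](_ : _ = 0)// abse0.
rewrite -(cvg_lim (@ereal_hausdorff R) cF) -(cvg_lim (@ereal_hausdorff R) (@expR_cvg0 alpha B a al0)).
apply: lee_lim.
- by apply/cvg_ex; exists (\int[leb]_(t in D) F t).
- by apply/cvg_ex; exists a%:E; exact: expR_cvg0.
- by apply: nearW => n; rewrite -Fn; exact: fle.
Qed.

Lemma integrable_segment (f : R -> \bar R) (alpha k T : R) : (0 <= alpha)%R -> measurable_fun D f ->
  (forall t, (0 <= t)%R -> `|f t| <= k%:E) ->
  leb.-integrable `[0%R, T] (fun t => (expR (- (alpha * t)))%:E * f t).
Proof.
move=> al0 mf fk.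
have sD : `[0%R, T] `<=` D.
  by move=> t; rewrite /nonneg_times /= !in_itv /= andbT => /andP[].
have ik : leb.-integrable `[0%R, T] (EFin \o cst k).
  apply: continuous_compact_integrable; first exact: segment_compact.
  by apply: continuous_subspaceT => t; exact: cvg_cst.
apply: (@le_integrable _ _ R leb _ (measurable_itv `[0%R, T]) _ (EFin \o cst k) _ _ ik).
  by apply: emeasurable_funM; [exact: mexp|apply: (measurable_funS mD sD); exact: mf].
move=> t; rewrite /= in_itv /= => /andP[t0 _].
apply: (@le_trans _ _ (1 * `|f t|)).
  rewrite abseM gee0_abs ?lee_fin ?expR_ge0//; apply: lee_wpmul2r => //.
  by rewrite lee_fin expR_le1 oppr_le0 mulr_ge0.
by rewrite mul1e; apply: le_trans (fk t t0) _; rewrite lee_fin ler_norm.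
Qed.

Lemma integrable_integralN (E : set R) (f : R -> \bar R) : measurable E -> leb.-integrable E f ->
  \int[leb]_(t in E) - f t = - \int[leb]_(t in E) f t.
Proof.
by move=> mE fi; apply: integralN; exact: integrable_add_def.
Qed.

Lemma integrable_halfline (f : R -> \bar R) (alpha k : R) : (0 < alpha)%R -> measurable_fun D f ->
  (forall t, (0 <= t)%R -> `|f t| <= k%:E) ->
  leb.-integrable D (fun t => (expR (- (alpha * t)))%:E * f t).
Proof.
move=> al0 mf fk.
have ik : leb.-integrable D (fun t => k%:E * (expR (- (alpha * t)))%:E).
  by apply: integrableZl => //; exact: integrable_expR_halfline.
apply: (@le_integrable _ _ R leb _ mD _ (fun t => k%:E * (expR (- (alpha * t)))%:E) _ _ ik).
  by apply: emeasurable_funM; [exact: mexp|exact: mf].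
move=> t; rewrite /nonneg_times /= in_itv /= andbT => t0.
rewrite abseM gee0_abs ?lee_fin ?expR_ge0// muleC.
apply: (@le_trans _ _ (k%:E * (expR (- (alpha * t)))%:E)); last exact: lee_abs.
by apply: lee_wpmul2r; [rewrite lee_fin expR_ge0|exact: fk].
Qed.

Lemma halfline_ge (alpha a B k : R) (f : R -> \bar R) : (0 < alpha)%R -> measurable_fun D f ->
  (forall t, (0 <= t)%R -> `|f t| <= k%:E) ->
  (forall n, (a - B * expR (- (alpha * n%:R)))%:E <=
    \int[leb]_(t in `[0%R, n%:R]) ((expR (- (alpha * t)))%:E * f t)) ->
  a%:E <= \int[leb]_(t in D) ((expR (- (alpha * t)))%:E * f t).
Proof.
move=> al0 mf fk fge.
have mNf : measurable_fun D (fun t => - f t) by exact: measurableT_comp.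
have Nfk t : (0 <= t)%R -> `|- f t| <= k%:E by rewrite abseN; exact: fk.
have := @halfline_le alpha (- a) B k (fun t => - f t) al0 mNf Nfk.
have eN (E : set R) : measurable E -> leb.-integrable E (fun t => (expR (- (alpha * t)))%:E * f t) ->
    \int[leb]_(t in E) ((expR (- (alpha * t)))%:E * - f t) =
    - \int[leb]_(t in E) ((expR (- (alpha * t)))%:E * f t).
  by move=> mE fi; rewrite -(integrable_integralN mE fi); apply: eq_integral => t _; rewrite muleN.
rewrite (eN _ mD); last exact: (integrable_halfline al0 mf fk).
rewrite EFinN leeN2; apply => n; rewrite (eN _ (measurable_itv _)); last exact: (integrable_segment _ (ltW al0) mf fk).
by rewrite leeNl -EFinN opprD opprK.
Qed.

Lemma limf_einf_le (f : R -> \bar R) (g k : R) :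
  (forall T, (0 < T)%R -> f T <= (g + k / T)%:E) -> limf_einf f (pinfty_nbhs R) <= g%:E.
Proof.
move=> fle; rewrite limf_einfE; apply: ge_ereal_sup => _ [V [N [_ hN]] <-].
apply/lee_addgt0Pr => e e0.
pose T := (Num.max (Num.max N 0) (`|k| / e) + 1)%R.
have [N1 [T1 kT]] : (N < T)%R /\ (0 < T)%R /\ (`|k| / e < T)%R.
  by rewrite /T; split; [|split]; rewrite ltr_pwDr// !le_max lexx ?orbT.
apply: (@le_trans _ _ (f T)).
  by apply: ereal_inf_lbound; exists T => //; exact: hN.
apply: le_trans (fle T T1) _; rewrite -EFinD lee_fin lerD2l ler_pdivrMr//.
by apply: le_trans (ler_norm k) _; rewrite mulrC -ler_pdivrMr// ltW.
Qed.

Lemma limf_einf_ge (f : R -> \bar R) (g k : R) :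
  (forall T, (0 < T)%R -> (g - k / T)%:E <= f T) -> g%:E <= limf_einf f (pinfty_nbhs R).
Proof.
move=> fle; rewrite limf_einfE; apply/lee_addgt0Pr => e e0.
pose N := Num.max 0%R (`|k| / e)%R.
have h : (g - e)%:E <= ereal_sup [set ereal_inf (f @` V) | V in pinfty_nbhs R].
  apply: (@le_trans _ _ (ereal_inf (f @` [set T | (N < T)%R]))); last first.
    apply: ereal_sup_ubound; exists [set T | (N < T)%R] => //.
    by exists N; split=> //; exact: num_real.
  apply: le_ereal_inf_tmp => _ [T NT <-]; move: NT; rewrite /N /= gt_max => /andP[T0 kT].
  apply: le_trans (fle T T0); rewrite lee_fin lerD2l lerN2 ler_pdivrMr//.
  by apply: le_trans (ler_norm k) _; rewrite mulrC -ler_pdivrMr// ltW.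
by move: h; rewrite EFinB leeBlDr.
Qed.

End half_line.

Local Open Scope ring_scope.

(** * Bounds on the discounted and average criteria *)

Section criteria.
Context {R : realType} {S A : completePseudoMetricType R}.
Variables (Aset : S -> set A) (qm : S -> A -> {measure set (borel S) -> \bar R}) (r : S -> A -> R).
Local Notation SB := (borel S).
Local Notation AB := (borel A).
Local Notation leb := (@lebesgue_measure R).
Hypothesis ok : model_ok Aset qm r.
Variables (w w' : S -> R) (c b Mq M c' b' M' : R).
Hypotheses (mw : measurable_fun [set: SB] (w : SB -> R)) (w1 : forall x, 1 <= w x)
  (c0 : 0 < c) (b0 : 0 <= b)
  (Hw : forall x a, Aset x a -> (qint qm w x a <= (- (c * w x) + b)%:E)%E)
  (Hq : forall x, (qx Aset qm x <= (Mq * w x)%:E)%E)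
  (M0 : 0 < M) (Hr : forall x a, Aset x a -> `|r x a| <= M * w x)
  (mw' : measurable_fun [set: SB] (w' : SB -> R)) (w'0 : forall x, 0 <= w' x)
  (c'0 : 0 < c') (b'0 : 0 <= b') (M'0 : 0 < M')
  (Hqw : forall x, (qx Aset qm x * (w x)%:E <= (M' * w' x)%:E)%E)
  (Hw' : forall x a, Aset x a -> (qint qm w' x a <= (c' * w' x + b')%:E)%E).
Local Notation hamiltonian := (hamiltonian ok w Mq).

Let K x := M * (w x + b / c).

Let Erew_le pi x t : admissible Aset pi -> 0 <= t -> (`|Erew qm r pi x t| <= (K x)%:E)%E.
Proof.
move=> api t0.
exact: (Erew_bound ok mw w1 c0 b0 Hw Hq M0 Hr mw' w'0 c'0 b'0 M'0 Hqw Hw' api x t0).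
Qed.

Let mErew pi x : admissible Aset pi -> measurable_fun (@nonneg_times R) (Erew qm r pi x).
Proof.
move=> api; exact: (@measurable_Erew _ _ _ _ _ _ ok w Mq M mw w1 Hq M0 Hr pi api x).
Qed.

Let okN : model_ok Aset qm (fun x a => - r x a).
Proof.
have [h1 [h2 [h3 [h4 [h5 [h6 [h7 mr]]]]]]] := ok.
by do 7 (split => //); exact: measurableT_comp.
Qed.

Let HrN x a : Aset x a -> `|- r x a| <= M * w x. Proof. by rewrite normrN; exact: Hr. Qed.

Let expI (alpha t : R) : (\int[leb]_(v in `[0%R, t]) (expR (- (alpha * v)))%:E \is a fin_num)%E.
Proof.
apply: integrable_fin_num => //.
apply: continuous_compact_integrable; first exact: segment_compact.
apply: continuous_subspaceT => v; apply: continuous_comp; last exact: continuous_expR.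
by apply: cvgN; apply: cvgM; [exact: cvg_cst|exact: cvg_id].
Qed.

Section value.
Variables (alpha gam C : R) (u : SB -> R).
Hypotheses (al0 : 0 <= alpha) (C0 : 0 <= C) (mu : measurable_fun setT u) (uC : forall y, `|u y| <= C * w y).

Let uw : exists C, forall y, `|u y| <= C * w y. Proof. by exists C. Qed.

Lemma reward_integral_le pi t x : admissible Aset pi ->
  (forall y a, Aset y a -> hamiltonian u y a <= (alpha + Mq * w y) * u y + gam) -> 0 <= t ->
  (\int[leb]_(v in `[0%R, t]) ((expR (- (alpha * v)))%:E * Erew qm r pi x v) <=
  (u x + C * expR (- (alpha * t)) * (w x + b / c))%:E +
    gam%:E * \int[leb]_(v in `[0%R, t]) (expR (- (alpha * v)))%:E)%E.
Proof.
move=> api Hu t0.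
have mA y : measurable (Aset y : set AB) by case: ok => _ [_ []].
have PA s y : 0 <= s -> pi s y (Aset y) = 1%E by case: api => [[h _] _]; exact: h.
apply: (@policy_verification _ _ _ _ _ _ ok w w' c b Mq M c' b' M' mw w1 c0 b0 Hw Hq M0 Hr mw' w'0
  c'0 b'0 M'0 Hqw Hw' _ api alpha gam C u Aset t x al0 C0 mu uC mA (fun=> @subset_refl _ _) PA _ t0).
move=> y a ya; rewrite (@hamiltonian_qint _ _ _ _ _ _ ok w c b Mq mw w1 Hw u mu uw y a ya) lee_fin.
by have := Hu y a ya; rewrite mulrDl; move: (Mq * _ * _) (alpha * _) => *; lra.
Qed.

(** This is [policy_verification] for the reward [- r] and the function [- u], with the policy
    carried by the single actions [f y]. *)
Lemma reward_integral_ge f t x : stationary Aset f -> admissible Aset (stat_policy f) ->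
  (forall y, (alpha + Mq * w y) * u y + gam <= hamiltonian u y (f y)) -> 0 <= t ->
  ((u x - C * expR (- (alpha * t)) * (w x + b / c))%:E +
    gam%:E * \int[leb]_(v in `[0%R, t]) (expR (- (alpha * v)))%:E <=
   \int[leb]_(v in `[0%R, t]) ((expR (- (alpha * v)))%:E * Erew qm r (stat_policy f) x v))%E.
Proof.
move=> sf api Hu t0.
have mNu : measurable_fun setT (fun y : SB => - u y) by exact: measurableT_comp.
have Nuw : exists C, forall y : SB, `|- u y| <= C * w y by exists C => y; rewrite normrN.
have mB y : measurable ([set f y] : set AB) by apply: measurable_singleton; case: ok => _ [].
have qN y a : Aset y a -> qint qm (fun y => - u y) y a = (- qint qm u y a)%E.
  move=> ya; rewrite (@qintE _ _ _ _ _ _ ok w c b mw w1 Hw u mu uw y a ya).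
  rewrite (@qintE _ _ _ _ _ _ ok w c b mw w1 Hw _ mNu Nuw y a ya) -EFinN; congr (_%:E).
  have -> : (fun y => - u y) = (fun y => -1 * u y) by apply/funext => z; rewrite mulN1r.
  rewrite (@IQZ _ _ _ _ _ _ ok w c b mw w1 Hw (-1) u (y, a) mu uw); ring.
have BA y : [set f y] `<=` Aset y by move=> _ ->; exact: sf.2.
have PB s y : 0 <= s -> stat_policy f s y [set f y] = 1%E.
  by move=> _; rewrite /stat_policy /= diracE mem_set.
have NuC y : `|- u y| <= C * w y by rewrite normrN.
have HB y a : [set f y] a -> ((- r y a)%:E + qint qm (fun y => - u y)%R y a <= (alpha * - u y + - gam)%:E)%E.
  move=> ->; rewrite qN; last exact: sf.2.
  have := @hamiltonian_qint _ _ _ _ _ _ ok w c b Mq mw w1 Hw u mu uw y (f y) (sf.2 y).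
  rewrite (@qintE _ _ _ _ _ _ ok w c b mw w1 Hw u mu uw y (f y) (sf.2 y)) -EFinD => -[h1].
  rewrite -EFinN -EFinD lee_fin; have := Hu y; rewrite mulrDl mulrN.
  by move: h1; move: (IQ _ _ _ - _) (hamiltonian u y (f y)) (Mq * w y * u y) (alpha * u y) => *; lra.
have := @policy_verification _ _ _ _ _ _ okN w w' c b Mq M c' b' M' mw w1 c0 b0 Hw Hq M0 HrN mw' w'0
  c'0 b'0 M'0 Hqw Hw' _ api alpha (- gam) C (fun y => - u y) (fun y => [set f y]) t x al0 C0 mNu NuC
  mB BA PB HB t0.
set I := (\int[leb]_(v in `[0%R, t]) ((expR (- (alpha * v)))%:E * Erew qm r (stat_policy f) x v))%E.
have iI := @integrable_segment R _ alpha (K x) t al0 (@mErew _ x api) (fun v v0 => @Erew_le _ x v api v0).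
rewrite (_ : (\int[leb]_(v in _) (_ * Erew _ _ _ _ _))%E = (- I)%E); last first.
  rewrite /I -integrable_integralN//; apply: eq_integral => v; rewrite inE /= in_itv /= => /andP[v0 _].
  by rewrite (ErewN ok mw w1 c0 b0 Hw Hq M0 Hr mw' w'0 c'0 b'0 M'0 Hqw Hw' api x v0) muleN.
have fI : I \is a fin_num by exact: integrable_fin_num.
rewrite -(fineK (expI alpha t)) -(fineK fI) -!EFinM -EFinN -!EFinD !lee_fin mulNr.
by move: (fine I) (gam * _) (C * _ * _) => *; lra.
Qed.

End value.

Lemma stationary_admissible f : stationary Aset f -> admissible Aset (stat_policy f).
Proof.
move=> [mf fA]; split; first split; [|split|].
- by move=> t x _; rewrite /stat_policy /= diracE mem_set.
- by move=> t B _ mB; apply: (measurableT_comp (measurable_fun_dirac mB) mf).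
- by move=> x B _; exact: measurable_cst.
- by move=> x h _ _; rewrite /stat_policy; apply: continuous_subspaceT; exact: cst_continuous.
Qed.

(** The boundary term C e^(-alpha t) (w + b/c) vanishes as t grows, so the upper bound for all
    policies and the lower bound for [f] meet at [u]. *)
Lemma JoptE (alpha C : R) (u : SB -> R) (f : S -> A) x : 0 < alpha -> 0 <= C -> measurable_fun setT u ->
  (forall y, `|u y| <= C * w y) -> stationary Aset f ->
  (forall y a, Aset y a -> hamiltonian u y a <= (alpha + Mq * w y) * u y) ->
  (forall y, hamiltonian u y (f y) = (alpha + Mq * w y) * u y) -> Jopt Aset qm r alpha x = (u x)%:E.
Proof.
move=> al0 C0 mu uC sf Hle Hf.
have api := stationary_admissible sf.
apply/eqP; rewrite eq_le; apply/andP; split.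
  apply: ge_ereal_sup => _ [pi pia <-].
  apply: (@halfline_le R alpha (u x) (C * (w x + b / c)) (K x)) => // [|t t0|n].
  - exact: mErew.
  - exact: Erew_le.
  have := @reward_integral_le alpha 0 C u (ltW al0) C0 mu uC pi n%:R x pia.
  rewrite mul0e adde0 mulrAC; apply; last exact: ler0n.
  by move=> y a ya; rewrite addr0; exact: Hle.
apply: le_trans (_ : (Jdisc qm r alpha (stat_policy f) x <= _)%E); last first.
  by apply: ereal_sup_ubound; exists (stat_policy f).
apply: (@halfline_ge R alpha (u x) (C * (w x + b / c)) (K x)) => // [|t t0|n].
- exact: mErew.
- exact: Erew_le.
have := @reward_integral_ge alpha 0 C u (ltW al0) C0 mu uC f n%:R x sf api.
rewrite mul0e adde0 mulrAC; apply; last exact: ler0n.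
by move=> y; rewrite addr0 Hf.
Qed.

(** Without discount the terms in [u] and [w] are constant in [T], so they contribute O(1/T) to the
    average. *)
Lemma Vavg_le (g C : R) (u : SB -> R) pi x : 0 <= C -> measurable_fun setT u ->
  (forall y, `|u y| <= C * w y) -> admissible Aset pi ->
  (forall y a, Aset y a -> hamiltonian u y a <= g + Mq * w y * u y) -> (Vavg qm r pi x <= g%:E)%E.
Proof.
move=> C0 mu uC api Hle; rewrite /Vavg.
apply: (@limf_einf_le R _ g (u x + C * (w x + b / c))) => T T0.
have := @reward_integral_le 0 g C u (lexx 0) C0 mu uC pi T x api _ (ltW T0).
rewrite mul0r oppr0 expR0 mulr1.
have e1 : (\int[leb]_(v in `[0%R, T]) ((expR (- (0 * v)))%:E * Erew qm r pi x v) =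
    \int[leb]_(v in `[0%R, T]) Erew qm r pi x v)%E.
  by apply: eq_integral => v _; rewrite mul0r oppr0 expR0 mul1e.
have e2 : (\int[leb]_(v in `[0%R, T]) (expR (- (0 * v)))%:E = T%:E)%E.
  under eq_integral do rewrite mul0r oppr0 expR0.
  by rewrite integral_cst// mul1e /= lebesgue_measure_itv /= lte_fin T0 sube0.
rewrite e1 e2 => h.
apply: (@le_trans _ _ (T^-1 * (u x + C * (w x + b / c) + g * T))%:E).
  rewrite EFinM EFinD EFinM; apply: lee_wpmul2l; first by rewrite lee_fin invr_ge0 ltW.
  by apply: h => y a ya; rewrite add0r addrC; exact: Hle.
rewrite lee_fin; move: (u x + _) => X.
by rewrite (_ : T^-1 * _ = g + X / T)//; field; rewrite gt_eqF.
Qed.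

Lemma Vavg_ge (g C : R) (u : SB -> R) f x : 0 <= C -> measurable_fun setT u ->
  (forall y, `|u y| <= C * w y) -> stationary Aset f ->
  (forall y, g + Mq * w y * u y <= hamiltonian u y (f y)) -> (g%:E <= Vavg qm r (stat_policy f) x)%E.
Proof.
move=> C0 mu uC sf Hge; rewrite /Vavg.
apply: (@limf_einf_ge R _ g (- (u x - C * (w x + b / c)))) => T T0.
have := @reward_integral_ge 0 g C u (lexx 0) C0 mu uC f T x sf (stationary_admissible sf) _ (ltW T0).
rewrite mul0r oppr0 expR0 mulr1.
have e1 : (\int[leb]_(v in `[0%R, T]) ((expR (- (0 * v)))%:E * Erew qm r (stat_policy f) x v) =
    \int[leb]_(v in `[0%R, T]) Erew qm r (stat_policy f) x v)%E.
  by apply: eq_integral => v _; rewrite mul0r oppr0 expR0 mul1e.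
have e2 : (\int[leb]_(v in `[0%R, T]) (expR (- (0 * v)))%:E = T%:E)%E.
  under eq_integral do rewrite mul0r oppr0 expR0.
  by rewrite integral_cst// mul1e /= lebesgue_measure_itv /= lte_fin T0 sube0.
rewrite e1 e2 => h.
apply: (@le_trans _ _ (T^-1 * (u x - C * (w x + b / c) + g * T))%:E).
  rewrite lee_fin; move: (u x - _) => X.
  by rewrite (_ : T^-1 * _ = g - (- X) / T)//; field; rewrite gt_eqF.
rewrite EFinM EFinD EFinM; apply: lee_wpmul2l; first by rewrite lee_fin invr_ge0 ltW.
by apply: h => y; rewrite add0r addrC; exact: Hge.
Qed.

End criteria.

Local Open Scope ring_scope.

(** * Assembly along a vanishing sequence of discount rates *)

Lemma bounded_subsequence {R : realType} (u : nat -> R) (G : R) : (forall n, `|u n| <= G) ->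
  exists2 f : nat -> nat, (forall n, (n <= f n)%N) & cvgn (u \o f).
Proof.
move=> uG; have bu : bounded_fun u.
  by exists G; split; [exact: num_real|move=> x /ltW Gx n _; exact: le_trans (uG n) Gx].
have [f fi cf] := bolzano_weierstrass bu; exists f => //.
elim=> // n IH; apply: leq_ltn_trans IH _.
by move/increasing_seqP: fi => /(_ n); rewrite ltEnat.
Qed.

(** Without admissible policies the optimal values would be suprema of the empty set, and the
    difference of -oo with itself evaluates to -oo, below the finite bound [v1]. An admissible
    policy in turn forces every [Aset x] to be nonempty. *)
Lemma assumptionC_nonempty {R : realType} {S A : completePseudoMetricType R} (Aset : S -> set A)
  (qm : S -> A -> {measure set (borel S) -> \bar R}) (r : S -> A -> R) (w : S -> R) :
  assumptionC Aset qm r w -> forall x, exists a, Aset x a.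
Proof.
move=> [v1 [v2 [x0 [_ [_ HC]]]]].
have [pi api] : exists pi, admissible Aset pi.
  apply: contrapT => /forallNP none; have [h _] := HC x0 1 ltr01.
  have e x : Jopt Aset qm r 1 x = -oo%E.
    rewrite /Jopt (_ : [set _ | _ in _] = set0) ?ereal_sup0//.
    by apply/seteqP; split=> // z [pi api _]; exact: none api.
  by move: h; rewrite e.
exact: admissible_nonempty api.
Qed.

Theorem theorem4p2 (R : realType) (S A : completePseudoMetricType R)
  (Aset : S -> set A) (qm : S -> A -> {measure set (borel S) -> \bar R})
  (r : S -> A -> R) (w : S -> R) :
  model_ok Aset qm r ->
  assumptionA Aset qm w ->
  assumptionB Aset qm r w ->
  assumptionC Aset qm r w ->
  exists (g : R) (u1 u2 : S -> R) (fstar : S -> A),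
    in_Bw w u1 /\ in_Bw w u2 /\ stationary Aset fstar /\
    (* (a) *)
    (forall x,
       (opt_rhs Aset qm r u1 x <= g%:E)%E /\
       (g%:E <= opt_rhs Aset qm r u2 x)%E /\
       opt_rhs Aset qm r u2 x = ((r x (fstar x))%:E + qint qm u2 x (fstar x))%E) /\
    (* (b) *)
    (forall x,
       g%:E = ereal_sup [set Vavg qm r pi x | pi in admissible Aset] /\
       g%:E = Vavg qm r (stat_policy fstar) x) /\
    (* (c) *)
    (forall f : S -> A, stationary Aset f ->
       (forall x, ((r x (f x))%:E + qint qm u2 x (f x))%E = opt_rhs Aset qm r u2 x) ->
       avg_optimal Aset qm r (stat_policy f)) /\
    avg_optimal Aset qm r (stat_policy fstar).
Proof.
move=> ok [mw [w1 [c [b [Mq [c0 [b0 [Mq0 [Hw Hq]]]]]]]]].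
move=> [cA [cr [cq [cqw [[M [M0 Hr]] [w' [c' [b' [M' [mw' [w'0 [c'0 [b'0 [M'0 [Hqw Hw']]]]]]]]]]]]]]] asC.
have nA := assumptionC_nonempty asC.
have [v1 [v2 [x0 [[_ [C1 hC1]] [[_ [C2 hC2]] HC]]]]] := asC.
have w0 x : 0 <= w x by exact: le_trans ler01 (w1 x).
pose al n : R := (n.+1%:R)^-1.
have al0 n : 0 < al n by rewrite invr_gt0.
pose hamiltonian := hamiltonian ok w Mq.
have /choice[u hu] n : exists u : borel S -> R, [/\ measurable_fun setT u,
    forall y, `|u y| <= M / c * w y + M / c * b / al n,
    forall x a, Aset x a -> hamiltonian u x a <= (al n + Mq * w x) * u x &
    exists2 f, stationary Aset f & forall x, hamiltonian u x (f x) = (al n + Mq * w x) * u x].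
  exact: (discounted_equation ok mw w1 c0 b0 Mq0 Hw Hq cA cr cq cqw nA M0 Hr (al0 n)).
have mu n : measurable_fun setT (u n) by case: (hu n).
have kb0 : 0 <= M / c * b by rewrite mulr_ge0// divr_ge0// ltW.
pose Cn n := M / c + M / c * b / al n.
have Cn0 n : 0 <= Cn n by rewrite addr_ge0 ?divr_ge0// ltW.
have uCn n y : `|u n y| <= Cn n * w y.
  have [_ h _ _] := hu n; apply: le_trans (h y) _; rewrite mulrDl lerD2l ler_peMr// divr_ge0//.
  exact: ltW.
have JE n x : Jopt Aset qm r (al n) x = (u n x)%:E.
  have [_ _ Hle [f sf Hf]] := hu n.
  exact: (@JoptE _ _ _ _ _ _ ok w w' c b Mq M c' b' M' mw w1 c0 b0 Hw Hq M0 Hr mw' w'0 c'0 b'0 M'0 Hqw Hw'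
    (al n) (Cn n) (u n) f x (al0 n) (Cn0 n) (mu n) (uCn n) sf Hle Hf).
pose D := `|C1| + `|C2|.
(* Here assumption C enters: [JE] turns its bounds on the optimal values into bounds on [u n],
   uniform in [n]. *)
have hD n y : `|u n y - u n x0| <= D * w y.
  have [] := HC y (al n) (al0 n); rewrite !JE -EFinB !lee_fin => l1 l2.
  have k1 : `|v1 y| <= `|C1| * w y by apply: le_trans (hC1 y) _; rewrite ler_wpM2r// ler_norm.
  have k2 : `|v2 y| <= `|C2| * w y by apply: le_trans (hC2 y) _; rewrite ler_wpM2r// ler_norm.
  have p1 : 0 <= `|C1| * w y by rewrite mulr_ge0.
  have p2 : 0 <= `|C2| * w y by rewrite mulr_ge0.
  move: k1 k2; rewrite !ler_norml mulrDl => /andP[k1 _] /andP[_ k2].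
  by move: (u n y - u n x0) (`|C1| * w y) (`|C2| * w y) (v1 y) (v2 y) l1 l2 k1 k2 p1 p2 => *; apply/andP; split; lra.
(* The factor [al n] cancels the singular part of the bound on [u n]; the other part is handled by
   [al n <= 1]. *)
have gG n : `|al n * u n x0| <= M / c * (w x0 + b).
  have [_ h _ _] := hu n; rewrite normrM gtr0_norm//.
  apply: (@le_trans _ _ (al n * (M / c * w x0 + M / c * b / al n))); first by rewrite ler_pM2l.
  rewrite mulrDr [X in _ + X]mulrCA mulfV ?gt_eqF// mulr1 mulrDr lerD2r.
  rewrite ler_piMl//; first by apply: mulr_ge0 => //; apply: divr_ge0; exact: ltW.
  by rewrite /al invf_le1// ler1n.
have [phi phin cg] := bounded_subsequence gG.
pose g := limn ((fun n => al n * u n x0) \o phi).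
pose h n (y : borel S) := u (phi n) y + - u (phi n) x0.
(* This is [al (phi n) * u (phi n) x], split into the part at [x0] that converges to [g] and a part
   that tends to 0 because [h n x] stays bounded. *)
pose eps n (x : S) := al (phi n) * u (phi n) x0 + al (phi n) * h n x.
have mh n : measurable_fun setT (h n) by apply: measurable_funD => //; exact: measurable_cst.
have hC n y : `|h n y| <= D * w y by exact: hD.
have ceps x : eps n x @[n --> \oo] --> g.
  rewrite -[g]addr0; apply: cvgD; first exact: cg.
  have cD (k : R) : k * harmonic n @[n --> \oo] --> (0 : R).
    by rewrite -(mulr0 k); apply: cvgM; [exact: cvg_cst|exact: cvg_harmonic].
  apply: (squeeze_cvgr _ (cD (- (D * w x))) (cD (D * w x))); apply: nearW => n.
  rewrite mulNr -ler_norml normrM gtr0_norm// mulrC; apply: ler_pM => //; first exact: ltW.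
  by rewrite lef_pV2 ?posrE// ler_nat ltnS; exact: phin.
(* The rates annihilate constants, so the shift shows only in the auxiliary term Mq w u. *)
have HhE n x a : hamiltonian (h n) x a = hamiltonian (u (phi n)) x a + Mq * w x * - u (phi n) x0.
  by apply: (@hamiltonian_shift _ _ _ _ _ _ ok w c b Mq mw w1 Hw) => //; exists (Cn (phi n)).
have epsE n x : eps n x + Mq * w x * h n x = (al (phi n) + Mq * w x) * u (phi n) x + Mq * w x * - u (phi n) x0.
  by rewrite /eps /h; ring.
have hle n x a : Aset x a -> hamiltonian (h n) x a <= eps n x + Mq * w x * h n x.
  by move=> xa; rewrite HhE epsE lerD2r; have [_ _ + _] := hu (phi n); exact.
have hge n x : exists2 a, Aset x a & eps n x + Mq * w x * h n x <= hamiltonian (h n) x a.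
  have [_ _ _ [f [_ fA] fE]] := hu (phi n).
  by exists (f x) => //; rewrite HhE epsE lerD2r fE.
have [u1 [mu1 u1D Hu1]] := @liminf_supersolution _ _ _ _ _ _ ok w c b Mq mw w1 Mq0 Hw Hq h eps D g mh hC ceps hle.
have [u2 [mu2 u2D Hu2]] := @limsup_subsolution _ _ _ _ _ _ ok w c b Mq mw w1 Mq0 Hw Hq cA cr cq cqw nA
  h eps D g mh hC ceps hge.
have D0 : 0 <= D by rewrite addr_ge0.
have Bu1 : exists C, forall y : borel S, `|u1 y| <= C * w y by exists D.
have Bu2 : exists C, forall y : borel S, `|u2 y| <= C * w y by exists D.
have [f [sf fm]] := @argmax_hamiltonian _ _ _ _ _ _ ok w c b Mq mw w1 Hw cA cr cq cqw nA u2 mu2 Bu2.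
have rhs1 x a : Aset x a -> ((r x a)%:E + qint qm u1 x a = (hamiltonian u1 x a - Mq * w x * u1 x)%:E)%E.
  exact: (@hamiltonian_qint _ _ _ _ _ _ ok w c b Mq mw w1 Hw u1 mu1 Bu1 x a).
have rhs2 x a : Aset x a -> ((r x a)%:E + qint qm u2 x a = (hamiltonian u2 x a - Mq * w x * u2 x)%:E)%E.
  exact: (@hamiltonian_qint _ _ _ _ _ _ ok w c b Mq mw w1 Hw u2 mu2 Bu2 x a).
have Hf x : g + Mq * w x * u2 x <= hamiltonian u2 x (f x).
  by have [a xa ga] := Hu2 x; exact: le_trans ga (fm x a xa).
have rhsf x : opt_rhs Aset qm r u2 x = ((r x (f x))%:E + qint qm u2 x (f x))%E.
  apply/eqP; rewrite eq_le; apply/andP; split; last first.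
    by apply: ereal_sup_ubound; exists (f x) => //; exact: sf.2.
  apply: ge_ereal_sup => _ [a xa <-]; rewrite rhs2// rhs2; last exact: sf.2.
  by rewrite lee_fin lerD2r; exact: fm.
have upper pi x : admissible Aset pi -> (Vavg qm r pi x <= g%:E)%E.
  move=> api.
  exact: (@Vavg_le _ _ _ _ _ _ ok w w' c b Mq M c' b' M' mw w1 c0 b0 Hw Hq M0 Hr mw' w'0 c'0 b'0 M'0 Hqw Hw'
    g D u1 pi x D0 mu1 u1D api Hu1).
have lower f' x : stationary Aset f' ->
    (forall y, opt_rhs Aset qm r u2 y = ((r y (f' y))%:E + qint qm u2 y (f' y))%E) ->
    (g%:E <= Vavg qm r (stat_policy f') x)%E.
  move=> sf' att.
  apply: (@Vavg_ge _ _ _ _ _ _ ok w w' c b Mq M c' b' M' mw w1 c0 b0 Hw Hq M0 Hr mw' w'0 c'0 b'0 M'0 Hqw Hw'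
    g D u2 f' x D0 mu2 u2D sf') => y.
  (* Both actions attain the same supremum, so their Hamiltonians at [u2] coincide. *)
  apply: le_trans (Hf y) _; have := att y; rewrite rhsf rhs2; last exact: sf.2.
  by rewrite rhs2; [move=> [/addIr ->]|exact: sf'.2].
have opt f' : stationary Aset f' ->
    (forall y, opt_rhs Aset qm r u2 y = ((r y (f' y))%:E + qint qm u2 y (f' y))%E) ->
    avg_optimal Aset qm r (stat_policy f').
  move=> sf' att; split; first exact: stationary_admissible.
  by move=> pi x api; apply: le_trans (upper pi x api) (lower f' x sf' att).
exists g, u1, u2, f; split; first by split.
split; first by split.
split; first exact: sf.
split.
  move=> x; split.
    apply: ge_ereal_sup => _ [a xa <-]; rewrite (rhs1 x a xa) lee_fin lerBlDr; exact: Hu1.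
  split; last exact: rhsf.
  by rewrite rhsf (rhs2 x _ (sf.2 x)) lee_fin lerBrDr; exact: Hf.
split.
  move=> x; have af := stationary_admissible sf.
  have lf := lower f x sf rhsf; have uf := upper _ x af.
  split; last by apply: le_anti; rewrite lf uf.
  apply: le_anti; apply/andP; split.
    by apply: le_trans lf _; apply: ereal_sup_ubound; exists (stat_policy f).
  by apply: ge_ereal_sup => _ [pi api <-]; exact: upper.
split; last exact: (opt f sf rhsf).
by move=> f' sf' att; apply: (opt f' sf') => y; rewrite att.
Qed.
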